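(* Let $A$ be a pseudomatricial C$^*$-algebra. Then $K_0(A)$ is totally ordered and has successors and predecessors: every $g\in K_0(A)$ has a least element strictly greater than $g$ and a greatest element strictly less than $g$. If $A$ is separable, then $K_0(A)$ is a countable abelian totally ordered group, and hence is a dimension group.
   Context: $K_0(A)$ carries its usual order: the positive cone is the set of classes $[p]_0$ of projections $p$ in matrix algebras $M_n(A)$, $n\ge 1$. $M_n$ denotes the C$^*$-algebra of complex $n\times n$ matrices, $n\ge 1$. Continuous logic for C$^*$-algebras: atomic formulae are norms $\|P(x_1,\dots,x_k)\|$ of $*$-polynomials with complex coefficients (a constant $I$ for the identity may be used when the algebras are unital); formulae are built from these by applying continuous real-valued functions to finitely many formulae and by taking $\sup$ or $\inf$ of a variable over the closed unit ball. A sentence is a formula without free variables; $\varphi^A\in\mathbb{R}$ is its value in $A$. $A\equiv B$ (elementarily equivalent) if $\varphi^A=\varphi^B$ for every sentence $\varphi$. For an ultrafilter $\mathcal{U}$ on a set $J$, the ultraproduct $\prod_{\mathcal{U}}A_i$ is the C$^*$-algebra of bounded families $(a_i)_{i\in J}$ modulo those with $\lim_{\mathcal{U}}\|a_i\|=0$. A C$^*$-algebra is pseudomatricial if it is elementarily equivalent to an ultraproduct of matrix algebras $M_n$; it is not required to be infinite-dimensional. Such algebras are unital. *)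

(* Defs.v *)
From HB Require Import structures.
From mathcomp Require Import all_boot all_order all_algebra.
From mathcomp Require Import complex.
From mathcomp Require Import all_classical all_reals all_analysis.
From mathcomp Require Import generic_quotient ring lra.

Set Implicit Arguments.
Unset Strict Implicit.
Unset Printing Implicit Defensive.

Import Order.TTheory GRing.Theory Num.Theory.
Import numFieldNormedType.Exports.
Import ComplexField.Normc.

Local Open Scope classical_set_scope.
Local Open Scope ring_scope.
Local Open Scope complex_scope.
Local Open Scope quotient_scope.

(* Unital C*-algebras; 1 != 0 because [algType] extends nontrivial rings. The
   norm [cnorm] is [R]-valued, whereas the norm of the library's normed modules
   over [R[i]] is [R[i]]-valued, and on matrices the library's norm is the
   entrywise maximum, not the C*-norm. *)
HB.mixin Record isCStarAlgebra (R : realType) A of GRing.Algebra R[i] A := {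
  star : A -> A;
  cnorm : A -> R;
  starD : forall x y, star (x + y) = star x + star y;
  starZ : forall (a : R[i]) x, star (a *: x) = conjc a *: star x;
  starM : forall x y, star (x * y) = star y * star x;
  starK : involutive star;
  cnorm_eq0 : forall x, cnorm x = 0 -> x = 0;
  ler_cnormD : forall x y, cnorm (x + y) <= cnorm x + cnorm y;
  cnormZ : forall (a : R[i]) x, cnorm (a *: x) = normc a * cnorm x;
  ler_cnormM : forall x y, cnorm (x * y) <= cnorm x * cnorm y;
  cstar_identity : forall x, cnorm (star x * x) = cnorm x ^+ 2;
  cnorm_complete : forall u : nat -> A,
    (forall e : R, 0 < e -> exists N : nat, forall m n : nat,
      (N <= m)%N -> (N <= n)%N -> cnorm (u m - u n) < e) ->
    exists l : A, forall e : R, 0 < e -> exists N : nat, forall n : nat,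
      (N <= n)%N -> cnorm (u n - l) < e
}.

#[short(type="cstarAlgType")]
HB.structure Definition CStarAlgebra (R : realType) :=
  {A of isCStarAlgebra R A & GRing.Algebra R[i] A}.

Section CStarTheory.
Variables (R : realType) (A : cstarAlgType R).
Implicit Types x y : A.

Lemma cnorm0 : cnorm (0 : A) = 0.
Proof. by rewrite -(scale0r (0 : A)) cnormZ normc0 mul0r. Qed.

Lemma normcN1 : normc (-1 : R[i]) = 1.
Proof. by rewrite /normc /= sqrrN oppr0 expr0n /= addr0 expr1n sqrtr1. Qed.

Lemma cnormN x : cnorm (- x) = cnorm x.
Proof. by rewrite -scaleN1r cnormZ normcN1 mul1r. Qed.

Lemma cnormB x y : cnorm (x - y) = cnorm (y - x).
Proof. by rewrite -cnormN opprB. Qed.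

Lemma cnorm_ge0 x : 0 <= cnorm x.
Proof.
have := ler_cnormD x (- x); rewrite subrr cnorm0 cnormN => h.
lra.
Qed.

Lemma star0 : star (0 : A) = 0.
Proof. by apply: (addIr (star 0)); rewrite -starD !add0r. Qed.

Lemma starN x : star (- x) = - star x.
Proof. by apply: (addIr (star x)); rewrite -starD !addNr star0. Qed.

Lemma star1 : star (1 : A) = 1.
Proof. by rewrite -[LHS]mul1r -[X in X * _](starK 1) -starM mul1r starK. Qed.

Lemma cnorm1 : cnorm (1 : A) = 1.
Proof.
have := cstar_identity (1 : A); rewrite star1 mulr1 expr2 => h.
have n0 : cnorm (1 : A) != 0.
  by apply/eqP => /cnorm_eq0 /eqP; rewrite oner_eq0.
by apply: (mulfI n0); rewrite -h mulr1.
Qed.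

Lemma cnorm_star x : cnorm (star x) = cnorm x.
Proof.
have le y : cnorm y <= cnorm (star y).
  have [->|n0] := eqVneq (cnorm y) 0; first exact: cnorm_ge0.
  have gt0 : 0 < cnorm y by rewrite lt_def n0 cnorm_ge0.
  by rewrite -(ler_pM2r gt0) -expr2 -cstar_identity ler_cnormM.
by apply/le_anti; rewrite le andbT -{2}(starK x) le.
Qed.

Lemma ler_cnorm_sum (I : Type) (r : seq I) (P : pred I) (F : I -> A) :
  cnorm (\sum_(i <- r | P i) F i) <= \sum_(i <- r | P i) cnorm (F i).
Proof.
elim/big_ind2: _ => [|x a y b h1 h2|//]; first by rewrite cnorm0.
by apply: (le_trans (ler_cnormD _ _)); apply: lerD.
Qed.

End CStarTheory.

Lemma real_cauchy (R : realType) (u : nat -> R) :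
  (forall e : R, 0 < e -> exists N : nat, forall m n : nat,
      (N <= m)%N -> (N <= n)%N -> `|u m - u n| < e) ->
  exists l : R, forall e : R, 0 < e -> exists N : nat, forall n : nat,
      (N <= n)%N -> `|u n - l| < e.
Proof.
move=> uC; have : cvg (u @ \oo).
  apply/cauchy_cvgP/cauchy_exP => e e0.
  have [N hN] := uC e e0; exists (u N).
  by exists N => // n /= Nn; exact: hN.
move=> /cvg_ex[l ul]; exists l => e e0.
have /cvgr_dist_lt /(_ _ e0) [N _ hN] := ul.
by exists N => n /hN; rewrite distrC.
Qed.

Section OperatorNorm.
Variable R : realType.
Local Notation C := R[i].

Definition vnorm n (v : 'cV[C]_n) : R := Num.sqrt (\sum_i normc (v i 0) ^+ 2).

Definition opnorm m n (M : 'M[C]_(m, n)) : R :=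
  sup [set vnorm (M *m v) | v in [set v : 'cV[C]_n | vnorm v <= 1]].

Lemma normc_ge0 (z : C) : 0 <= normc z.
Proof. by case: z => a b; exact: sqrtr_ge0. Qed.

Lemma ler_normc_sum (I : Type) (r : seq I) (P : pred I) (F : I -> C) :
  normc (\sum_(i <- r | P i) F i) <= \sum_(i <- r | P i) normc (F i).
Proof.
elim/big_ind2: _ => [|x a y b h1 h2|//]; first by rewrite normc0.
by apply: (le_trans (le_normcD _ _)); apply: lerD.
Qed.

Lemma normc_conjc (z : C) : normc (conjc z) = normc z.
Proof. by case: z => a b /=; rewrite sqrrN. Qed.

Lemma Re_le_normc (z : C) : `|complex.Re z| <= normc z.
Proof.
by case: z => a b /=; rewrite -sqrtr_sqr ler_wsqrtr // lerDl sqr_ge0.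
Qed.

Lemma Im_le_normc (z : C) : `|complex.Im z| <= normc z.
Proof.
by case: z => a b /=; rewrite -sqrtr_sqr ler_wsqrtr // lerDr sqr_ge0.
Qed.

Lemma normc_le (z : C) : normc z <= `|complex.Re z| + `|complex.Im z|.
Proof.
case: z => a b /=; rewrite -[leRHS]ger0_norm ?addr_ge0 // -sqrtr_sqr.
rewrite ler_wsqrtr // sqrrD -(real_normK (num_real a)) -(real_normK (num_real b)).
by rewrite addrAC lerDl mulrn_wge0 // mulr_ge0.
Qed.

Lemma cauchy_schwarz n (a b : 'I_n -> R) :
  (forall i, 0 <= a i) -> (forall i, 0 <= b i) ->
  \sum_i a i * b i <=
  Num.sqrt (\sum_i a i ^+ 2) * Num.sqrt (\sum_i b i ^+ 2).
Proof.
move=> a0 b0; rewrite -sqrtrM ?sumr_ge0 // => [|i _]; last exact: sqr_ge0.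
rewrite -[leLHS]ger0_norm; last by apply: sumr_ge0 => i _; apply: mulr_ge0.
rewrite -sqrtr_sqr ler_wsqrtr // expr2 !big_distrlr /=.
rewrite -(ler_pM2l (ltr0Sn R 1)) [leLHS]mulr_natl [leRHS]mulr_natl !mulr2n.
rewrite [X in _ <= _ + X]exchange_big /= -!big_split /=.
apply: ler_sum => i _; rewrite -!big_split /=; apply: ler_sum => j _.
rewrite -subr_ge0.
have -> : a i ^+ 2 * b j ^+ 2 + a j ^+ 2 * b i ^+ 2 -
  (a i * b i * (a j * b j) + a i * b i * (a j * b j)) =
  (a i * b j - a j * b i) ^+ 2 by ring.
exact: sqr_ge0.
Qed.

Lemma vnorm_ge0 n (v : 'cV[C]_n) : 0 <= vnorm v.
Proof. exact: sqrtr_ge0. Qed.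

Lemma vnormsq_ge0 n (v : 'cV[C]_n) : 0 <= \sum_i normc (v i 0) ^+ 2.
Proof. by apply: sumr_ge0 => i _; exact: sqr_ge0. Qed.

Lemma vnorm_sqr n (v : 'cV[C]_n) :
  vnorm v ^+ 2 = \sum_i normc (v i 0) ^+ 2.
Proof. by rewrite sqr_sqrtr ?vnormsq_ge0. Qed.

Lemma vnorm0 n : vnorm (0 : 'cV[C]_n) = 0.
Proof.
by rewrite /vnorm big1 ?sqrtr0 // => i _; rewrite mxE normc0 expr0n.
Qed.

Lemma vnormD n (v w : 'cV[C]_n) : vnorm (v + w) <= vnorm v + vnorm w.
Proof.
rewrite -(ler_pXn2r (ltn0Sn 1)) ?nnegrE ?addr_ge0 ?vnorm_ge0 //.
rewrite vnorm_sqr sqrrD !vnorm_sqr.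
apply: (@le_trans _ _ (\sum_i (normc (v i 0) + normc (w i 0)) ^+ 2)).
  apply: ler_sum => i _; rewrite mxE ler_pXn2r ?nnegrE ?addr_ge0 ?normc_ge0 //.
  exact: le_normcD.
under eq_bigr => i _ do rewrite sqrrD.
rewrite !big_split /= lerD2r lerD2l -mulr2n ler_pMn2r //.
apply: cauchy_schwarz => i; exact: normc_ge0.
Qed.

Lemma vnormZ n (a : C) (v : 'cV[C]_n) : vnorm (a *: v) = normc a * vnorm v.
Proof.
rewrite /vnorm; under eq_bigr => i _ do rewrite mxE normcM exprMn.
by rewrite -mulr_sumr sqrtrM ?sqr_ge0 // sqrtr_sqr ger0_norm ?normc_ge0.
Qed.

Lemma normc_le_vnorm n (v : 'cV[C]_n) i : normc (v i 0) <= vnorm v.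
Proof.
rewrite -[leLHS]ger0_norm ?normc_ge0 // -sqrtr_sqr ler_wsqrtr //.
by rewrite (bigD1 i) //= lerDl sumr_ge0 // => j _; exact: sqr_ge0.
Qed.

Lemma vnorm_le_sum n (v : 'cV[C]_n) : vnorm v <= \sum_i normc (v i 0).
Proof.
have s0 : 0 <= \sum_i normc (v i 0) by apply: sumr_ge0 => i _; exact: normc_ge0.
rewrite -(ler_pXn2r (ltn0Sn 1)) ?nnegrE ?vnorm_ge0 // vnorm_sqr.
rewrite [leRHS]expr2 big_distrlr /=; apply: ler_sum => i _.
rewrite (bigD1 i) //= expr2 lerDl sumr_ge0 // => j _.
by rewrite mulr_ge0 ?normc_ge0.
Qed.

Lemma vnorm_delta n (j : 'I_n) : vnorm (delta_mx j 0 : 'cV[C]_n) = 1.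
Proof.
rewrite /vnorm (bigD1 j) //= big1 ?addr0 => [|i ij].
  by rewrite mxE !eqxx normc1 expr1n sqrtr1.
by rewrite mxE (negbTE ij) andFb normc0 expr0n.
Qed.

Lemma vnorm_mul_le m n (M : 'M[C]_(m, n)) (v : 'cV[C]_n) :
  vnorm (M *m v) <= (\sum_i \sum_j normc (M i j)) * vnorm v.
Proof.
apply: (le_trans (vnorm_le_sum _)); rewrite mulr_suml; apply: ler_sum => i _.
rewrite mxE mulr_suml; apply: (le_trans (ler_normc_sum _ _ _)).
apply: ler_sum => j _; rewrite normcM ler_wpM2l ?normc_ge0 //.
exact: normc_le_vnorm.
Qed.

Lemma opnorm_has_sup m n (M : 'M[C]_(m, n)) :
  has_sup [set vnorm (M *m v) | v in [set v : 'cV[C]_n | vnorm v <= 1]].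
Proof.
split; first by exists (vnorm (M *m 0)), 0 => //=; rewrite vnorm0.
exists (\sum_i \sum_j normc (M i j)) => _ [v /= v1 <-].
apply: (le_trans (vnorm_mul_le _ _)); rewrite ler_piMr // sumr_ge0 // => i _.
by apply: sumr_ge0 => j _; exact: normc_ge0.
Qed.

Lemma opnorm_ub m n (M : 'M[C]_(m, n)) v :
  vnorm v <= 1 -> vnorm (M *m v) <= opnorm M.
Proof. by move=> v1; apply: sup_upper_bound; [exact: opnorm_has_sup|exists v]. Qed.

Lemma opnorm_lub m n (M : 'M[C]_(m, n)) (c : R) :
  (forall v, vnorm v <= 1 -> vnorm (M *m v) <= c) -> opnorm M <= c.
Proof.
move=> h; apply: sup_le_ub; first by case: (opnorm_has_sup M).
by move=> _ [v /= v1 <-]; exact: h.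
Qed.

Lemma opnorm_ge0 m n (M : 'M[C]_(m, n)) : 0 <= opnorm M.
Proof. by apply: le_trans (opnorm_ub M (v := 0) _); rewrite ?vnorm_ge0 ?vnorm0. Qed.

Lemma normc_realc (x : R) : normc x%:C = `|x|.
Proof. by rewrite /= expr0n /= addr0 sqrtr_sqr. Qed.

Lemma vnorm_eq0 n (v : 'cV[C]_n) : vnorm v = 0 -> v = 0.
Proof.
move=> v0; apply/matrixP => i j; rewrite ord1 mxE; apply: eq0_normc.
by apply/le_anti; rewrite normc_ge0 -v0 normc_le_vnorm.
Qed.

Lemma opnormP m n (M : 'M[C]_(m, n)) v : vnorm (M *m v) <= opnorm M * vnorm v.
Proof.
have [/vnorm_eq0 ->|n0] := eqVneq (vnorm v) 0.
  by rewrite mulmx0 !vnorm0 mulr0.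
have gt0 : 0 < vnorm v by rewrite lt_def n0 vnorm_ge0.
have := @opnorm_ub _ _ M ((vnorm v)^-1%:C *: v).
rewrite vnormZ -scalemxAr vnormZ normc_realc ger0_norm ?invr_ge0 ?vnorm_ge0 //.
by rewrite mulVf // => /(_ (lexx _)); rewrite ler_pdivrMl // mulrC.
Qed.

Lemma opnormD m n (M N : 'M[C]_(m, n)) : opnorm (M + N) <= opnorm M + opnorm N.
Proof.
apply: opnorm_lub => v v1; rewrite mulmxDl; apply: (le_trans (vnormD _ _)).
by apply: lerD; exact: opnorm_ub.
Qed.

Lemma opnormM m n p (M : 'M[C]_(m, n)) (N : 'M[C]_(n, p)) :
  opnorm (M *m N) <= opnorm M * opnorm N.
Proof.
apply: opnorm_lub => v v1; rewrite -mulmxA; apply: (le_trans (opnormP _ _)).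
by rewrite ler_wpM2l ?opnorm_ge0 // opnorm_ub.
Qed.

Lemma opnormZ_le m n (a : C) (M : 'M[C]_(m, n)) :
  opnorm (a *: M) <= normc a * opnorm M.
Proof.
apply: opnorm_lub => v v1; rewrite -scalemxAl vnormZ ler_wpM2l ?normc_ge0 //.
exact: opnorm_ub.
Qed.

Lemma opnormZ m n (a : C) (M : 'M[C]_(m, n)) :
  opnorm (a *: M) = normc a * opnorm M.
Proof.
apply/le_anti; rewrite opnormZ_le /=.
have [->|a0] := eqVneq a 0; first by rewrite normc0 mul0r opnorm_ge0.
have na0 : 0 < normc a.
  by rewrite lt_def normc_ge0 andbT; apply: contraNN a0 => /eqP/eq0_normc->.
rewrite -ler_pdivlMl // -normcV.
by apply: le_trans (opnormZ_le _ _); rewrite scalerA mulVf // scale1r.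
Qed.

Lemma entry_le_opnorm m n (M : 'M[C]_(m, n)) i j : normc (M i j) <= opnorm M.
Proof.
have : vnorm (M *m delta_mx j 0) <= opnorm M by rewrite opnorm_ub ?vnorm_delta.
by apply: le_trans; rewrite -colE; have := normc_le_vnorm (col j M) i; rewrite mxE.
Qed.

Lemma opnorm_le_sum m n (M : 'M[C]_(m, n)) :
  opnorm M <= \sum_i \sum_j normc (M i j).
Proof.
apply: opnorm_lub => v v1; apply: (le_trans (vnorm_mul_le _ _)).
rewrite ler_piMr // sumr_ge0 // => i _.
by apply: sumr_ge0 => j _; exact: normc_ge0.
Qed.

Lemma opnorm_eq0 m n (M : 'M[C]_(m, n)) : opnorm M = 0 -> M = 0.
Proof.
move=> M0; apply/matrixP => i j; rewrite mxE; apply: eq0_normc.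
by apply/le_anti; rewrite normc_ge0 -M0 entry_le_opnorm.
Qed.

Definition ctrmx m n (M : 'M[C]_(m, n)) : 'M[C]_(n, m) := map_mx conjc M^T.

Lemma ctrmxD m n (M N : 'M[C]_(m, n)) : ctrmx (M + N) = ctrmx M + ctrmx N.
Proof. by apply/matrixP => i j; rewrite !mxE rmorphD. Qed.

Lemma ctrmxZ m n a (M : 'M[C]_(m, n)) : ctrmx (a *: M) = conjc a *: ctrmx M.
Proof. by apply/matrixP => i j; rewrite !mxE rmorphM. Qed.

Lemma ctrmxM m n p (M : 'M[C]_(m, n)) (N : 'M[C]_(n, p)) :
  ctrmx (M *m N) = ctrmx N *m ctrmx M.
Proof. by rewrite /ctrmx trmx_mul map_mxM. Qed.

Lemma ctrmxK m n (M : 'M[C]_(m, n)) : ctrmx (ctrmx M) = M.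
Proof. by apply/matrixP => i j; rewrite !mxE conjcK. Qed.

Lemma mul_conjc (z : C) : conjc z * z = (normc z ^+ 2)%:C.
Proof.
case: z => a b; rewrite /= sqr_sqrtr ?addr_ge0 ?sqr_ge0 //.
by apply/eqP; rewrite eq_complex /=; apply/andP; split; apply/eqP; ring.
Qed.

Lemma ctrmx_mul_vec n (v : 'cV[C]_n) : (ctrmx v *m v) 0 0 = (vnorm v ^+ 2)%:C.
Proof.
rewrite vnorm_sqr mxE rmorph_sum; apply: eq_bigr => i _.
by rewrite !mxE mul_conjc.
Qed.

Lemma dot_le n (v w : 'cV[C]_n) : normc ((ctrmx v *m w) 0 0) <= vnorm v * vnorm w.
Proof.
rewrite mxE; apply: (le_trans (ler_normc_sum _ _ _)).
under eq_bigr => i _ do rewrite !mxE normcM normc_conjc.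
by apply: cauchy_schwarz => i; exact: normc_ge0.
Qed.

Lemma opnorm_sqr_le m n (M : 'M[C]_(m, n)) :
  opnorm M ^+ 2 <= opnorm (ctrmx M *m M).
Proof.
rewrite -[leRHS]sqr_sqrtr ?opnorm_ge0 // ler_pXn2r ?nnegrE ?opnorm_ge0 ?sqrtr_ge0 //.
apply: opnorm_lub => v v1.
rewrite -[leLHS]ger0_norm ?vnorm_ge0 // -sqrtr_sqr ler_wsqrtr //.
rewrite -[leLHS]ger0_norm ?sqr_ge0 // -normc_realc -ctrmx_mul_vec.
rewrite ctrmxM -mulmxA [ctrmx M *m _]mulmxA; apply: (le_trans (dot_le _ _)).
rewrite -[leRHS]mul1r ler_pM ?vnorm_ge0 //; exact: opnorm_ub.
Qed.

Lemma opnorm_ctrmx_ge m n (M : 'M[C]_(m, n)) : opnorm M <= opnorm (ctrmx M).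
Proof.
have [->|n0] := eqVneq (opnorm M) 0; first exact: opnorm_ge0.
have gt0 : 0 < opnorm M by rewrite lt_def n0 opnorm_ge0.
rewrite -(ler_pM2r gt0) -expr2; apply: (le_trans (opnorm_sqr_le _)).
exact: opnormM.
Qed.

Lemma opnorm_cstar m n (M : 'M[C]_(m, n)) :
  opnorm (ctrmx M *m M) = opnorm M ^+ 2.
Proof.
apply/le_anti; rewrite opnorm_sqr_le andbT.
apply: (le_trans (opnormM _ _)); rewrite expr2 ler_wpM2r ?opnorm_ge0 //.
by have := opnorm_ctrmx_ge (ctrmx M); rewrite ctrmxK.
Qed.

Lemma complexc_cauchy (u : nat -> C) :
  (forall e : R, 0 < e -> exists N : nat, forall m n : nat,
      (N <= m)%N -> (N <= n)%N -> normc (u m - u n) < e) ->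
  exists l : C, forall e : R, 0 < e -> exists N : nat, forall n : nat,
      (N <= n)%N -> normc (u n - l) < e.
Proof.
move=> uC.
have [|a ha] := @real_cauchy R (fun n => complex.Re (u n)).
  move=> e /uC[N hN]; exists N => m n Nm Nn; apply: le_lt_trans (hN m n Nm Nn).
  by have := Re_le_normc (u m - u n); rewrite raddfB.
have [|b hb] := @real_cauchy R (fun n => complex.Im (u n)).
  move=> e /uC[N hN]; exists N => m n Nm Nn; apply: le_lt_trans (hN m n Nm Nn).
  by have := Im_le_normc (u m - u n); rewrite raddfB.
exists (a +i* b) => e e0.
have e20 : 0 < e / 2 by rewrite divr_gt0.
have [N1 h1] := ha _ e20; have [N2 h2] := hb _ e20.
exists (maxn N1 N2) => n; rewrite geq_max => /andP[n1 n2].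
apply: le_lt_trans (normc_le _) _; rewrite !raddfB /= (splitr e).
by apply: ltrD; [exact: h1|exact: h2].
Qed.

Lemma opnorm_complete m n (u : nat -> 'M[C]_(m, n)) :
  (forall e : R, 0 < e -> exists N : nat, forall p q : nat,
      (N <= p)%N -> (N <= q)%N -> opnorm (u p - u q) < e) ->
  exists l, forall e : R, 0 < e -> exists N : nat, forall p : nat,
      (N <= p)%N -> opnorm (u p - l) < e.
Proof.
move=> uC.
have /choice[l hl] : forall ij : 'I_m * 'I_n, exists l : C,
  forall e : R, 0 < e -> exists N : nat, forall p : nat,
      (N <= p)%N -> normc (u p ij.1 ij.2 - l) < e.
  move=> [i j]; apply: complexc_cauchy => e /uC[N hN]; exists N => p q Np Nq /=.
  apply: le_lt_trans (hN p q Np Nq).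
  by have := entry_le_opnorm (u p - u q) i j; rewrite !mxE.
exists (\matrix_(i, j) l (i, j)) => e e0.
have e10 : 0 < e / (m * n).+1%:R by rewrite divr_gt0.
have /choice[N hN] : forall ij : 'I_m * 'I_n, exists N : nat, forall p : nat,
      (N <= p)%N -> normc (u p ij.1 ij.2 - l ij) < e / (m * n).+1%:R.
  by move=> ij; exact: hl.
exists (\max_ij N ij) => p Np; apply: le_lt_trans (opnorm_le_sum _) _.
apply: (@le_lt_trans _ _ (\sum_(i < m) \sum_(j < n) e / (m * n).+1%:R)).
  apply: ler_sum => i _; apply: ler_sum => j _; rewrite !mxE ltW //.
  by apply: (hN (i, j)); apply: leq_trans Np; exact: leq_bigmax.
rewrite !sumr_const !card_ord -mulrnA -[ltLHS]mulr_natr mulrAC.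
by rewrite ltr_pdivrMr ?ltr0n // ltr_pM2l // ltr_nat mulnC ltnS.
Qed.

End OperatorNorm.

HB.instance Definition _ (R : realType) (n : nat) :=
  isCStarAlgebra.Build R 'M[R[i]]_n.+1
    (@ctrmxD R n.+1 n.+1) (@ctrmxZ R n.+1 n.+1) (@ctrmxM R n.+1 n.+1 n.+1)
    (@ctrmxK R n.+1 n.+1) (@opnorm_eq0 R n.+1 n.+1) (@opnormD R n.+1 n.+1)
    (@opnormZ R n.+1 n.+1) (@opnormM R n.+1 n.+1 n.+1)
    (@opnorm_cstar R n.+1 n.+1) (@opnorm_complete R n.+1 n.+1).

Section UltraLimit.
Variables (R : realType) (J : Type) (U : set_system J) (hU : UltraFilter U).

Definition ulim (f : J -> R) : R := lim (f @ U).

Lemma ulimP (f : J -> R) (M : R) :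
  (forall j, `|f j| <= M) -> f @ U --> ulim f.
Proof.
move=> fM; suff : cvg (f @ U) by [].
have fI : U (f @^-1` `[- M, M]%classic).
  apply: (filterS _ filterT) => j _ /=.
  by have := fM j; rewrite in_itv /= ler_norml.
have [l [_ lC]] : `[- M, M]%classic `&` cluster (f @ U) !=set0.
  exact: (@segment_compact R (- M) M (f @ U)).
apply/cvg_ex; exists l; apply/cvgrPdist_lt => e e0.
have [//|nU] := in_ultra_setVsetC [set j | `|l - f j| < e] hU.
have [||x [/= xn xb]] := lC (~` ball l e) (ball l e); last by [].
  exact: nU.
exact: nbhsx_ballx.
Qed.

Lemma ulim_unique (f : J -> R) (l : R) : f @ U --> l -> ulim f = l.
Proof. by move=> fl; apply: cvg_lim. Qed.

Lemma ulim_le (f g : J -> R) (l l' : R) : f @ U --> l -> g @ U --> l' ->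
  (forall j, f j <= g j) -> l <= l'.
Proof.
move=> fl gl fg; rewrite -subr_ge0.
have gfl : (fun j => g j - f j) @ U --> l' - l by apply: cvgB.
by apply: (cvgr_to_ge gfl); apply: filterE => j; rewrite subr_ge0.
Qed.

End UltraLimit.

Section Ultraproduct.
Variables (R : realType) (J : Type) (U : set_system J) (hU : UltraFilter U).
Variable A : J -> cstarAlgType R.
Local Notation C := R[i].

Record bounded_family := BoundedFamily {
  family_val :> forall j, A j;
  family_bounded : exists M : R, forall j, cnorm (family_val j) <= M }.

HB.instance Definition _ := gen_eqMixin bounded_family.
HB.instance Definition _ := gen_choiceMixin bounded_family.

Implicit Types a b : bounded_family.

Lemma family_ext a b : (forall j, a j = b j) -> a = b.
Proof.
case: a b => [a aM] [b bM] /= ab.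
have e : a = b by apply: functional_extensionality_dep.
by rewrite -e in bM *; congr BoundedFamily; exact: Prop_irrelevance.
Qed.

Lemma fadd_bounded a b : exists M : R, forall j, cnorm (a j + b j) <= M.
Proof.
have [[M aM] [N bN]] := (family_bounded a, family_bounded b).
by exists (M + N) => j; apply: (le_trans (ler_cnormD _ _)); exact: lerD.
Qed.

Lemma fmul_bounded a b : exists M : R, forall j, cnorm (a j * b j) <= M.
Proof.
have [[M aM] [N bN]] := (family_bounded a, family_bounded b).
exists (M * N) => j; apply: (le_trans (ler_cnormM _ _)).
by apply: ler_pM => //; exact: cnorm_ge0.
Qed.

Lemma fscale_bounded (c : C) a : exists M : R, forall j, cnorm (c *: a j) <= M.
Proof.
have [M aM] := family_bounded a; exists (normc c * M) => j.
by rewrite cnormZ ler_wpM2l // normc_ge0.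
Qed.

Lemma fopp_bounded a : exists M : R, forall j, cnorm (- a j) <= M.
Proof. by have [M aM] := family_bounded a; exists M => j; rewrite cnormN. Qed.

Lemma fstar_bounded a : exists M : R, forall j, cnorm (star (a j)) <= M.
Proof. by have [M aM] := family_bounded a; exists M => j; rewrite cnorm_star. Qed.

Lemma fzero_bounded : exists M : R, forall j, cnorm (0 : A j) <= M.
Proof. by exists 0 => j; rewrite cnorm0. Qed.

Lemma fone_bounded : exists M : R, forall j, cnorm (1 : A j) <= M.
Proof. by exists 1 => j; rewrite cnorm1. Qed.

Definition fadd a b := BoundedFamily (fadd_bounded a b).
Definition fmul a b := BoundedFamily (fmul_bounded a b).
Definition fscale c a := BoundedFamily (fscale_bounded c a).
Definition fopp a := BoundedFamily (fopp_bounded a).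
Definition fstar a := BoundedFamily (fstar_bounded a).
Definition fzero := BoundedFamily fzero_bounded.
Definition fone := BoundedFamily fone_bounded.

Definition fnorm a : R := ulim U (fun j => cnorm (a j)).

Lemma fnorm_cvg a : (fun j => cnorm (a j)) @ U --> fnorm a.
Proof.
have [M aM] := family_bounded a; apply: (@ulimP _ _ _ hU _ M) => j.
by rewrite ger0_norm ?cnorm_ge0.
Qed.

Lemma fnorm_unique a (l : R) : (fun j => cnorm (a j)) @ U --> l -> fnorm a = l.
Proof. exact: ulim_unique. Qed.

Lemma fnorm_ge0 a : 0 <= fnorm a.
Proof.
apply: (cvgr_to_ge (@fnorm_cvg a)); apply: filterE => j; exact: cnorm_ge0.
Qed.

Lemma fnorm_le a (c : R) : (\forall j \near U, cnorm (a j) <= c) -> fnorm a <= c.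
Proof. exact: (cvgr_to_le (@fnorm_cvg a)). Qed.

Lemma fnormD a b : fnorm (fadd a b) <= fnorm a + fnorm b.
Proof.
apply: (ulim_le hU (@fnorm_cvg (fadd a b))).
  by apply: cvgD; exact: fnorm_cvg.
by move=> j; exact: ler_cnormD.
Qed.

Lemma fnormM a b : fnorm (fmul a b) <= fnorm a * fnorm b.
Proof.
apply: (ulim_le hU (@fnorm_cvg (fmul a b))).
  by apply: cvgM; exact: fnorm_cvg.
by move=> j; exact: ler_cnormM.
Qed.

Lemma fnormZ c a : fnorm (fscale c a) = normc c * fnorm a.
Proof.
apply: fnorm_unique; under eq_cvg => j do rewrite /= cnormZ.
by apply: cvgMr; exact: fnorm_cvg.
Qed.

Lemma fnorm_cstar a : fnorm (fmul (fstar a) a) = fnorm a ^+ 2.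
Proof.
apply: fnorm_unique; under eq_cvg => j do rewrite /= cstar_identity.
by apply: cvgM; exact: fnorm_cvg.
Qed.

Lemma fnorm_eq a b : (forall j, cnorm (a j) = cnorm (b j)) -> fnorm a = fnorm b.
Proof.
move=> ab; apply: fnorm_unique; under eq_cvg => j do rewrite ab.
exact: fnorm_cvg.
Qed.

Definition fsub a b := fadd a (fopp b).

Lemma fnorm_zero : fnorm fzero = 0.
Proof.
rewrite (_ : fzero = fscale 0 fzero) ?fnormZ ?normc0 ?mul0r //.
by apply: family_ext => j /=; rewrite scale0r.
Qed.

(* [fnorm] is a genuine limit (lemma [fnorm_cvg]), so this says that the norms
   of the difference tend to 0 along [U]. *)
Definition ueq : rel bounded_family := fun a b => `[< fnorm (fsub a b) = 0 >].

Lemma ueq_refl : reflexive ueq.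
Proof.
move=> a; apply/asboolP; rewrite -[RHS]fnorm_zero; apply: fnorm_eq => j /=.
by rewrite subrr.
Qed.

Lemma fsubC a b : fnorm (fsub a b) = fnorm (fsub b a).
Proof. by apply: fnorm_eq => j /=; rewrite cnormB. Qed.

Lemma fsub_trans b a c :
  fnorm (fsub a c) <= fnorm (fsub a b) + fnorm (fsub b c).
Proof.
apply: le_trans (fnormD _ _); rewrite le_eqVlt; apply/orP; left; apply/eqP.
by apply: fnorm_eq => j /=; rewrite addrA subrK.
Qed.

Lemma ueq_sym : symmetric ueq.
Proof. by move=> a b; rewrite /ueq fsubC. Qed.

Lemma ueq_trans : transitive ueq.
Proof.
move=> b a c /asboolP ab /asboolP bc; apply/asboolP/le_anti.
by rewrite fnorm_ge0 andbT -[leRHS](addr0 0) -{1}ab -bc fsub_trans.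
Qed.

Canonical ueq_equiv := EquivRel ueq ueq_refl ueq_sym ueq_trans.

Definition ultraproduct := {eq_quot ueq}.

HB.instance Definition _ := Choice.on ultraproduct.
HB.instance Definition _ := EqQuotient.on ultraproduct.

Notation upi := (\pi_ultraproduct).

Lemma upiP a b : fnorm (fsub a b) = 0 -> upi a = upi b.
Proof. by move=> ab; apply/eqmodP/asboolP. Qed.

Lemma upiP_le a b : fnorm (fsub a b) <= 0 -> upi a = upi b.
Proof. by move=> h; apply: upiP; apply/le_anti; rewrite h fnorm_ge0. Qed.

Lemma upi_inj a b : upi a = upi b -> fnorm (fsub a b) = 0.
Proof. by move/eqmodP/asboolP. Qed.

Lemma upi_repr (x : ultraproduct) : upi (repr x) = x.
Proof. exact: reprK. Qed.

Lemma urepr_pi a : fnorm (fsub (repr (upi a)) a) = 0.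
Proof. by apply: upi_inj; rewrite upi_repr. Qed.

Definition uadd (x y : ultraproduct) : ultraproduct := upi (fadd (repr x) (repr y)).
Definition umul (x y : ultraproduct) : ultraproduct := upi (fmul (repr x) (repr y)).
Definition uscale (c : C) (x : ultraproduct) : ultraproduct := upi (fscale c (repr x)).
Definition uopp (x : ultraproduct) : ultraproduct := upi (fopp (repr x)).
Definition ustar (x : ultraproduct) : ultraproduct := upi (fstar (repr x)).
Definition uzero : ultraproduct := upi fzero.
Definition uone : ultraproduct := upi fone.
Definition unorm (x : ultraproduct) : R := fnorm (repr x).

Lemma upi_add a b : uadd (upi a) (upi b) = upi (fadd a b).
Proof.
apply: upiP_le.
apply: (@le_trans _ _ (fnorm (fadd (fsub (repr (upi a)) a) (fsub (repr (upi b)) b)))).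
  rewrite le_eqVlt; apply/orP; left; apply/eqP; apply: fnorm_eq => j /=.
  by rewrite opprD addrACA.
by apply: (le_trans (fnormD _ _)); rewrite !urepr_pi addr0.
Qed.

Lemma upi_opp a : uopp (upi a) = upi (fopp a).
Proof.
apply: upiP; rewrite -[RHS](urepr_pi a); apply: fnorm_eq => j /=.
by rewrite -opprD cnormN.
Qed.

Lemma upi_scale c a : uscale c (upi a) = upi (fscale c a).
Proof.
apply: upiP; rewrite -[RHS](mulr0 (normc c)) -[X in _ * X](urepr_pi a) -fnormZ.
by apply: fnorm_eq => j /=; rewrite scalerBr.
Qed.

Lemma upi_star a : ustar (upi a) = upi (fstar a).
Proof.
apply: upiP; rewrite -[RHS](urepr_pi a); apply: fnorm_eq => j /=.
by rewrite -starN -starD cnorm_star.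
Qed.

Lemma upi_mul a b : umul (upi a) (upi b) = upi (fmul a b).
Proof.
apply: upiP_le.
set a' := repr (upi a); set b' := repr (upi b).
apply: (@le_trans _ _ (fnorm (fadd (fmul (fsub a' a) b') (fmul a (fsub b' b))))).
  rewrite le_eqVlt; apply/orP; left; apply/eqP; apply: fnorm_eq => j /=.
  by rewrite mulrBl mulrBr addrA subrK.
apply: (le_trans (fnormD _ _)).
apply: (@le_trans _ _ (0 * fnorm b' + fnorm a * 0)).
  by rewrite -{1}(urepr_pi a) -(urepr_pi b) lerD ?fnormM.
by rewrite mul0r mulr0 addr0.
Qed.

Lemma upi_norm a : unorm (upi a) = fnorm a.
Proof.
have le b c : fnorm (fsub b c) = 0 -> fnorm b <= fnorm c.
  move=> bc; rewrite -[leRHS](add0r) -bc; apply: le_trans (fnormD _ _).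
  rewrite le_eqVlt; apply/orP; left; apply/eqP; apply: fnorm_eq => j /=.
  by rewrite subrK.
by apply/le_anti; rewrite !le // ?[fnorm (fsub a _)]fsubC ?urepr_pi.
Qed.

Lemma upi_ind (P : ultraproduct -> Prop) : (forall a, P (upi a)) -> forall x, P x.
Proof. by move=> h x; rewrite -(upi_repr x). Qed.

Definition upiE := (upi_add, upi_opp, upi_scale, upi_star, upi_mul, upi_norm).

Lemma uaddA : associative uadd.
Proof.
elim/upi_ind=> a; elim/upi_ind=> b; elim/upi_ind=> c; rewrite !upiE; congr upi.
by apply: family_ext => j /=; rewrite addrA.
Qed.

Lemma uaddC : commutative uadd.
Proof.
elim/upi_ind=> a; elim/upi_ind=> b; rewrite !upiE; congr upi.
by apply: family_ext => j /=; rewrite addrC.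
Qed.

Lemma uadd0 : left_id uzero uadd.
Proof.
elim/upi_ind=> a; rewrite !upiE; congr upi.
by apply: family_ext => j /=; rewrite add0r.
Qed.

Lemma uaddN : left_inverse uzero uopp uadd.
Proof.
elim/upi_ind=> a; rewrite !upiE; congr upi.
by apply: family_ext => j /=; rewrite addNr.
Qed.

HB.instance Definition _ := GRing.isZmodule.Build ultraproduct
  uaddA uaddC uadd0 uaddN.

Lemma umulA : associative umul.
Proof.
elim/upi_ind=> a; elim/upi_ind=> b; elim/upi_ind=> c; rewrite !upiE; congr upi.
by apply: family_ext => j /=; rewrite mulrA.
Qed.

Lemma umul1l : left_id uone umul.
Proof.
elim/upi_ind=> a; rewrite !upiE; congr upi.
by apply: family_ext => j /=; rewrite mul1r.
Qed.

Lemma umul1r : right_id uone umul.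
Proof.
elim/upi_ind=> a; rewrite !upiE; congr upi.
by apply: family_ext => j /=; rewrite mulr1.
Qed.

Lemma umulDl : left_distributive umul uadd.
Proof.
elim/upi_ind=> a; elim/upi_ind=> b; elim/upi_ind=> c; rewrite !upiE; congr upi.
by apply: family_ext => j /=; rewrite mulrDl.
Qed.

Lemma umulDr : right_distributive umul uadd.
Proof.
elim/upi_ind=> a; elim/upi_ind=> b; elim/upi_ind=> c; rewrite !upiE; congr upi.
by apply: family_ext => j /=; rewrite mulrDr.
Qed.

Lemma uone_neq0 : uone != uzero.
Proof.
apply/eqP => /upi_inj h; have : fnorm (fsub fone fzero) = 1.
  apply: fnorm_unique; under eq_cvg => j do rewrite /= subr0 cnorm1.
  exact: cvg_cst.
by rewrite h => /eqP; rewrite eq_sym oner_eq0.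
Qed.

HB.instance Definition _ := GRing.Zmodule_isNzRing.Build ultraproduct
  umulA umul1l umul1r umulDl umulDr uone_neq0.

Lemma uscaleA (c d : C) (x : ultraproduct) :
  uscale c (uscale d x) = uscale (c * d) x.
Proof.
elim/upi_ind: x => a; rewrite !upiE; congr upi.
by apply: family_ext => j /=; rewrite scalerA.
Qed.

Lemma uscale1 : left_id 1 uscale.
Proof.
elim/upi_ind=> a; rewrite !upiE; congr upi.
by apply: family_ext => j /=; rewrite scale1r.
Qed.

Lemma uscaleDr : right_distributive uscale +%R.
Proof.
move=> c; elim/upi_ind=> a; elim/upi_ind=> b; rewrite /GRing.add /= !upiE.
by congr upi; apply: family_ext => j /=; rewrite scalerDr.
Qed.

Lemma uscaleDl (x : ultraproduct) : {morph uscale^~ x : c d / c + d}.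
Proof.
move=> c d; elim/upi_ind: x => a; rewrite [in RHS]/GRing.add /= !upiE.
by congr upi; apply: family_ext => j /=; rewrite scalerDl.
Qed.

HB.instance Definition _ := GRing.Zmodule_isLmodule.Build C ultraproduct
  uscaleA uscale1 uscaleDr uscaleDl.

Lemma uscaleAl (c : C) (x y : ultraproduct) : c *: (x * y) = (c *: x) * y.
Proof.
elim/upi_ind: x => a; elim/upi_ind: y => b.
rewrite /GRing.mul /GRing.scale /= !upiE.
by congr upi; apply: family_ext => j /=; rewrite scalerAl.
Qed.

HB.instance Definition _ := GRing.Lmodule_isLalgebra.Build C ultraproduct uscaleAl.

Lemma uscaleAr (c : C) (x y : ultraproduct) : c *: (x * y) = x * (c *: y).
Proof.
elim/upi_ind: x => a; elim/upi_ind: y => b.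
rewrite /GRing.mul /GRing.scale /= !upiE.
by congr upi; apply: family_ext => j /=; rewrite scalerAr.
Qed.

HB.instance Definition _ := GRing.Lalgebra_isAlgebra.Build C ultraproduct uscaleAr.

Lemma upiD a b : upi (fadd a b) = upi a + upi b.
Proof. by rewrite -upi_add. Qed.
Lemma upiN a : upi (fopp a) = - upi a.
Proof. by rewrite -upi_opp. Qed.
Lemma upiB a b : upi (fsub a b) = upi a - upi b.
Proof. by rewrite upiD upiN. Qed.
Lemma upiM a b : upi (fmul a b) = upi a * upi b.
Proof. by rewrite -upi_mul. Qed.
Lemma upiZ c a : upi (fscale c a) = c *: upi a.
Proof. by rewrite -upi_scale. Qed.

Lemma ustarD (x y : ultraproduct) : ustar (x + y) = ustar x + ustar y.
Proof.
elim/upi_ind: x => a; elim/upi_ind: y => b; rewrite -upiD !upiE -upiD.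
by congr upi; apply: family_ext => j /=; rewrite starD.
Qed.

Lemma ustarZ (c : C) (x : ultraproduct) : ustar (c *: x) = conjc c *: ustar x.
Proof.
elim/upi_ind: x => a; rewrite -upiZ !upiE -upiZ.
by congr upi; apply: family_ext => j /=; rewrite starZ.
Qed.

Lemma ustarM (x y : ultraproduct) : ustar (x * y) = ustar y * ustar x.
Proof.
elim/upi_ind: x => a; elim/upi_ind: y => b; rewrite -upiM !upiE -upiM.
by congr upi; apply: family_ext => j /=; rewrite starM.
Qed.

Lemma ustarK : involutive ustar.
Proof.
elim/upi_ind=> a; rewrite !upiE.
by congr upi; apply: family_ext => j /=; rewrite starK.
Qed.

Lemma unorm_eq0 (x : ultraproduct) : unorm x = 0 -> x = 0.
Proof.
elim/upi_ind: x => a; rewrite upiE => a0; apply: upiP; rewrite -[RHS]a0.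
by apply: fnorm_eq => j /=; rewrite subr0.
Qed.

Lemma unormD (x y : ultraproduct) : unorm (x + y) <= unorm x + unorm y.
Proof.
by elim/upi_ind: x => a; elim/upi_ind: y => b; rewrite -upiD !upiE fnormD.
Qed.

Lemma unormZ (c : C) (x : ultraproduct) : unorm (c *: x) = normc c * unorm x.
Proof. by elim/upi_ind: x => a; rewrite -upiZ !upiE fnormZ. Qed.

Lemma unormM (x y : ultraproduct) : unorm (x * y) <= unorm x * unorm y.
Proof.
by elim/upi_ind: x => a; elim/upi_ind: y => b; rewrite -upiM !upiE fnormM.
Qed.

Lemma unorm_cstar (x : ultraproduct) : unorm (ustar x * x) = unorm x ^+ 2.
Proof. by elim/upi_ind: x => a; rewrite upiE -upiM !upiE fnorm_cstar. Qed.

Lemma unormN (x : ultraproduct) : unorm (- x) = unorm x.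
Proof. by rewrite -scaleN1r unormZ normcN1 mul1r. Qed.

Lemma cut_bounded (P : set J) a : exists M : R, forall j,
  cnorm (if `[< P j >] then a j else 0) <= M.
Proof.
have [M aM] := family_bounded a; exists M => j; case: ifP => // _.
by rewrite cnorm0; apply: le_trans (aM j); exact: cnorm_ge0.
Qed.

Lemma ulift (x : ultraproduct) (c : R) : unorm x < c ->
  exists2 a : bounded_family, upi a = x & forall j, cnorm (a j) <= c.
Proof.
elim/upi_ind: x => a; rewrite upiE => ac.
have c0 : 0 <= c by apply: ltW; apply: le_lt_trans ac; exact: fnorm_ge0.
have Ua : \forall j \near U, cnorm (a j) < c by apply: (cvgr_lt _ (@fnorm_cvg a)).
exists (BoundedFamily (cut_bounded [set j | cnorm (a j) < c] a)).
  apply: upiP; apply/le_anti; rewrite fnorm_ge0 andbT; apply: fnorm_le.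
  apply: filterS Ua => j /= aj.
  by rewrite asboolT // subrr cnorm0.
by move=> j /=; case: asboolP => [/ltW//|_]; rewrite cnorm0.
Qed.

Lemma fsum_bounded (D : nat -> bounded_family) n : exists M : R, forall j,
  cnorm (\sum_(i < n) D i j) <= M.
Proof.
have /choice[M DM] := fun i => family_bounded (D i).
exists (\sum_(i < n) M i) => j; apply: (le_trans (ler_cnorm_sum _ _ _)).
by apply: ler_sum => i _; exact: DM.
Qed.

Definition fsum D n := BoundedFamily (fsum_bounded D n).

Lemma upi_sum D n : upi (fsum D n) = \sum_(i < n) upi (D i).
Proof.
elim: n => [|n ih].
  by rewrite big_ord0; congr upi; apply: family_ext => j /=; rewrite big_ord0.
rewrite big_ord_recr /= -ih -upiD; congr upi; apply: family_ext => j /=.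
by rewrite big_ord_recr.
Qed.

Lemma unorm_complete (u : nat -> ultraproduct) :
  (forall e : R, 0 < e -> exists N : nat, forall m n : nat,
    (N <= m)%N -> (N <= n)%N -> unorm (u m - u n) < e) ->
  exists l : ultraproduct, forall e : R, 0 < e -> exists N : nat,
    forall n : nat, (N <= n)%N -> unorm (u n - l) < e.
Proof.
move=> uC.
pose h k : R := 2^-1 ^+ k.
have h0 k : 0 < h k by rewrite exprn_gt0 // invr_gt0.
have /choice[N0 hN0] : forall k, exists N : nat, forall m n : nat,
    (N <= m)%N -> (N <= n)%N -> unorm (u m - u n) < h k.
  by move=> k; exact: uC.
pose N k := (\sum_(i < k.+1) N0 i)%N.
have NN0 k : (N0 k <= N k)%N by rewrite /N big_ord_recr /= leq_addl.
have NS k : (N k <= N k.+1)%N by rewrite {2}/N big_ord_recr /= leq_addr.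
have NS0 k : (N0 k <= N k.+1)%N by exact: leq_trans (NN0 k) (NS k).
have /choice[D hD] : forall k, exists a : bounded_family,
    upi a = u (N k.+1) - u (N k) /\ forall j, cnorm (a j) <= h k.
  move=> k; have [|a a1 a2] := @ulift (u (N k.+1) - u (N k)) (h k).
    exact: hN0.
  by exists a.
have tail j m n : (m <= n)%N ->
    cnorm (fsum D n j - fsum D m j) <= 2 * h m - 2 * h n.
  move=> /subnK <-; elim: (n - m)%N => [|d ih]; first by rewrite !subrr cnorm0.
  rewrite addSn /= big_ord_recr /= addrAC.
  apply: (le_trans (ler_cnormD _ _)).
  apply: (le_trans (lerD ih ((hD _).2 j))).
  rewrite /h exprS; lra.
have tail2 j m n : (m <= n)%N -> cnorm (fsum D n j - fsum D m j) <= 2 * h m.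
  move=> mn; apply: (le_trans (tail j _ _ mn)).
  by rewrite lerBlDr lerDl mulr_ge0 // ltW.
have hcvg e : 0 < e -> exists K, forall k, (K <= k)%N -> 2 * h k < e.
  move=> e0; have : h @ \oo --> (0 : R).
    by apply: cvg_expr; rewrite ger0_norm ?invr_ge0 // invf_lt1 // ltr1n.
  move=> /cvgrPdist_lt /(_ (e / 2)) []; first by rewrite divr_gt0.
  move=> K _ hK; exists K => k /hK; rewrite /= sub0r normrN ger0_norm ?ltW //.
  by rewrite ltr_pdivlMr // mulrC.
have lex : forall j, exists l : A j, forall e : R, 0 < e ->
    exists K : nat, forall n : nat, (K <= n)%N -> cnorm (fsum D n j - l) < e.
  move=> j; apply: cnorm_complete => e /hcvg[K hK]; exists K => m n Km Kn.
  have [mn|/ltnW nm] := leqP m n.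
    by rewrite cnormB; apply: le_lt_trans (hK _ Km); exact: tail2.
  by apply: le_lt_trans (hK _ Kn); exact: tail2.
pose l j := projT1 (cid (lex j)).
have hl j : forall e : R, 0 < e ->
    exists K : nat, forall n : nat, (K <= n)%N -> cnorm (fsum D n j - l j) < e.
  exact: projT2 (cid (lex j)).
have lD j n : cnorm (fsum D n j - l j) <= 2 * h n.
  apply/ler_addgt0Pr => e e0; have [K hK] := hl j e e0.
  have := hK _ (leq_maxl K n); have := tail2 j n (maxn K n) (leq_maxr _ _).
  set x := fsum D (maxn K n) j => h1 h2.
  rewrite -(subrK x (fsum D n j)) -addrA; apply: (le_trans (ler_cnormD _ _)).
  by apply: lerD (ltW h2); rewrite cnormB.
have lM : exists M : R, forall j, cnorm (l j) <= M.
  exists (2 * h 0%N) => j; have := lD j 0%N.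
  by rewrite /= big_ord0 sub0r cnormN.
pose L := BoundedFamily lM.
have uN k : u (N k) = u (N 0%N) + upi (fsum D k).
  rewrite upi_sum; elim: k => [|k ih]; first by rewrite big_ord0 addr0.
  by rewrite big_ord_recr /= addrA -ih (hD k).1 addrC subrK.
exists (u (N 0%N) + upi L) => e e0.
have e20 : 0 < e / 2 by rewrite divr_gt0.
have [K1 hK1] := hcvg _ e20; exists (N0 K1) => n nK; rewrite (splitr e).
rewrite -(subrK (u (N K1)) (u n)) -addrA.
apply: (le_lt_trans (unormD _ _)); apply: ltr_leD.
  apply: lt_le_trans (hN0 K1 _ _ nK (NN0 K1)) _.
  have := hK1 _ (leqnn K1); have := h0 K1; lra.
rewrite uN opprD addrACA subrr add0r -upiB upiE.
apply: (@le_trans _ _ (2 * h K1)); last exact: ltW (hK1 _ (leqnn _)).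
by apply: fnorm_le; apply: filterE => j; exact: lD.
Qed.

HB.instance Definition _ := isCStarAlgebra.Build R ultraproduct
  ustarD ustarZ ustarM ustarK unorm_eq0 unormD unormZ unormM unorm_cstar
  unorm_complete.

End Ultraproduct.

Section Formulas.
Variable R : realType.

Inductive star_poly (n : nat) : Type :=
  | PVar of 'I_n
  | POne
  | PAdd of star_poly n & star_poly n
  | PMul of star_poly n & star_poly n
  | PScale of R[i] & star_poly n
  | PStar of star_poly n.

(* [formula n] has its free variables among those indexed by ['I_n]; in
   [FSup phi] and [FInf phi] the bound variable is the one of index 0, and the
   variable [i] of the quantified formula is the variable [i + 1] of [phi].
   As the bound variable ranges over the unit ball, the values of [phi] are
   bounded and its [sup] and [inf] below are genuine ones. *)
Inductive formula : nat -> Type :=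
  | FNorm n of star_poly n : formula n
  | FConn n k (f : 'rV[R]_k -> R) of continuous f & ('I_k -> formula n) :
      formula n
  | FSup n of formula n.+1 : formula n
  | FInf n of formula n.+1 : formula n.

Definition sentence := formula 0.

Variable A : cstarAlgType R.

Fixpoint star_poly_eval n (P : star_poly n) (v : 'I_n -> A) : A :=
  match P with
  | PVar i => v i
  | POne => 1
  | PAdd P Q => star_poly_eval P v + star_poly_eval Q v
  | PMul P Q => star_poly_eval P v * star_poly_eval Q v
  | PScale a P => a *: star_poly_eval P v
  | PStar P => star (star_poly_eval P v)
  end.

Definition cons_val n (x : A) (v : 'I_n -> A) : 'I_n.+1 -> A :=
  fun i => oapp v x (unlift ord0 i).

Definition unit_ball : set A := [set x | cnorm x <= 1].

Fixpoint formula_eval n (phi : formula n) : ('I_n -> A) -> R :=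
  match phi with
  | FNorm _ P => fun v => cnorm (star_poly_eval P v)
  | FConn _ _ f _ phis => fun v => f (\row_i formula_eval (phis i) v)
  | FSup _ phi =>
      fun v => sup [set formula_eval phi (cons_val x v) | x in unit_ball]
  | FInf _ phi =>
      fun v => inf [set formula_eval phi (cons_val x v) | x in unit_ball]
  end.

Definition sentence_eval (phi : sentence) : R :=
  formula_eval phi (fun _ : 'I_0 => 0).

End Formulas.

Arguments sentence_eval {R} A phi.

Definition elementarily_equivalent (R : realType) (A B : cstarAlgType R) : Prop :=
  forall phi : sentence R, sentence_eval A phi = sentence_eval B phi.

Definition pseudomatricial (R : realType) (A : cstarAlgType R) : Prop :=
  exists (J : Type) (U : set_system J) (hU : UltraFilter U) (n : J -> nat),
    elementarily_equivalent A
      (ultraproduct hU (fun j => 'M[R[i]]_((n j).+1) : cstarAlgType R)).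

Definition separable (R : realType) (A : cstarAlgType R) : Prop :=
  exists s : nat -> A, forall (x : A) (e : R), 0 < e ->
    exists n, cnorm (x - s n) < e.

Section MurrayVonNeumann.
Variables (R : realType) (A : cstarAlgType R).

Definition adjmx m n (M : 'M[A]_(m, n)) : 'M[A]_(n, m) := map_mx star M^T.

Definition is_projection n (p : 'M[A]_n) : Prop :=
  adjmx p = p /\ p *m p = p.

Definition mvn_equiv m n (p : 'M[A]_m) (q : 'M[A]_n) : Prop :=
  exists v : 'M[A]_(n, m), adjmx v *m v = p /\ v *m adjmx v = q.

Definition dsum m n (p : 'M[A]_m) (q : 'M[A]_n) : 'M[A]_(m + n) :=
  block_mx p 0 0 q.

Lemma star_sum (I : Type) (r : seq I) (P : pred I) (F : I -> A) :
  star (\sum_(i <- r | P i) F i) = \sum_(i <- r | P i) star (F i).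
Proof. exact: (big_morph _ (@starD _ A) (@star0 _ A)). Qed.

Lemma adjmxK m n (M : 'M[A]_(m, n)) : adjmx (adjmx M) = M.
Proof. by apply/matrixP => i j; rewrite !mxE starK. Qed.

Lemma adjmxM m n k (M : 'M[A]_(m, n)) (N : 'M[A]_(n, k)) :
  adjmx (M *m N) = adjmx N *m adjmx M.
Proof.
apply/matrixP => i j; rewrite !mxE star_sum; apply: eq_bigr => l _.
by rewrite !mxE starM.
Qed.

Lemma adjmx0 m n : adjmx (0 : 'M[A]_(m, n)) = 0.
Proof. by apply/matrixP => i j; rewrite !mxE star0. Qed.

Lemma adjmx_block m1 m2 n1 n2 (a : 'M[A]_(m1, n1)) (b : 'M[A]_(m1, n2))
    (c : 'M[A]_(m2, n1)) (d : 'M[A]_(m2, n2)) :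
  adjmx (block_mx a b c d) = block_mx (adjmx a) (adjmx c) (adjmx b) (adjmx d).
Proof. by rewrite /adjmx tr_block_mx map_block_mx. Qed.

Lemma is_projection0 n : is_projection (0 : 'M[A]_n).
Proof. by split; rewrite ?adjmx0 ?mul0mx. Qed.

Lemma is_projectionD m n (p : 'M[A]_m) (q : 'M[A]_n) :
  is_projection p -> is_projection q -> is_projection (dsum p q).
Proof.
move=> [p1 p2] [q1 q2]; split; first by rewrite adjmx_block !adjmx0 p1 q1.
by rewrite mulmx_block !mulmx0 !mul0mx !addr0 !add0r p2 q2.
Qed.

Lemma mvn_refl n (p : 'M[A]_n) : is_projection p -> mvn_equiv p p.
Proof. by move=> [p1 p2]; exists p; rewrite !p1 !p2. Qed.

Lemma mvn_sym m n (p : 'M[A]_m) (q : 'M[A]_n) : mvn_equiv p q -> mvn_equiv q p.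
Proof. by move=> [v [v1 v2]]; exists (adjmx v); rewrite adjmxK. Qed.

Lemma mvn_trans m n k (p : 'M[A]_m) (q : 'M[A]_n) (r : 'M[A]_k) :
  is_projection p -> is_projection r ->
  mvn_equiv p q -> mvn_equiv q r -> mvn_equiv p r.
Proof.
move=> [_ pp] [_ rr] [v [v1 v2]] [w [w1 w2]]; exists (w *m v); split.
  rewrite adjmxM mulmxA -(mulmxA (adjmx v)) w1 -v2 mulmxA v1.
  by rewrite -mulmxA v1.
rewrite adjmxM mulmxA -(mulmxA w) v2 -w1 mulmxA w2.
by rewrite -mulmxA w2.
Qed.

Lemma mvnD m n m' n' (p : 'M[A]_m) (q : 'M[A]_n) (p' : 'M[A]_m') (q' : 'M[A]_n') :
  mvn_equiv p p' -> mvn_equiv q q' -> mvn_equiv (dsum p q) (dsum p' q').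
Proof.
move=> [v [v1 v2]] [w [w1 w2]]; exists (block_mx v 0 0 w).
rewrite adjmx_block !adjmx0 !mulmx_block !mulmx0 !mul0mx !addr0 !add0r.
by rewrite v1 v2 w1 w2.
Qed.

Lemma mvnC m n (p : 'M[A]_m) (q : 'M[A]_n) :
  is_projection p -> is_projection q -> mvn_equiv (dsum p q) (dsum q p).
Proof.
move=> [p1 p2] [q1 q2]; exists (block_mx 0 q p 0).
rewrite adjmx_block !adjmx0 p1 q1 !mulmx_block !mulmx0 !mul0mx !addr0 !add0r.
by rewrite p2 q2.
Qed.

Lemma mvn_cast m n (e : m = n) (p : 'M[A]_m) :
  is_projection p -> mvn_equiv p (castmx (e, e) p).
Proof. by case: n / e => pp; rewrite castmx_id; exact: mvn_refl. Qed.

Lemma mvnA m n k (p : 'M[A]_m) (q : 'M[A]_n) (r : 'M[A]_k) :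
  is_projection p -> is_projection q -> is_projection r ->
  mvn_equiv (dsum p (dsum q r)) (dsum (dsum p q) r).
Proof.
move=> pP qP rP.
have e : dsum p (dsum q r) =
    castmx (esym (addnA m n k), esym (addnA m n k)) (dsum (dsum p q) r).
  have := @block_mxA A m n k m n k p 0 0 0 q 0 0 0 r.
  by rewrite /= !row_mx0 !col_mx0.
by rewrite e; apply: mvn_sym; apply: mvn_cast; do 2?apply: is_projectionD.
Qed.

Lemma mvn0 m n (p : 'M[A]_m) : is_projection p -> mvn_equiv (dsum (0 : 'M[A]_n) p) p.
Proof.
move=> [p1 p2]; exists (row_mx 0 p).
have -> : adjmx (row_mx (0 : 'M[A]_(m, n)) p) = col_mx 0 p.
  by rewrite /adjmx tr_row_mx map_col_mx -[map_mx _ 0^T]/(adjmx 0) adjmx0 -[X in col_mx _ X]/(adjmx p) p1.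
by rewrite mul_col_row mul_row_col !mulmx0 !mul0mx add0r p2.
Qed.

Record projection := Projection {
  proj_dim : nat;
  proj_mx :> 'M[A]_proj_dim;
  proj_dim_gt0 : (0 < proj_dim)%N;
  projP : is_projection proj_mx }.

HB.instance Definition _ := gen_eqMixin projection.
HB.instance Definition _ := gen_choiceMixin projection.

Implicit Types p q r : projection.

Lemma proj_sum_gt0 p q : (0 < proj_dim p + proj_dim q)%N.
Proof. by rewrite addn_gt0 proj_dim_gt0. Qed.

Definition proj_sum p q : projection :=
  Projection (proj_sum_gt0 p q) (is_projectionD (projP p) (projP q)).

Definition proj_zero : projection :=
  Projection (ltn0Sn 0) (is_projection0 1).

Definition proj_equiv : rel projection :=
  fun p q => `[< mvn_equiv (proj_mx p) (proj_mx q) >].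

Lemma proj_equiv_refl : reflexive proj_equiv.
Proof. by move=> p; apply/asboolP; apply: mvn_refl; exact: projP. Qed.

Lemma proj_equiv_sym : symmetric proj_equiv.
Proof. by move=> p q; apply/idP/idP => /asboolP/mvn_sym/asboolP. Qed.

Lemma proj_equiv_trans : transitive proj_equiv.
Proof.
move=> q p r /asboolP pq /asboolP qr; apply/asboolP.
by apply: mvn_trans pq qr; exact: projP.
Qed.

Canonical proj_equivRel :=
  EquivRel proj_equiv proj_equiv_refl proj_equiv_sym proj_equiv_trans.

Definition mvn_monoid := {eq_quot proj_equiv}.

HB.instance Definition _ := Choice.on mvn_monoid.
HB.instance Definition _ := EqQuotient.on mvn_monoid.

Definition mvn_class p : mvn_monoid := \pi_mvn_monoid p.

Lemma mvn_classP p q : mvn_class p = mvn_class q <-> mvn_equiv (proj_mx p) (proj_mx q).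
Proof. by split => [/eqmodP/asboolP|h] //; apply/eqmodP/asboolP. Qed.

Lemma mvn_repr (x : mvn_monoid) : mvn_class (repr x) = x.
Proof. exact: reprK. Qed.

Definition mvn_add (x y : mvn_monoid) : mvn_monoid :=
  mvn_class (proj_sum (repr x) (repr y)).

Lemma mvn_classD p q :
  mvn_add (mvn_class p) (mvn_class q) = mvn_class (proj_sum p q).
Proof.
by apply/mvn_classP; apply: mvnD; apply/mvn_classP; rewrite mvn_repr.
Qed.

Lemma mvn_ind (P : mvn_monoid -> Prop) : (forall p, P (mvn_class p)) -> forall x, P x.
Proof. by move=> h x; rewrite -(mvn_repr x). Qed.

Lemma mvn_addA : associative mvn_add.
Proof.
elim/mvn_ind=> p; elim/mvn_ind=> q; elim/mvn_ind=> r; rewrite !mvn_classD.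
by apply/mvn_classP; apply: mvnA; exact: projP.
Qed.

Lemma mvn_addC : commutative mvn_add.
Proof.
elim/mvn_ind=> p; elim/mvn_ind=> q; rewrite !mvn_classD.
by apply/mvn_classP; apply: mvnC; exact: projP.
Qed.

Lemma mvn_add0 : left_id (mvn_class proj_zero) mvn_add.
Proof.
elim/mvn_ind=> p; rewrite !mvn_classD.
by apply/mvn_classP; apply: mvn0; exact: projP.
Qed.

HB.instance Definition _ := GRing.isNmodule.Build mvn_monoid
  mvn_addA mvn_addC mvn_add0.

End MurrayVonNeumann.

Section Grothendieck.
Variable M : nmodType.

Definition groth_equiv : rel (M * M) :=
  fun x y => `[< exists z, x.1 + y.2 + z = y.1 + x.2 + z >].

Lemma groth_equiv_refl : reflexive groth_equiv.
Proof. by move=> x; apply/asboolP; exists 0. Qed.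

Lemma groth_equiv_sym : symmetric groth_equiv.
Proof. by move=> x y; apply/idP/idP => /asboolP[z e]; apply/asboolP; exists z. Qed.

Lemma groth_equiv_trans : transitive groth_equiv.
Proof.
move=> y x z /asboolP[u xy] /asboolP[w yz]; apply/asboolP.
exists (y.2 + u + (y.1 + w)).
have -> : x.1 + z.2 + (y.2 + u + (y.1 + w)) = (x.1 + y.2 + u) + (y.1 + z.2 + w).
  by rewrite [LHS](AC (2*(2*2)) ((1*3*4)*(5*2*6))).
by rewrite xy yz [LHS](AC ((2*1)*(2*1)) ((4*2)*(5*3*(1*6)))) //.
Qed.

Canonical groth_equivRel :=
  EquivRel groth_equiv groth_equiv_refl groth_equiv_sym groth_equiv_trans.

Definition grothendieck := {eq_quot groth_equiv}.

HB.instance Definition _ := Choice.on grothendieck.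
HB.instance Definition _ := EqQuotient.on grothendieck.

Definition groth_diff (x y : M) : grothendieck := \pi_grothendieck (x, y).

Lemma groth_diffP x y x' y' : groth_diff x y = groth_diff x' y' <->
  exists z, x + y' + z = x' + y + z.
Proof. by split => [/eqmodP/asboolP|h] //; apply/eqmodP/asboolP. Qed.

Lemma groth_repr (g : grothendieck) : groth_diff (repr g).1 (repr g).2 = g.
Proof. by rewrite /groth_diff -surjective_pairing reprK. Qed.

Lemma groth_ind (P : grothendieck -> Prop) :
  (forall x y, P (groth_diff x y)) -> forall g, P g.
Proof. by move=> h g; rewrite -(groth_repr g). Qed.

Definition groth_add (g h : grothendieck) :=
  groth_diff ((repr g).1 + (repr h).1) ((repr g).2 + (repr h).2).
Definition groth_opp (g : grothendieck) := groth_diff (repr g).2 (repr g).1.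

Lemma groth_addE x y x' y' :
  groth_add (groth_diff x y) (groth_diff x' y') = groth_diff (x + x') (y + y').
Proof.
have /groth_diffP[z e] := groth_repr (groth_diff x y).
have /groth_diffP[z' e'] := groth_repr (groth_diff x' y').
apply/groth_diffP; exists (z + z').
have -> : forall a b c d u w : M,
    a + b + (c + d) + (u + w) = a + c + u + (b + d + w).
  by move=> a b c d u w; rewrite (addrACA a) [LHS]addrACA.
by rewrite e e' [LHS]addrACA (addrACA x).
Qed.

Lemma groth_oppE x y : groth_opp (groth_diff x y) = groth_diff y x.
Proof.
have /groth_diffP[z e] := groth_repr (groth_diff x y).
by apply/groth_diffP; exists z; rewrite [_ + x]addrC -e [y + _]addrC.
Qed.

Lemma groth_addA : associative groth_add.
Proof.
by elim/groth_ind=> a b; elim/groth_ind=> c d; elim/groth_ind=> e f;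
  rewrite !groth_addE !addrA.
Qed.

Lemma groth_addC : commutative groth_add.
Proof.
by elim/groth_ind=> a b; elim/groth_ind=> c d;
  rewrite !groth_addE addrC [b + d]addrC.
Qed.

Lemma groth_add0 : left_id (groth_diff 0 0) groth_add.
Proof. by elim/groth_ind=> a b; rewrite !groth_addE !add0r. Qed.

Lemma groth_addN : left_inverse (groth_diff 0 0) groth_opp groth_add.
Proof.
elim/groth_ind=> a b; rewrite groth_oppE groth_addE; apply/groth_diffP.
by exists 0; rewrite addr0 add0r [b + a]addrC.
Qed.

HB.instance Definition _ := GRing.isZmodule.Build grothendieck
  groth_addA groth_addC groth_add0 groth_addN.

End Grothendieck.

Definition K0 (R : realType) (A : cstarAlgType R) : zmodType :=
  grothendieck (mvn_monoid A).

Definition K0_class (R : realType) (A : cstarAlgType R) (p : projection A) : K0 A :=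
  groth_diff (mvn_class p) 0.

Definition K0_pos (R : realType) (A : cstarAlgType R) : set (K0 A) :=
  range (@K0_class R A).

Arguments K0_pos {R} A.

Section OrderedGroups.
Variables (G : zmodType) (P : set G).

Definition cone_le (g h : G) : Prop := P (h - g).
Definition cone_lt (g h : G) : Prop := cone_le g h /\ g <> h.

Record totally_ordered_group : Prop := {
  cone_le_refl : forall g, cone_le g g;
  cone_le_anti : forall g h, cone_le g h -> cone_le h g -> g = h;
  cone_le_trans : forall g h k, cone_le g h -> cone_le h k -> cone_le g k;
  cone_le_total : forall g h, cone_le g h \/ cone_le h g;
  cone_le_add : forall g h k, cone_le g h -> cone_le (g + k) (h + k) }.

Definition is_successor (g s : G) : Prop :=
  cone_lt g s /\ forall h, cone_lt g h -> cone_le s h.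

Definition is_predecessor (g s : G) : Prop :=
  cone_lt s g /\ forall h, cone_lt h g -> cone_le h s.

Definition simplicial_cone n : set 'rV[int]_n := [set x | forall i, 0 <= x 0 i].

Fixpoint connecting_map (r : nat -> nat)
    (f : forall n, 'rV[int]_(r n) -> 'rV[int]_(r n.+1)) (k n : nat) :
    'rV[int]_(r n) -> 'rV[int]_(r (k + n)) :=
  match k with
  | 0 => id
  | k'.+1 => fun x => f (k' + n) (connecting_map f k' x)
  end.

(* [(G, P)] is a dimension group when it is the inductive
   limit, in ordered abelian groups, of a sequence Z^(r 0) -> Z^(r 1) -> ... of
   simplicial groups with positive connecting homomorphisms [f]; the [iota n]
   are the canonical maps into the limit. *)
Definition dimension_group : Prop :=
  exists (r : nat -> nat)
         (f : forall n, {additive 'rV[int]_(r n) -> 'rV[int]_(r n.+1)})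
         (iota : forall n, {additive 'rV[int]_(r n) -> G}),
  [/\ forall n x, simplicial_cone x -> simplicial_cone (f n x),
      forall n x, iota n.+1 (f n x) = iota n x,
      forall g, exists n x, iota n x = g,
      forall n x, iota n x = 0 -> exists k, connecting_map f k x = 0 &
      forall g, P g <-> exists n x, simplicial_cone x /\ iota n x = g].

End OrderedGroups.

(* Main.v *)
From HB Require Import structures.
Require Import Defs.
From mathcomp Require Import all_boot all_order all_algebra.
From mathcomp Require Import complex.
From mathcomp Require Import all_classical all_reals all_analysis.
From mathcomp Require Import ring lra zify spectral.

(** Three properties of the projections over matrix algebras M_n account for
    the theorem, because ranks compare projections there:
    - of two projections over M_n, one is equivalent to a subprojection of the
      other;
    - an isometry over M_n is unitary;
    - M_n contains a nonzero projection without proper nonzero subprojections.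
    Each of them passes to a pseudomatricial algebra [A] (lemmas
    [pseudomatricial_comparable], [pseudomatricial_finite] and
    [pseudomatricial_minimal_projection]) by the following route. A version of
    the property in which the relations hold up to a small error, with bounds
    that do not depend on n, is a closed formula of continuous logic. By the
    theorem of Los ([ultraproduct_los]) it holds in ultraproducts of matrix
    algebras, hence in [A]. Approximate solutions of the relations are then
    corrected to exact ones: Newton's iteration for the polar decomposition
    ([polar_iteration]) turns a near partial isometry into a partial isometry,
    and, applied to 2x - 1, a near projection x into a projection. Norms are
    measured by the sum of the norms of the entries, and bounds on projections
    are imposed by rescaling the variables of the formulas.

    In K_0(A), comparability makes the order total. If [p] + [q] = 0 then, for
    some r, the projection p + q + r is equivalent to its subprojection r, and
    finiteness gives p = q = 0: the order is antisymmetric. By comparability a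
    projection [e] that is minimal in [A] is equivalent to a subprojection of
    every nonzero projection over [A]; its class is thus the least positive
    element of K_0(A), and the neighbours of g are g + [e] and g - [e].
    When [A] is separable, K_0(A) is countable since close projections have
    the same class.

    Finally, a countable totally ordered group is a dimension group. Finitely
    many positive elements always lie in the cone spanned by finitely many
    independent positive elements ([independent_positive_basis]): as long as
    there is a relation, a Euclidean algorithm on its coefficients removes one
    generator. Adjoining the positive elements one after the other yields an
    increasing sequence of simplicial groups with union K_0(A). *)

Set Implicit Arguments.
Unset Strict Implicit.
Unset Printing Implicit Defensive.

Import Order.TTheory GRing.Theory Num.Theory.
Import numFieldNormedType.Exports.
Import ComplexField.Normc.

Local Open Scope classical_set_scope.
Local Open Scope ring_scope.
Local Open Scope complex_scope.

(** * The Banach *-algebra of matrices over a C*-algebra *)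

Section MatrixNorm.
Variables (R : realType) (A : cstarAlgType R).

(** An elementary substitute for the C*-norm of M_k(A): equivalent to it,
    submultiplicative and complete, with an isometric involution. *)
Definition mnorm m n (X : 'M[A]_(m, n)) : R := \sum_i \sum_j cnorm (X i j).

Lemma mnorm_ge0 m n (X : 'M[A]_(m, n)) : 0 <= mnorm X.
Proof. by do 2![apply: sumr_ge0 => ? _]; exact: cnorm_ge0. Qed.

Lemma mnorm0 m n : mnorm (0 : 'M[A]_(m, n)) = 0.
Proof. by do 2![apply: big1 => ? _]; rewrite mxE cnorm0. Qed.

Lemma mnormD m n (X Y : 'M[A]_(m, n)) : mnorm (X + Y) <= mnorm X + mnorm Y.
Proof.
rewrite -big_split; apply: ler_sum => i _; rewrite -big_split.
by apply: ler_sum => j _; rewrite mxE ler_cnormD.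
Qed.

Lemma mnormN m n (X : 'M[A]_(m, n)) : mnorm (- X) = mnorm X.
Proof. by do 2![apply: eq_bigr => ? _]; rewrite mxE cnormN. Qed.

Lemma mnormBC m n (X Y : 'M[A]_(m, n)) : mnorm (X - Y) = mnorm (Y - X).
Proof. by rewrite -mnormN opprB. Qed.

Lemma mnormB m n (X Y : 'M[A]_(m, n)) : mnorm (X - Y) <= mnorm X + mnorm Y.
Proof. by rewrite -(mnormN Y) mnormD. Qed.

Lemma mnorm_trans m n (Y X Z : 'M[A]_(m, n)) :
  mnorm (X - Z) <= mnorm (X - Y) + mnorm (Y - Z).
Proof. by apply: le_trans (mnormD _ _); rewrite addrA subrK. Qed.

Lemma mnorm_shift m n (X Y : 'M[A]_(m, n)) : mnorm X <= mnorm (X - Y) + mnorm Y.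
Proof. by apply: le_trans (mnormD _ _); rewrite subrK. Qed.

Lemma mnorm_entry m n (X : 'M[A]_(m, n)) i j : cnorm (X i j) <= mnorm X.
Proof.
rewrite /mnorm (bigD1 i) //= (bigD1 j) //= -addrA lerDl addr_ge0 //.
  by apply: sumr_ge0 => ? _; exact: cnorm_ge0.
by do 2![apply: sumr_ge0 => ? _]; exact: cnorm_ge0.
Qed.

Lemma mnorm_le0 m n (X : 'M[A]_(m, n)) : mnorm X <= 0 -> X = 0.
Proof.
move=> X0; apply/matrixP => i j; rewrite mxE; apply: cnorm_eq0.
by apply/le_anti; rewrite cnorm_ge0 (le_trans (mnorm_entry _ _ _)).
Qed.

Lemma mnormM m n k (X : 'M[A]_(m, n)) (Y : 'M[A]_(n, k)) :
  mnorm (X *m Y) <= mnorm X * mnorm Y.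
Proof.
rewrite /mnorm big_distrl /=; apply: ler_sum => i _.
apply: (@le_trans _ _ (\sum_j \sum_l cnorm (X i l) * cnorm (Y l j))).
  apply: ler_sum => j _; rewrite mxE; apply: (le_trans (ler_cnorm_sum _ _ _)).
  by apply: ler_sum => l _; exact: ler_cnormM.
rewrite exchange_big /= big_distrl /=; apply: ler_sum => l _.
rewrite -mulr_sumr ler_wpM2l ?cnorm_ge0 // (bigD1 l) //= lerDl.
by do 2![apply: sumr_ge0 => ? _]; exact: cnorm_ge0.
Qed.

Lemma mnorm_adj m n (X : 'M[A]_(m, n)) : mnorm (adjmx X) = mnorm X.
Proof.
rewrite /mnorm exchange_big; do 2![apply: eq_bigr => ? _].
by rewrite !mxE cnorm_star.
Qed.

Lemma adjmxD m n (X Y : 'M[A]_(m, n)) : adjmx (X + Y) = adjmx X + adjmx Y.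
Proof. by apply/matrixP => i j; rewrite !mxE starD. Qed.

Lemma adjmxN m n (X : 'M[A]_(m, n)) : adjmx (- X) = - adjmx X.
Proof. by apply/matrixP => i j; rewrite !mxE starN. Qed.

Lemma adjmxB m n (X Y : 'M[A]_(m, n)) : adjmx (X - Y) = adjmx X - adjmx Y.
Proof. by rewrite adjmxD adjmxN. Qed.

Lemma adjmx1 n : adjmx (1%:M : 'M[A]_n) = 1%:M.
Proof.
apply/matrixP => i j; rewrite !mxE eq_sym.
by case: eqP => _; rewrite ?star1 ?star0.
Qed.

(** The action of complex scalars; the module structure of a matrix space
    over [A] has its scalars in [A]. *)
Definition mscale (c : R[i]) m n (X : 'M[A]_(m, n)) := map_mx ( *:%R c) X.

Lemma mscaleDr c m n (X Y : 'M[A]_(m, n)) :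
  mscale c (X + Y) = mscale c X + mscale c Y.
Proof. by apply/matrixP => i j; rewrite !mxE scalerDr. Qed.

Lemma mscaleDl c d m n (X : 'M[A]_(m, n)) :
  mscale (c + d) X = mscale c X + mscale d X.
Proof. by apply/matrixP => i j; rewrite !mxE scalerDl. Qed.

Lemma mscaleA c d m n (X : 'M[A]_(m, n)) :
  mscale c (mscale d X) = mscale (c * d) X.
Proof. by apply/matrixP => i j; rewrite !mxE scalerA. Qed.

Lemma mscaleN c m n (X : 'M[A]_(m, n)) : mscale c (- X) = - mscale c X.
Proof. by apply/matrixP => i j; rewrite !mxE scalerN. Qed.

Lemma mscaleNl c m n (X : 'M[A]_(m, n)) : mscale (- c) X = - mscale c X.
Proof. by apply/matrixP => i j; rewrite !mxE scaleNr. Qed.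

Lemma mscale1 m n (X : 'M[A]_(m, n)) : mscale 1 X = X.
Proof. by apply/matrixP => i j; rewrite !mxE scale1r. Qed.

Lemma mscale_mull c m n k (X : 'M[A]_(m, n)) (Y : 'M[A]_(n, k)) :
  mscale c X *m Y = mscale c (X *m Y).
Proof.
apply/matrixP => i j; rewrite !mxE scaler_sumr; apply: eq_bigr => l _.
by rewrite !mxE scalerAl.
Qed.

Lemma mscale_mulr c m n k (X : 'M[A]_(m, n)) (Y : 'M[A]_(n, k)) :
  X *m mscale c Y = mscale c (X *m Y).
Proof.
apply/matrixP => i j; rewrite !mxE scaler_sumr; apply: eq_bigr => l _.
by rewrite !mxE scalerAr.
Qed.

Lemma adjmx_scale (c : R) m n (X : 'M[A]_(m, n)) :
  adjmx (mscale c%:C X) = mscale c%:C (adjmx X).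
Proof. by apply/matrixP => i j; rewrite !mxE starZ /= oppr0. Qed.

Lemma mnormZ (c : R[i]) m n (X : 'M[A]_(m, n)) :
  mnorm (mscale c X) = normc c * mnorm X.
Proof.
rewrite /mnorm mulr_sumr; apply: eq_bigr => i _; rewrite mulr_sumr.
by apply: eq_bigr => j _; rewrite mxE cnormZ.
Qed.

Lemma mnormZr (c : R) m n (X : 'M[A]_(m, n)) : 0 <= c ->
  mnorm (mscale c%:C X) = c * mnorm X.
Proof. by move=> c0; rewrite mnormZ normc_realc ger0_norm. Qed.

Lemma mscale_half2 m n (X : 'M[A]_(m, n)) :
  mscale (2^-1 : R)%:C X + mscale (2^-1 : R)%:C X = X.
Proof.
rewrite -mscaleDl -rmorphD /= (_ : 2^-1 + 2^-1 = 1 :> R); last by field.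
by rewrite rmorph1 mscale1.
Qed.

Lemma geometric_le0 (x C : R) : (forall n, x <= C * 2^-1 ^+ n) -> x <= 0.
Proof.
move=> xC; rewrite leNgt; apply/negP => x0.
have C0 : 0 < C by have := xC 0%N; rewrite expr0 mulr1; exact: lt_le_trans.
have : (fun n => 2^-1 ^+ n : R) @ \oo --> (0 : R).
  by apply: cvg_expr; rewrite ger0_norm ?invr_ge0 // invf_lt1 // ltr1n.
move=> /cvgrPdist_lt /(_ (x / C)) []; first by rewrite divr_gt0.
move=> N _ /(_ N (leqnn N)); rewrite /= sub0r normrN ger0_norm ?exprn_ge0 ?invr_ge0 //.
by rewrite ltr_pdivlMr // mulrC ltNge xC.
Qed.

Lemma mnorm_geometric_cvg m n (u : nat -> 'M[A]_(m, n)) (a : R) :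
  (forall k, mnorm (u k.+1 - u k) <= a * 2^-1 ^+ k) ->
  exists l, forall k, mnorm (u k - l) <= 2 * a * 2^-1 ^+ k.
Proof.
move=> ua.
have a0 : 0 <= a by have := ua 0%N; rewrite expr0 mulr1; apply: le_trans (mnorm_ge0 _).
have tail k d : mnorm (u (d + k)%N - u k) <= 2 * a * 2^-1 ^+ k.
  suff : mnorm (u (d + k)%N - u k) <= 2 * a * 2^-1 ^+ k - 2 * a * 2^-1 ^+ (d + k).
    by move/le_trans; apply; rewrite lerBlDr lerDl !mulr_ge0 // exprn_ge0 ?invr_ge0.
  elim: d => [|d ih]; first by rewrite add0n !subrr mnorm0.
  apply: le_trans (mnorm_trans (u (d + k)%N) _ _) _.
  apply: (le_trans (lerD (ua _) ih)); rewrite addSn exprS; lra.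
have ex ij : exists l : A, forall e : R, 0 < e -> exists N : nat,
    forall k : nat, (N <= k)%N -> cnorm (u k ij.1 ij.2 - l) < e.
  apply: cnorm_complete => e e0.
  have [N hN] : exists N : nat, 2 * a * 2^-1 ^+ N < e / 2.
    apply: contrapT => /forallNP h.
    have : e / 2 <= 0.
      by apply: (@geometric_le0 _ (2 * a)) => k; rewrite leNgt; apply/negP/h.
    lra.
  exists N => k l Nk Nl.
  have h i : (N <= i)%N -> cnorm (u i ij.1 ij.2 - u N ij.1 ij.2) < e / 2.
    move=> Ni; apply: le_lt_trans hN; apply: le_trans (tail N (i - N)%N).
    rewrite subnK //.
    by have := mnorm_entry (u i - u N) ij.1 ij.2; rewrite !mxE.
  rewrite (splitr e); apply: le_lt_trans (ltrD (h _ Nk) (h _ Nl)).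
  rewrite (cnormB (u l _ _)); apply: le_trans (ler_cnormD _ _).
  by rewrite addrA subrK.
have /choice[l hl] := ex.
exists (\matrix_(i, j) l (i, j)) => k.
apply/ler_addgt0Pr => e e0.
have e10 : 0 < e / (m * n).+1%:R by rewrite divr_gt0.
have /choice[N hN] : forall ij : 'I_m * 'I_n, exists N : nat, forall p : nat,
      (N <= p)%N -> cnorm (u p ij.1 ij.2 - l ij) < e / (m * n).+1%:R.
  by move=> ij; exact: hl.
pose d := (\max_ij N ij)%N.
apply: (le_trans (mnorm_trans (u (d + k)%N) _ _)).
rewrite mnormBC; apply: lerD; first exact: tail.
apply: (@le_trans _ _ (\sum_(i < m) \sum_(j < n) e / (m * n).+1%:R)).
  apply: ler_sum => i _; apply: ler_sum => j _; rewrite !mxE ltW //.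
  apply: (hN (i, j)); apply: leq_trans (leq_addr _ _).
  exact: (@leq_bigmax _ _ (i, j)).
rewrite !sumr_const !card_ord -mulrnA -[leLHS]mulr_natr mulrAC.
by rewrite ler_pdivrMr ?ltr0n // ler_pM2l // ler_nat mulnC.
Qed.

End MatrixNorm.

(** * Polar decomposition by Newton iteration *)

Lemma symmetry_defect (T : pzRingType) (x : T) :
  1 - (x *+ 2 - 1) * (x *+ 2 - 1) = - ((x * x - x) *+ 2 *+ 2).
Proof.
rewrite -expr2 sqrrB1 exprMn_n -!mulrnA mulrnBl.
by rewrite opprD addrCA subrr addr0 expr2.
Qed.

Section Polar.
Variables (R : realType) (A : cstarAlgType R) (k : nat).
Implicit Types p q v w x : 'M[A]_k.

Local Notation half := (mscale (2^-1 : R)%:C).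

(** The normalization by one half is that of the first-order term of the
    inverse square root: (p - 2h)^(-1/2) = p + h + O(h^2). *)
Definition polar_defect p v := half (p - adjmx v *m v).

Definition polar_step p v := v + v *m polar_defect p v.

Lemma polar_defect2 p v :
  adjmx v *m v = p - (polar_defect p v + polar_defect p v).
Proof. by rewrite mscale_half2 opprB addrC subrK. Qed.

Lemma polar_defect_adj p v : adjmx p = p ->
  adjmx (polar_defect p v) = polar_defect p v.
Proof. by move=> pa; rewrite adjmx_scale adjmxB pa adjmxM adjmxK. Qed.

Lemma polar_defect_cornerr p v : p *m p = p -> v *m p = v ->
  polar_defect p v *m p = polar_defect p v.
Proof. by move=> pp vp; rewrite mscale_mull mulmxBl pp -mulmxA vp. Qed.

Lemma polar_defect_cornerl p v : is_projection p -> v *m p = v ->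
  p *m polar_defect p v = polar_defect p v.
Proof.
move=> [pa pp] vp.
by rewrite -[LHS]adjmxK adjmxM polar_defect_adj // pa polar_defect_cornerr ?polar_defect_adj.
Qed.

(** The step is Newton's iteration for the inverse square root of v*v, so
    that the defect decays quadratically. *)
Lemma polar_defect_step p v : is_projection p -> v *m p = v ->
  let h := polar_defect p v in
  polar_defect p (polar_step p v) =
  half (h *m h + h *m h + h *m h + (h *m h *m h + h *m h *m h)).
Proof.
move=> pP vp h; have ha : adjmx h = h by apply: polar_defect_adj; case: pP.
have hr : h *m p = h by apply: polar_defect_cornerr => //; case: pP.
have hl : p *m h = h by exact: polar_defect_cornerl.
have vv : adjmx v *m v = p - (h + h) by exact: polar_defect2.
rewrite /polar_step -/h {1}/polar_defect; congr mscale.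
have -> : adjmx (v + v *m h) *m (v + v *m h) =
    (p - h - (h *m h + h *m h)) + (p - h - (h *m h + h *m h)) *m h.
  have -> : p - h - (h *m h + h *m h) = adjmx v *m v + h *m (adjmx v *m v).
    by rewrite vv mulmxBr hr mulmxDr !opprD !addrA subrK.
  by rewrite adjmxD adjmxM ha mulmxDr mulmxA !mulmxDl -!mulmxA.
rewrite !(mulmxDl, mulNmx) hl !opprD !opprK !addrA subrr add0r.
by rewrite (addrAC (h + _) _ (- h)) (addrAC h _ (- h)) subrr add0r.
Qed.

Lemma mnorm_half x : mnorm (half x) = 2^-1 * mnorm x.
Proof. by rewrite mnormZr // invr_ge0. Qed.

Lemma polar_defect_quadratic p v : is_projection p -> v *m p = v ->
  mnorm (polar_defect p v) <= 4^-1 ->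
  mnorm (polar_defect p (polar_step p v)) <= 2^-1 * mnorm (polar_defect p v).
Proof.
move=> pP vp; rewrite polar_defect_step // mnorm_half.
set h := polar_defect p v; set m := mnorm h => m4.
have m0 : 0 <= m by exact: mnorm_ge0.
have h2 : mnorm (h *m h) <= m * m by exact: mnormM.
have h3 : mnorm (h *m h *m h) <= m * m * m.
  by apply: (le_trans (mnormM _ _)); rewrite ler_wpM2r.
have {}h2 : mnorm (h *m h) <= m / 4 by nra.
have {}h3 : mnorm (h *m h *m h) <= m / 16 by nra.
rewrite ler_pM2l ?invr_gt0 //.
have D (x y : 'M[A]_k) : mnorm (x + y) <= mnorm x + mnorm y by exact: mnormD.
apply: (le_trans (D _ _)); apply: (le_trans (lerD (D _ _) (D _ _))).
have := D (h *m h) (h *m h); lra.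
Qed.

(** The defect is at least halved by each step, so the iterates form a Cauchy
    sequence; they stay in the closed subspaces that contain [v], namely those
    cut out by [p] on the right and by [q] on the left and, when [v] is
    self-adjoint, the self-adjoint matrices. *)
Lemma polar_iteration p q v : is_projection p -> v *m p = v -> q *m v = v ->
  mnorm (p - adjmx v *m v) <= 2^-1 ->
  exists w, [/\ adjmx w *m w = p, q *m w = w, w *m p = w,
    adjmx v = v -> adjmx w = w &
    mnorm (w - v) <= 2 * mnorm v * mnorm (p - adjmx v *m v)].
Proof.
move=> pP vp qv v2.
pose u n := iter n (polar_step p) v.
pose d n := mnorm (polar_defect p (u n)); pose c := mnorm v.
have c0 : 0 <= c by exact: mnorm_ge0.
have d04 : d 0%N <= 4^-1 by rewrite /d mnorm_half /=; lra.
have d0 n : 0 <= d n by exact: mnorm_ge0.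
have up n : u n *m p = u n.
  elim: n => //= n ih; rewrite mulmxDl ih -mulmxA polar_defect_cornerr //.
  by case: pP.
have qu n : q *m u n = u n.
  by elim: n => //= n ih; rewrite mulmxDr ih mulmxA ih.
have e0 n : (0 : R) <= 2^-1 ^+ n by rewrite exprn_ge0 ?invr_ge0.
have e1 n : 2^-1 ^+ n <= 1 :> R by rewrite exprn_ile1 ?invr_ge0 // invf_le1 ?ler1n.
have dn n : d n <= d 0%N * 2^-1 ^+ n.
  elim: n => [|n ih]; first by rewrite expr0 mulr1.
  apply: le_trans (polar_defect_quadratic pP (up n) _) _; rewrite -/(d n).
    have := e1 n; have := e0 n; have := d0 0%N; nra.
  by rewrite exprS; lra.
(* This form of the bound is preserved by a factor 1 + 2^-n / 4. *)
have un n : mnorm (u n) <= c * (2 - 2^-1 ^+ n).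
  elim: n => [|n ih]; first by rewrite expr0 -/c; lra.
  have : d n <= 4^-1 * 2^-1 ^+ n.
    by apply: (le_trans (dn n)); rewrite ler_wpM2r.
  move: (e0 n) (e1 n) (d0 n) => en en1 dn0 dn4.
  apply: (le_trans (mnormD _ _)); apply: (le_trans (lerD ih (mnormM _ _))).
  apply: (@le_trans _ _ (c * (2 - 2^-1 ^+ n) + c * (2 - 2^-1 ^+ n) * d n)).
    by rewrite lerD2l ler_wpM2r.
  rewrite exprS -mulrA -mulrDr ler_wpM2l //.
  move: (2^-1 ^+ n) (d n) en en1 dn0 dn4 => E D; nra.
have un2 n : mnorm (u n) <= 2 * c.
  by apply: (le_trans (un n)); rewrite mulrC ler_wpM2r // gerBl.
have [|w uw] := @mnorm_geometric_cvg R A k k u (2 * c * d 0%N).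
  move=> n; rewrite /= addrAC subrr add0r; apply: (le_trans (mnormM _ _)).
  by rewrite -[leRHS]mulrA; apply: ler_pM; rewrite ?mnorm_ge0 ?un2 ?dn.
have cvg0 (x : 'M[A]_k) (C : R) : (forall n, mnorm x <= C * mnorm (u n - w)) ->
    0 <= C -> x = 0.
  move=> xC C0; apply: mnorm_le0.
  apply: (@geometric_le0 R _ (C * (2 * (2 * c * d 0%N)))) => n.
  by apply: (le_trans (xC n)); rewrite -mulrA ler_wpM2l.
exists w; split.
- apply/eqP; rewrite -subr_eq0 -oppr_eq0 opprB; apply/eqP; apply: mnorm_le0.
  apply: (@geometric_le0 R _ (2 * d 0%N + (2 * c + mnorm w) * (2 * (2 * c * d 0%N)))).
  move=> n; apply: (le_trans (mnorm_trans (adjmx (u n) *m u n) _ _)).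
  rewrite mulrDl; apply: lerD.
    have : mnorm (p - adjmx (u n) *m u n) = 2 * d n by rewrite /d mnorm_half; lra.
    by move=> ->; rewrite -mulrA ler_wpM2l.
  have -> : adjmx (u n) *m u n - adjmx w *m w =
      adjmx (u n) *m (u n - w) + (adjmx (u n - w)) *m w.
    by rewrite adjmxB mulmxBr mulmxBl addrA subrK.
  apply: (le_trans (mnormD _ _)); apply: (le_trans (lerD (mnormM _ _) (mnormM _ _))).
  rewrite !mnorm_adj [X in _ + X]mulrC -mulrDl -mulrA.
  by apply: ler_pM; rewrite ?addr_ge0 ?mnorm_ge0 ?lerD2r.
- apply/eqP; rewrite -subr_eq0; apply/eqP.
  apply: (@cvg0 _ (mnorm q + 1)); last by rewrite addr_ge0 ?mnorm_ge0.
  move=> n; rewrite -mnormN.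
  have -> : - (q *m w - w) = q *m (u n - w) - (u n - w).
    by rewrite mulmxBr qu !opprB [RHS]addrC addrA subrK.
  by apply: (le_trans (mnormB _ _)); rewrite mulrDl mul1r lerD2r mnormM.
- apply/eqP; rewrite -subr_eq0; apply/eqP.
  apply: (@cvg0 _ (mnorm p + 1)); last by rewrite addr_ge0 ?mnorm_ge0.
  move=> n; rewrite -mnormN.
  have -> : - (w *m p - w) = (u n - w) *m p - (u n - w).
    by rewrite mulmxBl up !opprB [RHS]addrC addrA subrK.
  by apply: (le_trans (mnormB _ _)); rewrite mulrDl mul1r lerD2r mulrC mnormM.
- move=> va; have ua n : adjmx (u n) = u n.
    elim: n => //= n ih; rewrite adjmxD adjmxM ih; congr (_ + _).
    rewrite polar_defect_adj; last by case: pP.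
    rewrite /polar_defect ih mscale_mull mscale_mulr mulmxBl mulmxBr up mulmxA.
    by rewrite -{1}ih -{1}[p](proj1 pP) -adjmxM up ih.
  apply/eqP; rewrite -subr_eq0; apply/eqP.
  apply: (@cvg0 _ 2) => // n.
  have -> : adjmx w - w = (u n - w) - adjmx (u n - w).
    by rewrite adjmxB ua opprB [RHS]addrC addrA subrK.
  by apply: (le_trans (mnormB _ _)); rewrite mnorm_adj; lra.
- have := uw 0%N; rewrite expr0 mulr1 mnormBC => /le_trans; apply.
  by rewrite /d mnorm_half /= -/c; lra.
Qed.

Lemma is_projection1 : is_projection (1%:M : 'M[A]_k).
Proof. by split; rewrite ?adjmx1 ?mul1mx. Qed.

Lemma mnorm1 : mnorm (1%:M : 'M[A]_k) = k%:R.
Proof.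
rewrite /mnorm (eq_bigr (fun=> 1)) => [|i _]; first by rewrite sumr_const card_ord.
rewrite (bigD1 i) //= big1 => [|j ij]; first by rewrite mxE eqxx cnorm1 addr0.
by rewrite mxE eq_sym (negbTE ij) cnorm0.
Qed.

(** The polar part of the near symmetry 2x - 1 is a symmetry 2p - 1. *)
Lemma near_projection x : adjmx x = x -> mnorm (x *m x - x) <= 8^-1 ->
  exists2 p, is_projection p &
    mnorm (p - x) <= 4 * (2 * mnorm x + k%:R) * mnorm (x *m x - x).
Proof.
move=> xa x8; pose s : 'M[A]_k := x *+ 2 - 1.
have sa : adjmx s = s by rewrite adjmxB mulr2n adjmxD xa [adjmx 1]adjmx1.
have ss : 1 - adjmx s *m s = - ((x *m x - x) *+ 2 *+ 2).
  by rewrite sa; exact: symmetry_defect.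
pose d := mnorm (x *m x - x); have d0 : 0 <= d by exact: mnorm_ge0.
have sd : mnorm (1 - adjmx s *m s) <= 4 * d.
  have D2 (y : 'M[A]_k) : mnorm (y *+ 2) <= 2 * mnorm y.
    by rewrite mulr2n; apply: (le_trans (mnormD _ _)); lra.
  by rewrite ss mnormN; apply: (le_trans (D2 _)); have := D2 (x *m x - x); rewrite -/d; lra.
have sn : mnorm s <= 2 * mnorm x + k%:R.
  apply: (le_trans (mnormB _ _)); rewrite [mnorm 1]mnorm1 lerD2r mulr2n.
  by apply: (le_trans (mnormD _ _)); lra.
have [|||w [w1 _ _ wa ws]] := @polar_iteration 1 1 s is_projection1.
- exact: mulr1.
- exact: mul1r.
- by apply: (le_trans sd); rewrite /d; lra.
have {}wa := wa sa; rewrite wa in w1.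
exists (half (1 + w)).
  split; first by rewrite adjmx_scale adjmxD [adjmx 1]adjmx1 wa.
  rewrite mscale_mull mscale_mulr; congr mscale.
  rewrite -[RHS]mscale_half2 -mscaleDr; congr mscale.
  rewrite -[LHS]/((1 + w) * (1 + w)) mulrDl mul1r mulrDr mulr1.
  by rewrite -[w * w]/(w *m w) w1 [w + _]addrC.
have -> : half (1 + w) - x = half (w - s).
  have -> : w - s = 1 + w - (x + x).
    by rewrite /s mulr2n opprB addrCA addrA.
  by rewrite !mscaleDr mscaleN mscaleDr mscale_half2.
rewrite mnorm_half; move: ws sd sn; rewrite -/d.
have := mnorm_ge0 s; have := mnorm_ge0 (1 - adjmx s *m s).
move: (mnorm (1 - adjmx s *m s)) (mnorm s) (mnorm (w - s)) => E S W E0 S0 h1 h2 h3.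
have : S * E <= (2 * mnorm x + k%:R) * (4 * d) by apply: ler_pM.
lra.
Qed.

(** [q *m v *m p] is a near partial isometry with initial projection [p]. *)
Lemma near_subprojection p q v (K e : R) : is_projection p -> is_projection q ->
  mnorm p <= K -> mnorm q <= K -> mnorm v <= K -> 1 <= K -> 10 * K ^+ 4 * e <= 1 ->
  mnorm (adjmx v *m v - p) <= e -> mnorm (q *m v - v) <= e ->
  mnorm (v *m p - v) <= e ->
  exists w, adjmx w *m w = p /\ q *m w = w.
Proof.
move=> pP qP pK qK vK K1 Ke vvp qv vp.
have e0 : 0 <= e by apply: le_trans qv; exact: mnorm_ge0.
have K0 : 0 <= K by apply: le_trans K1.
pose u := q *m v *m p.
have uK : mnorm u <= K * K * K.
  by do 2![apply: (le_trans (mnormM _ _)); apply: ler_pM; rewrite ?mnorm_ge0 //].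
have uv : mnorm (u - v) <= 2 * K * e.
  apply: (le_trans (mnorm_trans (q *m v) _ _)).
  have : mnorm (u - q *m v) <= K * e.
    rewrite /u -mulmxA -mulmxBr; apply: (le_trans (mnormM _ _)).
    by apply: ler_pM; rewrite ?mnorm_ge0.
  nra.
have [|||w [w1 w2 _ _ _]] := @polar_iteration p q u pP.
- by rewrite /u -mulmxA; case: pP => _ ->.
- by rewrite /u !mulmxA; case: qP => _ ->.
- rewrite mnormBC; apply: (le_trans (mnorm_trans (adjmx v *m v) _ _)).
  have -> : adjmx u *m u - adjmx v *m v =
      adjmx u *m (u - v) + (adjmx (u - v)) *m v.
    by rewrite adjmxB mulmxBr mulmxBl addrA subrK.
  have : mnorm (adjmx u *m (u - v) + (adjmx (u - v)) *m v) <=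
      K * K * K * (2 * K * e) + 2 * K * e * K.
    apply: (le_trans (mnormD _ _)); apply: lerD; apply: (le_trans (mnormM _ _));
      by rewrite mnorm_adj; apply: ler_pM; rewrite ?mnorm_ge0.
  have K4 : K * K * e <= K ^+ 4 * e.
    by rewrite ler_wpM2r // -expr2 ler_weXn2l.
  have K5 : e <= K ^+ 4 * e by rewrite ler_peMl // exprn_ege1.
  move: Ke K4 K5; rewrite -mulrA (_ : K ^+ 4 = K * K * K * K); last by ring.
  lra.
by exists w.
Qed.

(** [q *m p] is a near partial isometry with initial projection [p]. *)
Lemma close_subprojection p q : is_projection p -> is_projection q ->
  mnorm p * mnorm p * mnorm (p - q) <= 2^-1 ->
  exists w, adjmx w *m w = p /\ q *m w = w.
Proof.
move=> pP qP pq.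
have [|||w [w1 w2 _ _ _]] := @polar_iteration p q (q *m p) pP; last by exists w.
- by rewrite -mulmxA; case: pP => _ ->.
- by rewrite mulmxA; case: qP => _ ->.
- apply: le_trans pq; rewrite adjmxM (proj1 pP) (proj1 qP).
  have -> : p - p *m q *m (q *m p) = p *m (p - q) *m p.
    rewrite mulmxBr mulmxBl (proj2 pP) (proj2 pP) -!mulmxA (mulmxA q).
    by rewrite (proj2 qP).
  apply: (le_trans (mnormM _ _)); rewrite -[leRHS]mulrA [leRHS]mulrC.
  by rewrite ler_wpM2r ?mnorm_ge0 // mnormM.
Qed.

End Polar.
(** * Comparability and finiteness for matrices of complex matrices *)

Section ComplexMatrices.
Variable R : realType.
Local Notation C := R[i].

(** The rows of [u] are an orthonormal basis of the row space of [p]. *)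
Lemma complex_projection_factor N (p : 'M[C]_N) : ctrmx p = p -> p *m p = p ->
  exists u : 'M[C]_(\rank p, N), u *m ctrmx u = 1%:M /\ ctrmx u *m u = p.
Proof.
move=> pa pp; have rN : (\rank p <= N)%N by exact: rank_leq_col.
pose u := schmidt (row_base p).
have uu : u *m ctrmx u = 1%:M by exact/unitarymxP/schmidt_unitarymx.
have up : (u :=: p)%MS.
  by apply: eqmx_trans (eq_row_base p); apply: eqmx_schmidt_free; exact: row_base_free.
have /submxP[D uD] : (u <= p)%MS by rewrite up.
have /submxP[X pX] : (p <= u)%MS by rewrite up.
exists u; split=> //.
have e1 : u *m p = u by rewrite uD -mulmxA pp.
have e2 : p *m ctrmx u = ctrmx u by have := congr1 (@ctrmx _ _ _) e1; rewrite ctrmxM pa.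
suff <- : X = ctrmx u by rewrite -pX.
by rewrite -[X in X = _]mulmx1 -uu mulmxA -pX.
Qed.

(** Projections of ranks r <= s are factored through isometries of C^r and C^s,
    and the inclusion of C^r in C^s compares them. *)
Lemma complex_projection_le N (p q : 'M[C]_N) :
  ctrmx p = p -> p *m p = p -> ctrmx q = q -> q *m q = q ->
  (\rank p <= \rank q)%N ->
  exists v : 'M[C]_N, [/\ ctrmx v *m v = p, q *m v = v & v *m p = v].
Proof.
move=> pa pp qa qq; have [u [u1 u2]] := complex_projection_factor pa pp.
have [w [w1 w2]] := complex_projection_factor qa qq.
move: (\rank p) (\rank q) u u1 u2 w w1 w2 => r s u u1 u2 w w1 w2 rs.
pose j : 'M[C]_(s, r) := pid_mx r.
have jj : ctrmx j *m j = 1%:M.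
  have -> : ctrmx j = pid_mx r by rewrite /ctrmx tr_pid_mx map_pid_mx.
  by rewrite mul_pid_mx minnn (minn_idPr rs) pid_mx_1.
exists (ctrmx w *m j *m u); split.
- rewrite !ctrmxM ctrmxK -!mulmxA (mulmxA w) w1 mul1mx (mulmxA _ j) jj mul1mx.
  exact: u2.
- by rewrite -w2 -!mulmxA (mulmxA w) w1 mul1mx.
- by rewrite -u2 -!mulmxA (mulmxA u) u1 mul1mx.
Qed.

Variables n k : nat.
Local Notation B := ('M[C]_n.+1 : cstarAlgType R).
Local Notation I := ('I_k * 'I_n.+1)%type.

(** The identification of M_k(M_n) with the matrices of size kn. *)
Definition flat (X : 'M[B]_k) : 'M[C]_#|{: I}| :=
  \matrix_(a, b) X (enum_val a).1 (enum_val b).1 (enum_val a).2 (enum_val b).2.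

Definition unflat (Y : 'M[C]_#|{: I}|) : 'M[B]_k :=
  \matrix_(i, j) \matrix_(a, b) Y (enum_rank (i, a)) (enum_rank (j, b)).

Lemma flatK : cancel flat unflat.
Proof.
move=> X; apply/matrixP => i j; apply/matrixP => a b.
by rewrite !mxE !enum_rankK.
Qed.

Lemma unflatK : cancel unflat flat.
Proof.
move=> Y; apply/matrixP => a b.
by rewrite !mxE -!surjective_pairing !enum_valK.
Qed.

Lemma flatM (X Y : 'M[B]_k) : flat (X *m Y) = flat X *m flat Y.
Proof.
apply/matrixP => a b; rewrite !mxE.
rewrite [RHS](reindex (@enum_rank _)) /=; last exact/onW_bij/enum_rank_bij.
under [RHS]eq_bigr => c _ do rewrite !mxE enum_rankK.
rewrite summxE -(pair_bigA _ (fun i c => X (enum_val a).1 i (enum_val a).2 c *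
  Y i (enum_val b).1 c (enum_val b).2)) /=.
by apply: eq_bigr => i _; exact: mxE.
Qed.

Lemma flat1 : flat 1%:M = 1%:M.
Proof.
apply/matrixP => a b; rewrite !mxE -(inj_eq enum_val_inj).
case: (enum_val a) (enum_val b) => [i x] [j y] /=.
by rewrite xpair_eqE; case: (i == j); rewrite /= ?mxE.
Qed.

Lemma flat_adj (X : 'M[B]_k) : flat (adjmx X) = ctrmx (flat X).
Proof. by apply/matrixP => a b; rewrite !mxE. Qed.

Lemma unflatM Y Z : unflat (Y *m Z) = unflat Y *m unflat Z.
Proof. by rewrite -[RHS]flatK flatM !unflatK. Qed.

Lemma unflat_adj Y : unflat (ctrmx Y) = adjmx (unflat Y).
Proof. by rewrite -[RHS]flatK flat_adj unflatK. Qed.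

Lemma complex_comparable (p q : 'M[B]_k) : is_projection p -> is_projection q ->
  (exists v : 'M[B]_k, [/\ adjmx v *m v = p, q *m v = v & v *m p = v]) \/
  (exists v : 'M[B]_k, [/\ adjmx v *m v = q, p *m v = v & v *m q = v]).
Proof.
have lift (p1 q1 : 'M[B]_k) : is_projection p1 -> is_projection q1 ->
    (\rank (flat p1) <= \rank (flat q1))%N ->
    exists v : 'M[B]_k, [/\ adjmx v *m v = p1, q1 *m v = v & v *m p1 = v].
  move=> [pa pp] [qa qq] le; have [||||//|v [v1 v2 v3]] := @complex_projection_le _ (flat p1) (flat q1).
  - by rewrite -flat_adj pa.
  - by rewrite -flatM pp.
  - by rewrite -flat_adj qa.
  - by rewrite -flatM qq.
  exists (unflat v); split; first by rewrite -unflat_adj -unflatM v1 flatK.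
    by rewrite -[q1]flatK -unflatM v2.
  by rewrite -[p1]flatK -unflatM v3.
move=> pP qP; have [le|/ltnW le] := leqP (\rank (flat p)) (\rank (flat q)).
  by left; apply: lift.
by right; apply: lift.
Qed.

Lemma complex_finite (w : 'M[B]_k) : adjmx w *m w = 1%:M -> w *m adjmx w = 1%:M.
Proof.
move=> ww; apply: (can_inj flatK); rewrite flatM flat1.
by apply: mulmx1C; rewrite -flatM ww flat1.
Qed.

(** For a vector x, the sum of the squared lengths of the [v l j] x over all
    [l] is the value at x of the quadratic form of the block [j], [j] on the
    right. *)
Lemma complex_block_norm (v : 'M[B]_k) i j :
  cnorm (v i j) ^+ 2 <= cnorm ((adjmx v *m v) j j).
Proof.
rewrite -[leRHS]sqr_sqrtr ?cnorm_ge0 // ler_pXn2r ?nnegrE ?cnorm_ge0 ?sqrtr_ge0 //.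
apply: opnorm_lub => x x1.
rewrite -[leLHS]ger0_norm ?vnorm_ge0 // -sqrtr_sqr ler_wsqrtr //.
apply: (@le_trans _ _ (\sum_l vnorm ((v l j : 'M[C]__) *m x) ^+ 2)).
  by rewrite (bigD1 i) //= lerDl sumr_ge0 // => l _; rewrite sqr_ge0.
have e : (\sum_l vnorm ((v l j : 'M[C]__) *m x) ^+ 2)%:C =
    (ctrmx x *m (((adjmx v *m v) j j : 'M[C]__) *m x)) 0 0.
  have -> : (adjmx v *m v) j j = \sum_l ctrmx (v l j : 'M[C]__) *m (v l j : 'M[C]__).
    by rewrite mxE; apply: eq_bigr => l _; rewrite !mxE.
  rewrite mulmx_suml mulmx_sumr summxE rmorph_sum; apply: eq_bigr => l _.
  by rewrite /= -ctrmx_mul_vec ctrmxM !mulmxA.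
rewrite -[leLHS]ger0_norm; last by apply: sumr_ge0 => l _; rewrite sqr_ge0.
rewrite -normc_realc e; apply: (le_trans (dot_le _ _)).
rewrite -[leRHS]mul1r; apply: ler_pM; rewrite ?vnorm_ge0 //.
exact: opnorm_ub.
Qed.

End ComplexMatrices.

(** * The fundamental theorem of ultraproducts *)

Section UniformBounds.
Variable R : realType.

Lemma star_poly_bound n (P : star_poly R n) (M : R) : exists B : R,
  forall (A : cstarAlgType R) (v : 'I_n -> A), (forall i, cnorm (v i) <= M) ->
  cnorm (star_poly_eval P v) <= B.
Proof.
elim: P => [i||P [B hB] Q [D hD]|P [B hB] Q [D hD]|c P [B hB]|P [B hB]].
- by exists M => A v; apply.
- by exists 1 => A v _ /=; rewrite cnorm1.
- exists (B + D) => A v vM /=; apply: (le_trans (ler_cnormD _ _)).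
  by apply: lerD; [exact: hB|exact: hD].
- exists (B * D) => A v vM /=; apply: (le_trans (ler_cnormM _ _)).
  by apply: ler_pM; rewrite ?cnorm_ge0 ?hB ?hD.
- exists (normc c * B) => A v vM /=; rewrite cnormZ.
  by rewrite ler_wpM2l ?hB // normc_ge0.
- by exists B => A v vM /=; rewrite cnorm_star hB.
Qed.

Lemma continuous_box_bound k (f : 'rV[R]_k -> R) (B : 'I_k -> R) : continuous f ->
  exists D : R, forall x : 'rV[R]_k, (forall i, `|x 0 i| <= B i) -> `|f x| <= D.
Proof.
move=> fc.
have box : compact [set x : 'rV[R]_k | forall i, `[- B i, B i]%classic (x 0 i)].
  apply: (@rV_compact R k (fun i => `[- B i, B i]%classic)) => i.
  exact: segment_compact.
have := @continuous_compact _ _ f _ (continuous_subspaceT fc) box.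
move/compact_bounded => [D [_ hD]]; exists (D + 1) => x xB.
apply: (hD (D + 1)); first by rewrite ltrDl.
by exists x => // i /=; rewrite in_itv /= -ler_norml.
Qed.

Lemma cons_val_bound (A : cstarAlgType R) n (x : A) (v : 'I_n -> A) (M : R) :
  cnorm x <= 1 -> (forall i, cnorm (v i) <= M) ->
  forall i, cnorm (cons_val x v i) <= Num.max 1 M.
Proof.
move=> x1 vM i; rewrite /cons_val.
by case: unlift => [l|] /=; rewrite le_max ?vM ?x1 ?orbT.
Qed.

Lemma ball_sup_bound (A : cstarAlgType R) (F : A -> R) (B : R) :
  (forall x, unit_ball x -> `|F x| <= B) ->
  has_sup [set F x | x in @unit_ball R A] /\
  `|sup [set F x | x in @unit_ball R A]| <= B.
Proof.
move=> FB; have b0 : @unit_ball R A 0 by rewrite /unit_ball /= cnorm0.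
have hs : has_sup [set F x | x in @unit_ball R A].
  split; first by exists (F 0), 0.
  by exists B => _ [x xb <-]; apply: le_trans (FB _ xb); exact: ler_norm.
split=> //; rewrite ler_norml; apply/andP; split.
  apply: (@le_trans _ _ (F 0)); last by apply: sup_upper_bound => //; exists 0.
  by have := FB _ b0; rewrite ler_norml => /andP[].
apply: sup_le_ub; first by case: hs.
by move=> _ [x xb <-]; apply: le_trans (FB _ xb); exact: ler_norm.
Qed.

Lemma inf_imageE (T : Type) (D : set T) (F : T -> R) :
  inf [set F x | x in D] = - sup [set - F x | x in D].
Proof. by rewrite /inf image_comp. Qed.

(** The bound is uniform in the algebra, which makes the values of a formula
    along a family of algebras converge along an ultrafilter. *)
Lemma formula_bound n (phi : formula R n) (M : R) : exists B : R,
  forall (A : cstarAlgType R) (v : 'I_n -> A), (forall i, cnorm (v i) <= M) ->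
  `|formula_eval phi v| <= B.
Proof.
elim: phi M => {n}[n P|n k f fc phi ih|n phi ih|n phi ih] M.
- have [B hB] := star_poly_bound P M; exists B => A v vM /=.
  by rewrite ger0_norm ?cnorm_ge0 ?hB.
- have /choice[B hB] : forall i, exists B : R, forall (A : cstarAlgType R)
      (v : 'I_n -> A), (forall l, cnorm (v l) <= M) -> `|formula_eval (phi i) v| <= B.
    by move=> i; exact: ih.
  have [D hD] := continuous_box_bound B fc.
  by exists D => A v vM /=; apply: hD => i; rewrite mxE hB.
- have [B hB] := ih (Num.max 1 M); exists B => A v vM /=.
  have [x xb|_ //] := @ball_sup_bound A (fun x => formula_eval phi (cons_val x v)) B.
  by apply: hB; exact: cons_val_bound.
- have [B hB] := ih (Num.max 1 M); exists B => A v vM /=.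
  rewrite inf_imageE normrN.
  have [x xb|_ //] := @ball_sup_bound A (fun x => - formula_eval phi (cons_val x v)) B.
  by rewrite normrN; apply: hB; exact: cons_val_bound.
Qed.

End UniformBounds.

Section Los.
Variables (R : realType) (J : Type) (U : set_system J) (hU : UltraFilter U).
Variable A : J -> cstarAlgType R.
Local Notation UP := (ultraproduct hU A : cstarAlgType R).

Definition ucls (a : bounded_family A) : UP := \pi_(ultraproduct hU A)%qT a.

Lemma cnorm_ucls a : cnorm (ucls a) = fnorm U a.
Proof. exact: upi_norm. Qed.

Lemma star_poly_ultraproduct n (P : star_poly R n) (a : 'I_n -> bounded_family A) :
  exists2 b : bounded_family A, (forall j, b j = star_poly_eval P (fun i => a i j)) &
    star_poly_eval P (fun i => ucls (a i)) = ucls b.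
Proof.
elim: P => [i||P [b hb eb] Q [d hd ed]|P [b hb eb] Q [d hd ed]|c P [b hb eb]|P [b hb eb]] /=.
- by exists (a i).
- by exists (fone A).
- by exists (fadd b d) => [j|] /=; rewrite ?hb ?hd // eb ed /ucls upiD.
- by exists (fmul b d) => [j|] /=; rewrite ?hb ?hd // eb ed /ucls upiM.
- by exists (fscale c b) => [j|] /=; rewrite ?hb // eb /ucls upiZ.
- by exists (fstar b) => [j|] /=; rewrite ?hb // eb /ucls -upi_star.
Qed.

Lemma truncated_bounded (a : bounded_family A) : exists M : R,
  forall j, cnorm ((Num.max 1 (cnorm (a j)))^-1%:C *: a j) <= M.
Proof.
exists 1 => j; rewrite cnormZ normc_realc ger0_norm ?invr_ge0 ?le_max ?ler01 //.
by rewrite ler_pdivrMl ?lt_max ?ltr01 // mulr1 le_max lexx orbT.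
Qed.

(** The unit ball of the ultraproduct is the image of the product of the unit
    balls. *)
Lemma unit_ball_lift (x : UP) : cnorm x <= 1 ->
  exists2 b : bounded_family A, ucls b = x & forall j, cnorm (b j) <= 1.
Proof.
elim/upi_ind: x => a; rewrite -/(ucls a) cnorm_ucls => a1.
exists (BoundedFamily (truncated_bounded a)); last first.
  move=> j /=; rewrite cnormZ normc_realc ger0_norm ?invr_ge0 ?le_max ?ler01 //.
  by rewrite ler_pdivrMl ?lt_max ?ltr01 // mulr1 le_max lexx orbT.
apply: upiP_le; apply/ler_addgt0Pr => e e0; rewrite add0r; apply: fnorm_le.
have a1e : fnorm U a < 1 + e by apply: le_lt_trans a1 _; rewrite ltrDl.
have : \forall j \near U, cnorm (a j) < 1 + e by exact: (cvgr_lt _ (@fnorm_cvg _ _ _ _ _ a)).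
apply: filterS => j aj /=; set m := Num.max _ _.
have m0 : 0 < m by rewrite lt_max ltr01.
have m1 : m < 1 + e by rewrite gt_max ltrDl e0.
have -> : m^-1%:C *: a j - a j = (m^-1 - 1)%:C *: a j.
  by rewrite rmorphB rmorph1 scalerBl scale1r.
have mi : m^-1 <= 1 by rewrite invf_le1 // le_max lexx.
rewrite cnormZ normc_realc ler0_norm ?subr_le0 // opprB.
apply: (@le_trans _ _ ((1 - m^-1) * m)).
  by rewrite ler_wpM2l ?subr_ge0 // le_max lexx orbT.
by rewrite mulrBl mul1r mulVf ?gt_eqF //; lra.
Qed.

(** Arguments that are nearly optimal in each factor form a family in the unit
    ball of the ultraproduct. *)
Lemma ultraproduct_sup (F : forall j, A j -> R) (G : UP -> R) (B : R) :
  (forall j x, unit_ball x -> `|F j x| <= B) ->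
  (forall b : bounded_family A, (forall j, cnorm (b j) <= 1) ->
    G (ucls b) = ulim U (fun j => F j (b j))) ->
  sup [set G x | x in unit_ball (A := UP)] =
  ulim U (fun j => sup [set F j x | x in unit_ball (A := A j)]).
Proof.
move=> FB GF.
have cvF (b : bounded_family A) : (forall j, cnorm (b j) <= 1) ->
    (fun j => F j (b j)) @ U --> G (ucls b).
  by move=> b1; rewrite GF //; apply: (ulimP hU (M := B)) => j; apply: FB; exact: b1.
have sF j := ball_sup_bound (@FB j).
have cvS := ulimP hU (fun j => proj2 (sF j)).
set s := ulim U _ in cvS *.
have ub x : unit_ball x -> G x <= s.
  move=> /unit_ball_lift[b <- b1]; apply: (ulim_le hU (cvF b b1) cvS) => j.
  by apply: sup_upper_bound; [case: (sF j)|exists (b j) => //; exact: b1].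
have b0 : unit_ball (0 : UP) by rewrite /unit_ball /= cnorm0.
apply/le_anti/andP; split.
  by apply: sup_le_ub => [|_ [x xb <-]]; [exists (G 0), 0|exact: ub].
apply/ler_addgt0Pr => e e0.
have ex j : exists x : A j, unit_ball x /\
    sup [set F j x | x in unit_ball (A := A j)] - e < F j x.
  have [_ [x xb <-] xe] := @sup_adherent _ _ e e0 (proj1 (sF j)).
  by exists x.
pose x j := projT1 (cid (ex j)).
have xP j : unit_ball (x j) /\
    sup [set F j x | x in unit_ball (A := A j)] - e < F j (x j).
  exact: projT2 (cid (ex j)).
have xM : exists M : R, forall j, cnorm (x j) <= M.
  by exists 1 => j; case: (xP j).
pose b := BoundedFamily xM.
have b1 j : cnorm (b j) <= 1 by case: (xP j).
apply: (@le_trans _ _ (G (ucls b) + e)).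
  rewrite -lerBlDr; have cvSe : (fun j => sup [set F j x | x in unit_ball (A := A j)] - e) @ U --> s - e.
    by apply: cvgB => //; exact: cvg_cst.
  by apply: (ulim_le hU cvSe (cvF b b1)) => j; apply: ltW; case: (xP j).
rewrite lerD2r; apply: sup_upper_bound.
  by split; [exists (G 0), 0|exists s => _ [y yb <-]; exact: ub].
exists (ucls b) => //; rewrite /unit_ball /= cnorm_ucls.
by apply: fnorm_le; apply: filterE.
Qed.

Lemma ulimN (f : J -> R) (M : R) : (forall j, `|f j| <= M) ->
  ulim U (fun j => - f j) = - ulim U f.
Proof.
by move=> fM; apply: ulim_unique; apply: cvgN; exact: (ulimP hU fM).
Qed.

Definition cons_family n (b : bounded_family A) (a : 'I_n -> bounded_family A) :=
  fun i => oapp a b (unlift ord0 i).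

Lemma cons_family_ucls n b (a : 'I_n -> bounded_family A) :
  cons_val (ucls b) (fun i => ucls (a i)) = fun i => ucls (cons_family b a i).
Proof.
by apply/funext => i; rewrite /cons_val /cons_family; case: unlift.
Qed.

Lemma cons_family_val n (b : bounded_family A) (a : 'I_n -> bounded_family A) j :
  cons_val (b j) (fun i => a i j) = fun i => cons_family b a i j.
Proof.
by apply/funext => i; rewrite /cons_val /cons_family; case: unlift.
Qed.

Lemma families_bound n (a : 'I_n -> bounded_family A) :
  exists M : R, forall i j, cnorm (a i j) <= M.
Proof.
have /choice[M hM] := fun i => family_bounded (a i).
exists (\sum_i `|M i|) => i j; apply: (le_trans (hM i j)).
rewrite (bigD1 i) //=; apply: (le_trans (ler_norm _)).
by rewrite lerDl sumr_ge0.
Qed.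

Theorem ultraproduct_los n (phi : formula R n) (a : 'I_n -> bounded_family A) :
  formula_eval phi (fun i => ucls (a i)) =
  ulim U (fun j => formula_eval phi (fun i => a i j)).
Proof.
elim: phi a => {n}[n P|n k f fc phi ih|n phi ih|n phi ih] a /=.
- have [b hb ->] := star_poly_ultraproduct P a.
  rewrite cnorm_ucls /fnorm; congr ulim; apply/funext => j.
  by rewrite hb.
- have [M aM] := families_bound a.
  apply/esym/ulim_unique.
  apply: (@cvg_comp _ _ _ (fun j => \row_i formula_eval (phi i) (fun i0 => a i0 j)) f
    U (nbhs (\row_i formula_eval (phi i) (fun i0 => ucls (a i0)))) _ _ (fc _)).
  move=> Q [P nP PQ]; rewrite /nbhs /=.
  apply: (@filterS _ U _ [set j | forall i, P 0 i (formula_eval (phi i) (fun i0 => a i0 j))]).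
    by move=> j h; apply: PQ => l i; rewrite mxE ord1.
  apply: filter_forall => i; have := nP 0 i; rewrite mxE ih.
  have [B hB] := formula_bound (phi i) M.
  by apply: (ulimP hU (M := B)) => j; exact: hB.
- have [M aM] := families_bound a.
  have [B hB] := formula_bound phi (Num.max 1 M).
  apply: (@ultraproduct_sup (fun j x => formula_eval phi (cons_val x (fun i => a i j)))
    (fun x => formula_eval phi (cons_val x (fun i => ucls (a i)))) B).
    by move=> j x xb; apply: hB; exact: cons_val_bound.
  move=> b b1; rewrite cons_family_ucls ih; congr ulim; apply/funext => j.
  by rewrite cons_family_val.
- have [M aM] := families_bound a.
  have [B hB] := formula_bound phi (Num.max 1 M).
  have FB j x : unit_ball x ->
      `|- formula_eval phi (cons_val x (fun i => a i j))| <= B.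
    by move=> xb; rewrite normrN; apply: hB; exact: cons_val_bound.
  under [in RHS]eq_fun => j do rewrite inf_imageE.
  rewrite inf_imageE (ulimN (fun j => proj2 (ball_sup_bound (@FB j)))); congr (- _).
  apply: (@ultraproduct_sup (fun j x => - formula_eval phi (cons_val x (fun i => a i j)))
    (fun x => - formula_eval phi (cons_val x (fun i => ucls (a i)))) B FB).
  move=> b b1; rewrite cons_family_ucls ih.
  rewrite -(ulimN (M := B)); first by congr ulim; apply/funext => j; rewrite cons_family_val.
  by move=> j; have := FB j (b j) (b1 j); rewrite normrN cons_family_val.
Qed.

End Los.

(** * Definability by continuous formulas over matrix variables *)

Section Definability.
Variables (R : realType) (k : nat).

(** A list of matrix variables is a list of blocks of k^2 variables of the
    formal language; the most recently bound block comes first. *)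
Fixpoint ctx d : nat := if d is d'.+1 then (k * k + ctx d')%N else 0%N.

Definition cat_val (T : Type) m n (w : 'I_m -> T) (v : 'I_n -> T) (i : 'I_(m + n)) : T :=
  match fintype.split i with inl a => w a | inr b => v b end.

Fixpoint ctx_val (A : cstarAlgType R) d (s : seq 'M[A]_k) : 'I_(ctx d) -> A :=
  if d is d'.+1 then cat_val (mxvec (head 0 s) 0) (ctx_val (behead s))
  else fun=> 0.

Arguments ctx_val {A} d s i.

(** The values are functions of a whole family of algebras: definability is by
    one formula, uniformly in the algebra. *)
Definition definable d (Phi : forall A : cstarAlgType R, seq 'M[A]_k -> R) :=
  exists phi : formula R (ctx d),
    forall A s, formula_eval phi (ctx_val d s) = Phi A s.

Definition elt_poly d (t : forall A : cstarAlgType R, seq 'M[A]_k -> A) :=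
  exists P : star_poly R (ctx d),
    forall A s, star_poly_eval P (ctx_val d s) = t A s.

Definition mx_poly d (M : forall A : cstarAlgType R, seq 'M[A]_k -> 'M[A]_k) :=
  forall i j, elt_poly d (fun A s => M A s i j).

Lemma cat_val_lshift (T : Type) m n (w : 'I_m -> T) (v : 'I_n -> T) i :
  cat_val w v (lshift n i) = w i.
Proof. by rewrite /cat_val (unsplitK (inl i)). Qed.

Lemma cat_val_rshift (T : Type) m n (w : 'I_m -> T) (v : 'I_n -> T) i :
  cat_val w v (rshift m i) = v i.
Proof. by rewrite /cat_val (unsplitK (inr i)). Qed.

Lemma cat_val0 (T : Type) n (w : 'I_0 -> T) (v : 'I_n -> T) : cat_val w v = v.
Proof.
by apply/funext => i; rewrite -[in LHS](_ : rshift 0 i = i) ?cat_val_rshift //; exact: val_inj.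
Qed.

Lemma cons_cat_val (A : cstarAlgType R) m n (x : A) (w : 'I_m -> A) (v : 'I_n -> A) :
  cons_val x (cat_val w v) = cat_val (cons_val x w) v :> ('I_(m.+1 + n) -> A).
Proof.
apply/funext => i; case: (split_ordP i) => [j ->|j ->].
  rewrite cat_val_lshift /cons_val; case: (unliftP ord0 j) => [l ->|->] /=.
    have -> : lshift n (lift ord0 l) = lift ord0 (lshift n l) :> 'I_(m.+1 + n).
      exact: val_inj.
    by rewrite liftK /= cat_val_lshift.
  have -> : lshift n ord0 = ord0 :> 'I_(m.+1 + n) by exact: val_inj.
  by rewrite unlift_none.
rewrite cat_val_rshift /cons_val.
have -> : rshift m.+1 j = lift ord0 (rshift m j) :> 'I_(m.+1 + n) by exact: val_inj.
by rewrite liftK /= cat_val_rshift.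
Qed.

Lemma cons_val_eta (A : cstarAlgType R) m (w : 'I_m.+1 -> A) :
  cons_val (w ord0) (fun i => w (lift ord0 i)) = w.
Proof.
apply/funext => i; rewrite /cons_val.
by case: unliftP => [l ->|->].
Qed.

Lemma val_bounded (A : cstarAlgType R) n (v : 'I_n -> A) :
  exists M : R, forall i, cnorm (v i) <= M.
Proof.
exists (\sum_i cnorm (v i)) => i; rewrite (bigD1 i) //= lerDl.
by apply: sumr_ge0 => j _; exact: cnorm_ge0.
Qed.

Fixpoint FSups m n : formula R (m + n) -> formula R n :=
  match m with
  | 0 => id
  | m'.+1 => fun phi => FSups (FSup phi : formula R (m' + n))
  end.

Lemma FSups_le (A : cstarAlgType R) m n (phi : formula R (m + n)) (v : 'I_n -> A) (c : R) :
  formula_eval (FSups phi) v <= c <->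
  forall w : 'I_m -> A, (forall i, cnorm (w i) <= 1) ->
    formula_eval phi (cat_val w v) <= c.
Proof.
elim: m phi => [|m ih] phi.
  split => [h w _|/(_ (fun=> 0))]; first by rewrite cat_val0.
  by rewrite cat_val0; apply; case.
apply: (iff_trans (ih _)); split => [h w w1|h w w1] /=.
  rewrite -(cons_val_eta w) -cons_cat_val.
  apply: le_trans (h (fun i => w (lift ord0 i)) _); last by move=> i.
  have [M hM] := val_bounded (cat_val (fun i => w (lift ord0 i)) v).
  have [B hB] := formula_bound (phi : formula R (m + n).+1) (Num.max 1 M).
  apply: sup_upper_bound; last by exists (w ord0) => //; exact: w1.
  apply: (proj1 (@ball_sup_bound _ _ _ B _)) => x xb.
  by apply: hB; exact: cons_val_bound.
apply: sup_le_ub; first by eexists; exists 0 => //; rewrite /unit_ball /= cnorm0.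
move=> _ [x xb <-]; rewrite cons_cat_val; apply: h => i.
rewrite /cons_val; case: unlift => [l|] /=; [exact: w1|exact: xb].
Qed.

Definition mxball (A : cstarAlgType R) : set 'M[A]_k :=
  [set X | forall i j, cnorm (X i j) <= 1].

Lemma mxball0 (A : cstarAlgType R) : mxball (0 : 'M[A]_k).
Proof. by move=> i j; rewrite mxE cnorm0. Qed.

(** A definable quantity is bounded when the variable bound last ranges over
    the unit ball, so that its supremum and infimum are genuine. *)
Lemma definable_bound d Phi : definable d.+1 Phi ->
  forall (A : cstarAlgType R) (s : seq 'M[A]_k), exists B : R,
  forall X, mxball X -> `|Phi A (X :: s)| <= B.
Proof.
move=> [phi hphi] A s; have [M hM] := val_bounded (ctx_val d s).
have [B hB] := formula_bound phi (Num.max 1 M).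
exists B => X X1; rewrite -hphi; apply: hB => i /=.
rewrite /cat_val; case: fintype.split => [a|b]; last by rewrite le_max hM orbT.
by case/mxvec_indexP: a => a b; rewrite mxvecE le_max X1.
Qed.

Lemma definable_has_sup d Phi (A : cstarAlgType R) (s : seq 'M[A]_k) :
  definable d.+1 Phi -> has_sup [set Phi A (X :: s) | X in @mxball A].
Proof.
move=> /definable_bound/(_ A s)[B hB]; split.
  by exists (Phi A (0 :: s)); exists 0 => //; exact: mxball0.
by exists B => _ [X X1 <-]; apply: le_trans (hB _ X1); exact: ler_norm.
Qed.

Lemma definable_sup d Phi : definable d.+1 Phi ->
  definable d (fun A s => sup [set Phi A (X :: s) | X in @mxball A]).
Proof.
move=> dPhi; have [phi hphi] := dPhi.
exists (FSups (phi : formula R (k * k + ctx d))) => A s.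
have hs := definable_has_sup s dPhi.
apply/le_anti/andP; split.
  apply/FSups_le => w w1.
  have -> : w = mxvec (vec_mx (\row_i w i)) 0.
    by apply/funext => i; rewrite vec_mxK mxE.
  rewrite -[cat_val _ _]/(ctx_val d.+1 (vec_mx (\row_i w i) :: s)) hphi.
  apply: sup_upper_bound => //; exists (vec_mx (\row_i w i)) => // i j.
  by rewrite -mxvecE vec_mxK mxE.
apply: sup_le_ub; first by case: hs.
move=> _ [X X1 <-]; rewrite -hphi.
have /FSups_le := lexx (formula_eval (FSups (phi : formula R (k * k + ctx d))) (ctx_val d s)).
by apply => i; case/mxvec_indexP: i => i j; rewrite mxvecE.
Qed.

Lemma definable_conn d m (f : 'rV[R]_m -> R) Phi : continuous f ->
  (forall i : 'I_m, definable d (Phi i)) ->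
  definable d (fun A s => f (\row_i Phi i A s)).
Proof.
move=> fc /choice[phi hphi]; exists (FConn fc phi) => A s /=.
by congr f; apply/rowP => i; rewrite !mxE hphi.
Qed.

Lemma definable_ext d Phi Psi : definable d Phi ->
  (forall A s, Phi A s = Psi A s) -> definable d Psi.
Proof. by move=> [phi hphi] e; exists phi => A s; rewrite hphi. Qed.

Lemma definable_cst d (c : R) : definable d (fun _ _ => c).
Proof.
apply: (definable_ext (@definable_conn d 0 (fun=> c) (fun _ _ _ => 0) _ _)) => //.
  exact: cst_continuous.
by case.
Qed.

Lemma definableZ d (c : R) Phi : definable d Phi ->
  definable d (fun A s => c * Phi A s).
Proof.
move=> h.
apply: (definable_ext (@definable_conn d 1 (fun x => c * x 0 0) (fun=> Phi) _ _)) => //.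
  move=> x; have hx : {for x, continuous (fun x : 'rV[R]_1 => x 0 0)}.
    exact: coord_continuous.
  exact: (continuousM (@cst_continuous _ _ c x) hx).
by move=> A s; rewrite mxE.
Qed.

Lemma definableN d Phi : definable d Phi -> definable d (fun A s => - Phi A s).
Proof.
by move=> /(@definableZ d (-1)) h; apply: definable_ext h _ => A s; rewrite mulN1r.
Qed.

Lemma definable_conn2 d (f : R -> R -> R) Phi Psi :
  continuous (fun x : 'rV[R]_2 => f (x 0 0) (x 0 1)) ->
  definable d Phi -> definable d Psi -> definable d (fun A s => f (Phi A s) (Psi A s)).
Proof.
move=> fc h1 h2.
apply: (definable_ext (@definable_conn d 2 _ (fun i => if i == 0 then Phi else Psi) fc _)).
  by move=> i; case: eqP.
by move=> A s; rewrite !mxE.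
Qed.

Lemma definableD d Phi Psi : definable d Phi -> definable d Psi ->
  definable d (fun A s => Phi A s + Psi A s).
Proof.
apply: definable_conn2 => x.
have hx i : {for x, continuous (fun x : 'rV[R]_2 => x 0 i)} by exact: coord_continuous.
exact: (continuousD (hx 0) (hx 1)).
Qed.

Lemma definableB d Phi Psi : definable d Phi -> definable d Psi ->
  definable d (fun A s => Phi A s - Psi A s).
Proof. by move=> h1 /definableN h2; exact: definableD. Qed.

Lemma definable_min d Phi Psi : definable d Phi -> definable d Psi ->
  definable d (fun A s => Num.min (Phi A s) (Psi A s)).
Proof.
apply: definable_conn2; apply: min_fun_continuous; exact: coord_continuous.
Qed.

Lemma definable_max d Phi Psi : definable d Phi -> definable d Psi ->
  definable d (fun A s => Num.max (Phi A s) (Psi A s)).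
Proof.
apply: definable_conn2; apply: max_fun_continuous; exact: coord_continuous.
Qed.

Lemma definable_sum d (I : Type) (r : seq I) Phi : (forall i : I, definable d (Phi i)) ->
  definable d (fun A s => \sum_(i <- r) Phi i A s).
Proof.
move=> h; elim: r => [|i r ih].
  by apply: definable_ext (definable_cst d 0) _ => A s; rewrite big_nil.
by apply: definable_ext (definableD (h i) ih) _ => A s; rewrite big_cons.
Qed.

Lemma definable_inf d Phi : definable d.+1 Phi ->
  definable d (fun A s => inf [set Phi A (X :: s) | X in @mxball A]).
Proof.
move=> /definableN/definable_sup/definableN h; apply: definable_ext h _ => A s.
by rewrite inf_imageE.
Qed.

Lemma definable_cnorm d t : elt_poly d t -> definable d (fun A s => cnorm (t A s)).
Proof. by move=> [P hP]; exists (FNorm P) => A s /=; rewrite hP. Qed.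

Lemma definable_mnorm d M : mx_poly d M -> definable d (fun A s => mnorm (M A s)).
Proof.
by move=> h; do 2![apply: definable_sum => ?]; exact: definable_cnorm.
Qed.

Lemma elt_polyD d t u : elt_poly d t -> elt_poly d u ->
  elt_poly d (fun A s => t A s + u A s).
Proof. by move=> [P hP] [Q hQ]; exists (PAdd P Q) => A s /=; rewrite hP hQ. Qed.

Lemma elt_polyM d t u : elt_poly d t -> elt_poly d u ->
  elt_poly d (fun A s => t A s * u A s).
Proof. by move=> [P hP] [Q hQ]; exists (PMul P Q) => A s /=; rewrite hP hQ. Qed.

Lemma elt_polyZ d (c : R[i]) t : elt_poly d t -> elt_poly d (fun A s => c *: t A s).
Proof. by move=> [P hP]; exists (PScale c P) => A s /=; rewrite hP. Qed.

Lemma elt_poly_ext d t u : elt_poly d t -> (forall A s, t A s = u A s) -> elt_poly d u.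
Proof. by move=> [P hP] e; exists P => A s; rewrite hP. Qed.

Lemma elt_poly1 d : elt_poly d (fun _ _ => 1).
Proof. by exists (POne _ _). Qed.

Lemma elt_poly_sum d (I : Type) (r : seq I) t : (forall i : I, elt_poly d (t i)) ->
  elt_poly d (fun A s => \sum_(i <- r) t i A s).
Proof.
move=> h; elim: r => [|i r ih].
  apply: elt_poly_ext (elt_polyZ 0 (elt_poly1 d)) _ => A s.
  by rewrite big_nil scale0r.
by apply: elt_poly_ext (elt_polyD (h i) ih) _ => A s; rewrite big_cons.
Qed.

Lemma mx_poly_var d t : (t < d)%N -> mx_poly d (fun A s => nth 0 s t).
Proof.
move=> td i j.
have [l hl] : exists l : 'I_(ctx d), forall A s, @ctx_val A d s l = nth 0 s t i j.
  elim: d t td => // d ih [|t] /=.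
    by move=> _; exists (lshift _ (mxvec_index i j)) => A [|X s]; rewrite cat_val_lshift mxvecE.
  rewrite ltnS => /ih[l hl]; exists (rshift _ l) => A s; rewrite cat_val_rshift hl.
  by case: s => //=; rewrite nth_nil.
by exists (PVar _ l).
Qed.

Lemma mx_polyD d M N : mx_poly d M -> mx_poly d N ->
  mx_poly d (fun A s => M A s + N A s).
Proof.
move=> h1 h2 i j; apply: elt_poly_ext (elt_polyD (h1 i j) (h2 i j)) _ => A s.
by rewrite mxE.
Qed.

Lemma mx_polyZ d c M : mx_poly d M -> mx_poly d (fun A s => mscale c (M A s)).
Proof.
move=> h i j; apply: elt_poly_ext (elt_polyZ c (h i j)) _ => A s; by rewrite mxE.
Qed.

Lemma mx_polyB d M N : mx_poly d M -> mx_poly d N ->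
  mx_poly d (fun A s => M A s - N A s).
Proof.
move=> h1 h2 i j; apply: elt_poly_ext (elt_polyD (h1 i j) (elt_polyZ (-1) (h2 i j))) _ => A s.
by rewrite !mxE scaleN1r.
Qed.

Lemma mx_polyM d M N : mx_poly d M -> mx_poly d N ->
  mx_poly d (fun A s => M A s *m N A s).
Proof.
move=> h1 h2 i j.
have h : elt_poly d (fun A s => \sum_l M A s i l * N A s l j).
  by apply: elt_poly_sum => l; exact: elt_polyM.
by apply: elt_poly_ext h _ => A s; rewrite mxE.
Qed.

Lemma mx_poly_adj d M : mx_poly d M -> mx_poly d (fun A s => adjmx (M A s)).
Proof.
by move=> h i j; have [P hP] := h j i; exists (PStar P) => A s /=; rewrite hP !mxE.
Qed.

Lemma mx_poly1 d : mx_poly d (fun A s => 1%:M).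
Proof.
move=> i j; apply: elt_poly_ext (elt_polyZ (i == j)%:R (elt_poly1 d)) _ => A s.
by rewrite mxE; case: eqP; rewrite ?scale1r ?scale0r.
Qed.

(** A closed definable bound valid in every M_n passes to ultraproducts of
    matrix algebras, and then to algebras elementarily equivalent to them. *)
Lemma definable_transfer Phi (c : R) (A : cstarAlgType R) : definable 0 Phi ->
  pseudomatricial A -> (forall n, Phi ('M[R[i]]_n.+1 : cstarAlgType R) [::] <= c) ->
  Phi A [::] <= c.
Proof.
move=> [phi hphi] [J [U [hU [n hA]]]] h.
rewrite -hphi -[formula_eval _ _]/(sentence_eval A phi) hA.
pose a : 'I_0 -> bounded_family (fun j => 'M[R[i]]_((n j).+1) : cstarAlgType R) := fun=> fone _.
have -> : sentence_eval (ultraproduct hU (fun j => 'M[R[i]]_((n j).+1) : cstarAlgType R)) phi =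
    formula_eval phi (fun i => ucls hU (a i)).
  by congr formula_eval; apply/funext; case.
rewrite ultraproduct_los.
have [B hB] := formula_bound phi 0.
apply: (ulim_le hU (ulimP hU (M := B) _) (cvg_cst c)).
  by move=> j; apply: hB; case.
move=> j; apply: le_trans (h (n j)); rewrite -hphi le_eqVlt; apply/orP; left; apply/eqP.
by congr formula_eval; apply/funext; case.
Qed.

End Definability.

(** * Properties inherited from matrix algebras *)

Section Transfer.
Variables (R : realType) (k : nat).
Local Notation Mat n := ('M[R[i]]_n.+1 : cstarAlgType R).

(** The premise is slackened (from <= 0 to < d) and the conclusion weakened
    (from < 2e to <= e) because the formal language only has continuous
    connectives: the implication becomes the bound
    min (2e/d (d - Phi), inf_V Psi) <= e. *)
Lemma forall_exists_transfer
    (Phi Psi : forall A : cstarAlgType R, seq 'M[A]_k -> R) (d e : R) :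
  0 < d -> 0 < e -> definable 2 Phi -> definable 3 Psi ->
  (forall n (X Y : 'M[Mat n]_k), mxball X -> mxball Y -> Phi _ [:: Y; X] < d ->
    exists2 V : 'M[Mat n]_k, mxball V & Psi _ [:: V; Y; X] <= e) ->
  forall A : cstarAlgType R, pseudomatricial A ->
  forall X Y : 'M[A]_k, mxball X -> mxball Y -> Phi A [:: Y; X] <= 0 ->
    exists2 V : 'M[A]_k, mxball V & Psi A [:: V; Y; X] < 2 * e.
Proof.
move=> d0 e0 dPhi dPsi hM A hA X Y X1 Y1 PhiXY.
have cpos : 0 < 2 * e / d by rewrite divr_gt0 // mulr_gt0.
pose Th := fun (A : cstarAlgType R) s => Num.min (2 * e / d * (d - Phi A s))
  (inf [set Psi A (V :: s) | V in @mxball R k A]).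
have dTh : definable 2 Th.
  apply: definable_min; last exact: definable_inf.
  by apply/definableZ/definableB => //; exact: definable_cst.
have dS := definable_sup (definable_sup dTh).
have infPsi (A' : cstarAlgType R) s :
    has_inf [set Psi A' (V :: s) | V in @mxball R k A'].
  have [B hB] := definable_bound dPsi s.
  split; first by exists (Psi A' (0 :: s)); exists 0 => //; exact: mxball0.
  by exists (- B) => _ [V V1 <-]; have := hB V V1; rewrite ler_norml => /andP[].
have nonempty (A' : cstarAlgType R) (F : 'M[A']_k -> R) : [set F Z | Z in @mxball R k A'] !=set0.
  by exists (F 0); exists 0 => //; exact: mxball0.
have := definable_transfer (c := e) dS hA; set S := sup _ => hS.
have {hS} Se : S <= e.
  apply: hS => n; apply: sup_le_ub => // _ [X' X'1 <-].
  apply: sup_le_ub => // _ [Y' Y'1 <-]; rewrite /Th ge_min.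
  have [ge|lt] := leP d (Phi _ [:: Y'; X']).
    by apply/orP; left; apply: (@le_trans _ _ 0); [rewrite pmulr_rle0 ?subr_le0|exact: ltW].
  apply/orP; right; have [V V1 PsiV] := hM n X' Y' X'1 Y'1 lt.
  apply: le_trans PsiV; apply: inf_lbound; last by exists V.
  by case: (infPsi (Mat n) [:: Y'; X']).
have ThXY : Th A [:: Y; X] <= e.
  have h1 : Th A [:: Y; X] <= sup [set Th A [:: Z; X] | Z in @mxball R k A].
    apply: sup_upper_bound; last by exists Y.
    exact: (definable_has_sup [:: X] dTh).
  apply: (le_trans h1); apply: le_trans Se; apply: sup_upper_bound; last by exists X.
  exact: (definable_has_sup [::] (definable_sup dTh)).
have {ThXY} inf2e : inf [set Psi A (V :: [:: Y; X]) | V in @mxball R k A] <= e.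
  move: ThXY; rewrite /Th ge_min => /orP[|//].
  have : 2 * e / d * d <= 2 * e / d * (d - Phi A [:: Y; X]).
    by rewrite ler_pM2l // lerBrDr -lerBrDl subrr.
  rewrite divfK ?gt_eqF // => h1 h2; have := le_trans h1 h2; lra.
have [_ [V V1 <-] Ve] := inf_adherent e0 (infPsi A [:: Y; X]).
by exists V => //; apply: lt_le_trans Ve _; lra.
Qed.

Lemma mnorm_ball (A : cstarAlgType R) (X : 'M[A]_k) (c : R) :
  (forall i j, cnorm (X i j) <= c) -> mnorm X <= (k * k)%:R * c.
Proof.
move=> Xc; apply: (@le_trans _ _ (\sum_(i < k) \sum_(j < k) c)).
  by do 2![apply: ler_sum => ? _].
by rewrite !sumr_const !card_ord -mulrnA mulr_natl.
Qed.

Lemma mxball_scale (A : cstarAlgType R) (X : 'M[A]_k) (c : R) : 0 < c ->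
  (forall i j, cnorm (X i j) <= c) -> mxball (mscale (c^-1)%:C X).
Proof.
move=> c0 Xc i j; rewrite mxE cnormZ normc_realc ger0_norm ?invr_ge0 ?(ltW c0) //.
by rewrite ler_pdivrMl // mulr1.
Qed.

Lemma mscaleVK (A : cstarAlgType R) (X : 'M[A]_k) (c : R) : 0 < c ->
  mscale c%:C (mscale (c^-1)%:C X) = X.
Proof.
by move=> c0; rewrite mscaleA -rmorphM /= divff ?gt_eqF // rmorph1 mscale1.
Qed.

Lemma mnorm_mscale_ball (A : cstarAlgType R) (X : 'M[A]_k) (c : R) : 0 < c ->
  mxball X -> mnorm (mscale c%:C X) <= (k * k)%:R * c.
Proof.
move=> c0 X1; apply: mnorm_ball => i j; rewrite mxE cnormZ normc_realc gtr0_norm //.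
by rewrite ler_piMr ?X1 // ltW.
Qed.

Lemma finiteness_arith (L d e a b c : R) : 1 <= L -> 0 <= d -> d <= 2^-1 ->
  d <= e / (12 * L * L) -> 0 <= a -> a <= L -> 0 <= b -> b <= 2 * L * d ->
  c <= b + a -> b * c + a * b <= e / 2.
Proof.
move=> L1 d0 d2; have L0 : 0 < L by apply: lt_le_trans L1.
rewrite ler_pdivlMr ?mulr_gt0 // => de a0 aL b0 bL cab.
have Ld : L * d <= L * 2^-1 by rewrite ler_wpM2l // ltW.
have h1 : b * c <= b * (2 * L) by rewrite ler_wpM2l //; lra.
have h2 : a * b <= L * b by rewrite ler_wpM2r.
have h3 : b * L <= 2 * L * d * L by rewrite ler_wpM2r // ltW.
lra.
Qed.

(** In M_k(M_n) a near isometry is close to an isometry, hence to a unitary, so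
    that it is nearly coisometric with a bound that does not depend on n. *)
Lemma pseudomatricial_finite (A : cstarAlgType R) (v : 'M[A]_k) :
  pseudomatricial A -> adjmx v *m v = 1%:M -> v *m adjmx v = 1%:M.
Proof.
move=> hA vv.
have [M hM] : exists2 M : R, 0 < M & forall i j, cnorm (v i j) <= M.
  exists (1 + mnorm v) => [|i j]; first by rewrite ltr_pwDl ?mnorm_ge0.
  by apply: (le_trans (mnorm_entry _ _ _)); rewrite lerDr.
move=> vM.
pose V (B : cstarAlgType R) (s : seq 'M[B]_k) := mscale M%:C (nth 0 s 0).
pose W (B : cstarAlgType R) (s : seq 'M[B]_k) := mscale M%:C (nth 0 s 1).
pose Phi (B : cstarAlgType R) (s : seq 'M[B]_k) := mnorm (1%:M - adjmx (V B s) *m V B s).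
pose Psi (B : cstarAlgType R) (s : seq 'M[B]_k) := mnorm (1%:M - W B s *m adjmx (W B s)).
have dPhi : definable 2 Phi.
  apply/definable_mnorm/mx_polyB; first exact: mx_poly1.
  by apply: mx_polyM; first apply: mx_poly_adj; apply/mx_polyZ/mx_poly_var.
have dPsi : definable 3 Psi.
  apply/definable_mnorm/mx_polyB; first exact: mx_poly1.
  by apply: mx_polyM; last apply: mx_poly_adj; apply/mx_polyZ/mx_poly_var.
apply/eqP; rewrite -subr_eq0 -oppr_eq0 opprB; apply/eqP/mnorm_le0.
apply/ler_addgt0Pr => e e0; rewrite add0r.
pose L : R := 1 + (k * k)%:R * M.
have L1 : 1 <= L by rewrite lerDl mulr_ge0 // ltW.
have L0 : 0 < L by apply: lt_le_trans L1.
pose d := Num.min 2^-1 (e / (12 * L * L)).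
have d0 : 0 < d by rewrite lt_min invr_gt0 ltr0n /= divr_gt0 // !mulr_gt0.
have v1 := mxball_scale hM vM.
have [|||U _ hU] := @forall_exists_transfer Phi Psi d (e / 2) d0 _ dPhi dPsi _ A hA
    (mscale (M^-1)%:C v) (mscale (M^-1)%:C v) v1 v1.
- by rewrite divr_gt0.
- move=> n X Y X1 Y1; rewrite /Phi /V /= => Yd; exists 0; first exact: mxball0.
  rewrite /Psi /W /=; set y := mscale _ Y in Yd *.
  have yL : mnorm y <= L.
    by apply: (le_trans (mnorm_mscale_ball hM Y1)); rewrite lerDr.
  have [|||w [w1 _ _ _ wy]] := @polar_iteration R (Mat n) k 1%:M 1%:M y (is_projection1 _ _).
  - by rewrite mulmx1.
  - by rewrite mul1mx.
  - by apply: (le_trans (ltW Yd)); rewrite ge_min lexx.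
  rewrite -(complex_finite w1).
  have -> : w *m adjmx w - y *m adjmx y = (w - y) *m adjmx w + y *m adjmx (w - y).
    by rewrite adjmxB mulmxBr mulmxBl addrA subrK.
  have {}wy : mnorm (w - y) <= 2 * L * d.
    apply: (le_trans wy); apply: ler_pM; rewrite ?mnorm_ge0 ?mulr_ge0 ?mnorm_ge0 //.
      by rewrite ler_pM2l.
    exact: ltW.
  apply: (le_trans (mnormD _ _)); apply: (le_trans (lerD (mnormM _ _) (mnormM _ _))).
  rewrite !mnorm_adj; apply: (finiteness_arith L1 (ltW d0)) => //.
  - by rewrite ge_min lexx.
  - by rewrite ge_min lexx orbT.
  - exact: mnorm_ge0.
  - exact: mnorm_ge0.
  - exact: mnorm_shift.
- by rewrite /Phi /V /= mscaleVK // vv subrr mnorm0.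
- move: hU; rewrite /Psi /W /= mscaleVK // => /ltW/le_trans; apply.
  by rewrite mulrCA divff ?mulr1 // pnatr_eq0.
Qed.

Lemma near_comparable_arith (eta K a b c N : R) :
  0 <= N -> N <= K -> 0 <= a -> a <= eta -> 0 <= b -> b <= eta ->
  c <= eta -> c + b * N + N * a <= eta * (1 + 2 * K).
Proof.
move=> N0 NK a0 ae b0 be ce.
have h1 : b * N <= eta * K by apply: ler_pM.
have h2 : N * a <= K * eta by apply: ler_pM.
lra.
Qed.

Definition subequiv_defect (A : cstarAlgType R) (p q v : 'M[A]_k) : R :=
  mnorm (adjmx v *m v - p) + mnorm (q *m v - v) + mnorm (v *m p - v).

(** Nearby exact projections are compared by the rank; neither the size of the
    comparing partial isometry nor its accuracy depends on n. *)
Lemma complex_near_comparable n (p q : 'M[Mat n]_k) (K d eta : R) :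
  adjmx p = p -> adjmx q = q -> mnorm p <= K -> mnorm q <= K ->
  d <= 8^-1 -> 4 * (2 * K + k%:R) * d <= eta -> eta <= 1 ->
  mnorm (p *m p - p) <= d -> mnorm (q *m q - q) <= d ->
  exists2 v : 'M[Mat n]_k, (forall i j, cnorm (v i j) <= K + 1) &
    Num.min (subequiv_defect p q v) (subequiv_defect q p v) <=
    eta * (1 + 2 * ((k * k)%:R * (K + 1))).
Proof.
move=> pa qa pK qK d8 deta eta1 pd qd.
have K0 : 0 <= K by apply: le_trans pK; exact: mnorm_ge0.
have correct (x : 'M[Mat n]_k) : adjmx x = x -> mnorm x <= K ->
    mnorm (x *m x - x) <= d -> exists2 x', is_projection x' & mnorm (x' - x) <= eta.
  move=> xa xK xd; have [|x' x'P h] := near_projection xa; first exact: le_trans d8.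
  exists x' => //; apply: (le_trans h); apply: le_trans deta.
  have k0 : 0 <= k%:R :> R by exact: ler0n.
  have x0 := mnorm_ge0 x.
  apply: ler_pM; rewrite ?mnorm_ge0 // ?mulr_ge0 ?addr_ge0 ?mulr_ge0 //.
  by rewrite ler_pM2l // lerD2r ler_pM2l.
have [p' p'P pp'] := correct p pa pK pd.
have [q' q'P qq'] := correct q qa qK qd.
have bound (x x' y y' v : 'M[Mat n]_k) : mnorm x <= K ->
    mnorm (x' - x) <= eta -> mnorm (y' - y) <= eta ->
    adjmx v *m v = x' -> y' *m v = v -> v *m x' = v ->
    (forall i j, cnorm (v i j) <= K + 1) /\
    subequiv_defect x y v <= eta * (1 + 2 * ((k * k)%:R * (K + 1))).
  move=> xK xx' yy' vv yv vx.
  have vK i j : cnorm (v i j) <= K + 1.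
    have h : cnorm (v i j) ^+ 2 <= (K + 1) ^+ 2.
      apply: (le_trans (complex_block_norm v i j)); rewrite vv.
      apply: (le_trans (mnorm_entry _ _ _)); apply: (le_trans (mnorm_shift _ x)).
      apply: (@le_trans _ _ (K + 1)); first by rewrite addrC lerD // (le_trans xx').
      by rewrite expr2 ler_peMr ?addr_ge0 // lerDr.
    by rewrite -(ler_pXn2r (ltn0Sn 1)) ?nnegrE ?cnorm_ge0 ?addr_ge0.
  split=> //; rewrite /subequiv_defect vv.
  have -> : y *m v - v = (y - y') *m v by rewrite mulmxBl yv.
  have -> : v *m x - v = v *m (x - x') by rewrite mulmxBr vx.
  apply: (@le_trans _ _ (mnorm (x' - x) + mnorm (y' - y) * mnorm v + mnorm v * mnorm (x' - x))).
    rewrite (mnormBC x') (mnormBC y').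
    by rewrite !lerD ?mnormM // mnormBC.
  by apply: near_comparable_arith; rewrite ?mnorm_ge0 ?mnorm_ball.
have [[v [v1 v2 v3]]|[v [v1 v2 v3]]] := complex_comparable p'P q'P.
  have [h1 h2] := bound p p' q q' v pK pp' qq' v1 v2 v3.
  by exists v; [exact: h1|rewrite ge_min; apply/orP; left; exact: h2].
have [h1 h2] := bound q q' p p' v qK qq' pp' v1 v2 v3.
by exists v; [exact: h1|rewrite ge_min; apply/orP; right; exact: h2].
Qed.

(** Over M_n the ranks of projections compare them; nearly comparing partial
    isometries over [A] are then corrected to exact ones. *)
Lemma pseudomatricial_comparable (A : cstarAlgType R) (p q : 'M[A]_k) :
  pseudomatricial A -> is_projection p -> is_projection q ->
  (exists w : 'M[A]_k, adjmx w *m w = p /\ q *m w = w) \/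
  (exists w : 'M[A]_k, adjmx w *m w = q /\ p *m w = w).
Proof.
move=> hA pP qP.
pose M : R := 1 + mnorm p + mnorm q.
have M0 : 0 < M by rewrite /M -addrA ltr_pwDl // addr_ge0 ?mnorm_ge0.
have pM i j : cnorm (p i j) <= M.
  by apply: (le_trans (mnorm_entry _ _ _)); rewrite /M addrAC lerDr addr_ge0 ?mnorm_ge0.
have qM i j : cnorm (q i j) <= M.
  by apply: (le_trans (mnorm_entry _ _ _)); rewrite /M lerDr addr_ge0 ?mnorm_ge0.
pose N : R := (k * k)%:R; have N0 : 0 <= N by exact: ler0n.
pose K0 := N * M; have K00 : 0 <= K0 by rewrite mulr_ge0 // ltW.
pose L := K0 + 1; have L0 : 0 < L by rewrite ltr_wpDl.
pose K := 1 + K0 + N * L.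
have NL0 : 0 <= N * L by rewrite mulr_ge0 // ltW.
have K1 : 1 <= K by rewrite /K -addrA lerDl addr_ge0.
have K4 : 0 < 20 * K ^+ 4 by rewrite mulr_gt0 // exprn_gt0 // (lt_le_trans _ K1).
pose e := (20 * K ^+ 4)^-1; have e0 : 0 < e by rewrite invr_gt0.
have NL1 : 0 < 1 + 2 * (N * L) by rewrite ltr_pwDl // mulr_ge0.
pose eta := Num.min 1 (e / (1 + 2 * (N * L))).
have eta0 : 0 < eta by rewrite lt_min ltr01 divr_gt0.
have C0 : 0 < 1 + 4 * (2 * K0 + k%:R).
  by rewrite ltr_pwDl // mulr_ge0 // addr_ge0 // mulr_ge0.
pose d := Num.min 8^-1 (eta / (1 + 4 * (2 * K0 + k%:R))).
have d0 : 0 < d by rewrite lt_min invr_gt0 ltr0n divr_gt0.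
have dC : 4 * (2 * K0 + k%:R) * d <= eta.
  have : d <= eta / (1 + 4 * (2 * K0 + k%:R)) by rewrite ge_min lexx orbT.
  rewrite ler_pdivlMr // mulrC mulrDl mul1r; apply: le_trans.
  by rewrite lerDr ltW.
(* Symmetrized variables: only idempotency has to be approximated. *)
pose P (B : cstarAlgType R) (X : 'M[B]_k) := mscale (M / 2)%:C (X + adjmx X).
have Pa (B : cstarAlgType R) (X : 'M[B]_k) : adjmx (P B X) = P B X.
  by rewrite adjmx_scale adjmxD adjmxK addrC.
have PK (B : cstarAlgType R) (X : 'M[B]_k) : mxball X -> mnorm (P B X) <= K0.
  move=> X1; have M2 : 0 < M / 2 by rewrite divr_gt0.
  rewrite mnormZr ?(ltW M2) //; apply: (@le_trans _ _ (M / 2 * (N + N))).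
    rewrite ler_pM2l //; apply: (le_trans (mnormD _ _)); rewrite mnorm_adj.
    by rewrite lerD // -[leRHS]mulr1 mnorm_ball.
  by rewrite -mulr2n -[N *+ 2]mulr_natl mulrA divfK ?pnatr_eq0 // /K0 mulrC.
have PE (x : 'M[A]_k) : is_projection x -> P A (mscale (M^-1)%:C x) = x.
  move=> [xa _]; rewrite /P adjmx_scale xa -mscaleDr mscaleA -rmorphM /=.
  by rewrite mulrAC divff ?gt_eqF // mul1r mscaleDr mscale_half2.
pose Phi (B : cstarAlgType R) (s : seq 'M[B]_k) :=
  mnorm (P B (nth 0 s 1) *m P B (nth 0 s 1) - P B (nth 0 s 1)) +
  mnorm (P B (nth 0 s 0) *m P B (nth 0 s 0) - P B (nth 0 s 0)).
pose Psi (B : cstarAlgType R) (s : seq 'M[B]_k) := Num.min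
  (subequiv_defect (P B (nth 0 s 2)) (P B (nth 0 s 1)) (mscale L%:C (nth 0 s 0)))
  (subequiv_defect (P B (nth 0 s 1)) (P B (nth 0 s 2)) (mscale L%:C (nth 0 s 0))).
have dP j t : (t < j)%N -> mx_poly j (fun B (s : seq 'M[B]_k) => P B (nth 0 s t)).
  move=> tj; apply/mx_polyZ/mx_polyD; first exact: mx_poly_var.
  by apply/mx_poly_adj/mx_poly_var.
have dPhi : definable 2 Phi.
  by apply: definableD; apply/definable_mnorm/mx_polyB; try apply: mx_polyM; apply: dP.
have dV : mx_poly 3 (fun B (s : seq 'M[B]_k) => mscale L%:C (nth 0 s 0)).
  exact/mx_polyZ/mx_poly_var.
have dPsi : definable 3 Psi.
  have dsub t u : (t < 3)%N -> (u < 3)%N -> definable 3 (fun B (s : seq 'M[B]_k) =>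
      subequiv_defect (P B (nth 0 s t)) (P B (nth 0 s u)) (mscale L%:C (nth 0 s 0))).
    move=> /dP dt /dP du.
    apply: definableD; first apply: definableD; apply/definable_mnorm/mx_polyB => //;
      apply: mx_polyM => //; exact: mx_poly_adj.
  by apply: definable_min; exact: dsub.
have [||||V V1 hV] := @forall_exists_transfer Phi Psi d e d0 e0 dPhi dPsi _ A hA
    (mscale (M^-1)%:C p) (mscale (M^-1)%:C q).
- move=> n X Y X1 Y1; rewrite /Phi /= => XYd.
  have [|||||||||v vL hv] := @complex_near_comparable n (P _ X) (P _ Y) K0 d eta.
  - exact: Pa.
  - exact: Pa.
  - exact: (PK _ _ X1).
  - exact: (PK _ _ Y1).
  - by rewrite ge_min lexx.
  - exact: dC.
  - by rewrite ge_min lexx.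
  - by apply: le_trans (ltW XYd); rewrite lerDl mnorm_ge0.
  - by apply: le_trans (ltW XYd); rewrite lerDr mnorm_ge0.
  exists (mscale (L^-1)%:C v); first exact: mxball_scale.
  rewrite /Psi /= mscaleVK //; apply: (le_trans hv).
  by rewrite -ler_pdivlMr // ge_min lexx orbT.
- exact: mxball_scale.
- exact: mxball_scale.
- rewrite /Phi /= !PE //; case: pP => _ ->; case: qP => _ ->.
  by rewrite !subrr mnorm0 addr0.
move: hV; rewrite /Psi /= !PE //; set v := mscale _ V => hV.
have xK (x : 'M[A]_k) : is_projection x -> (forall i j, cnorm (x i j) <= M) -> mnorm x <= K.
  move=> _ xM; apply: (le_trans (mnorm_ball xM)); rewrite -/N -/K0 /K addrAC.
  by rewrite lerDr addr_ge0.
have vK : mnorm v <= K.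
  by apply: (le_trans (mnorm_mscale_ball L0 V1)); rewrite -/N /K lerDr addr_ge0.
have Ke : 10 * K ^+ 4 * (2 * e) <= 1.
  rewrite mulrCA mulrA (_ : 2 * (10 * K ^+ 4) = 20 * K ^+ 4); last by ring.
  by rewrite mulfV // gt_eqF.
have correct (x y : 'M[A]_k) : is_projection x -> is_projection y ->
    mnorm x <= K -> mnorm y <= K -> subequiv_defect x y v < 2 * e ->
    exists w : 'M[A]_k, adjmx w *m w = x /\ y *m w = w.
  move=> xP yP xK' yK' h.
  have := mnorm_ge0 (adjmx v *m v - x); have := mnorm_ge0 (y *m v - v).
  have := mnorm_ge0 (v *m x - v) => h1 h2 h3.
  apply: (@near_subprojection R A k x y v K (2 * e)) => //; apply: le_trans (ltW h).
  - by rewrite /subequiv_defect -addrA lerDl addr_ge0.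
  - by rewrite /subequiv_defect addrAC lerDr addr_ge0.
  - by rewrite /subequiv_defect lerDr addr_ge0.
move: hV; rewrite gt_min => /orP[h|h]; [left|right]; apply: correct => //; exact: xK.
Qed.

End Transfer.

Section MinimalProjection.
Variable R : realType.
Local Notation Mat n := ('M[R[i]]_n.+1 : cstarAlgType R).

Section OneByOne.
Variable A : cstarAlgType R.

Lemma mnorm1x1 (x : 'M[A]_1) : mnorm x = cnorm (x 0 0).
Proof. by rewrite /mnorm !big_ord1. Qed.

Lemma projection_norm (x : 'M[A]_1) : is_projection x -> x = 0 \/ mnorm x = 1.
Proof.
move=> [xa xx]; have h : mnorm x = mnorm x * mnorm x.
  have sa : star (x 0 0) = x 0 0 by rewrite -[in RHS]xa !mxE.
  have mm : x 0 0 * x 0 0 = x 0 0 by rewrite -[in RHS]xx mxE big_ord1.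
  by rewrite mnorm1x1 -expr2 -cstar_identity sa mm.
have [/eqP x0|n0] := boolP (mnorm x == 0); first by left; apply: mnorm_le0; rewrite x0.
by right; apply: (mulfI n0); rewrite -h mulr1.
Qed.

Lemma projection_norm_le1 (x : 'M[A]_1) : is_projection x -> mnorm x <= 1.
Proof. by case/projection_norm => ->; rewrite ?mnorm0. Qed.

Lemma projection_norm_lt1 (x : 'M[A]_1) : is_projection x -> mnorm x < 1 -> x = 0.
Proof. by case/projection_norm => // ->; rewrite ltxx. Qed.

End OneByOne.

Lemma is_projectionB (A : cstarAlgType R) k (p q : 'M[A]_k) :
  is_projection p -> is_projection q -> p *m q = q -> is_projection (p - q).
Proof.
move=> [pa pp] [qa qq] pq; split; first by rewrite adjmxB pa qa.
have qp : q *m p = q by have := congr1 (@adjmx _ _ _ _) pq; rewrite adjmxM pa qa.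
by rewrite mulmxBl !mulmxBr pp pq qp qq subrr subr0.
Qed.

(** One of [l] and [l1] is at least 1/2, so the other is at most
    2 (z + 6 eta); adding 2 eta gives the constant 14. *)
Lemma corner_dichotomy_arith (l l1 x y z eta E : R) :
  0 <= l -> 0 <= l1 -> 1 <= l + l1 -> 0 <= eta -> 0 <= z ->
  E <= z + 6 * eta -> l * l1 <= E -> x <= l + 2 * eta -> y <= l1 + 2 * eta ->
  Num.min x y - 14 * (z + eta) <= 0.
Proof.
move=> l0 l10 ll eta0 z0 Ez lE xl yl; rewrite lerBlDr add0r ge_min.
have [h|h] := leP (2^-1) l; apply/orP; [right|left].
  have : 2^-1 * l1 <= l * l1 by rewrite ler_wpM2r.
  lra.
have : l * 2^-1 <= l * l1 by rewrite ler_wpM2l //; lra.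
lra.
Qed.

(** The compression of [q] by [E] is within twice the norm of [E *m q - q] of
    the nearly idempotent [q]; thus l (1 - l) is small. *)
Lemma scalar_corner_dichotomy (A : cstarAlgType R) (E q : 'M[A]_1) (l : R[i]) :
  is_projection E -> mnorm E = 1 -> E *m q *m E = mscale l E ->
  adjmx q = q -> mnorm q <= 1 ->
  Num.min (mnorm q) (mnorm (E - q)) -
    14 * (mnorm (q *m q - q) + mnorm (E *m q - q)) <= 0.
Proof.
move=> EP E1; pose q' := E *m q *m E; rewrite -/q' => q'E qa q1.
pose eta := mnorm (E *m q - q); pose z := mnorm (q *m q - q).
have eta0 : 0 <= eta by exact: mnorm_ge0.
have z0 : 0 <= z by exact: mnorm_ge0.
have qE : mnorm (q *m E - q) = eta.
  by rewrite -mnorm_adj adjmxB adjmxM qa (proj1 EP).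
have q'q : mnorm (q' - q) <= 2 * eta.
  apply: (le_trans (mnorm_trans (E *m q) _ _)).
  have -> : q' - E *m q = E *m (q *m E - q) by rewrite mulmxBr mulmxA.
  have := mnormM E (q *m E - q); rewrite E1 qE mul1r => h.
  by rewrite [2 * eta]mulr_natl mulr2n; apply: lerD h _.
have q'1 : mnorm q' <= 1.
  apply: (le_trans (mnormM _ _)); rewrite E1 mulr1; apply: (le_trans (mnormM _ _)).
  by rewrite E1 mul1r.
have sq : mnorm (q' *m q' - q') <= z + 6 * eta.
  apply: (le_trans (mnorm_trans (q *m q) _ _)).
  have h1 : mnorm (q' *m q' - q *m q) <= 2 * eta + 2 * eta.
    have -> : q' *m q' - q *m q = (q' - q) *m q' + q *m (q' - q).
      by rewrite mulmxBl mulmxBr addrA subrK.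
    apply: (le_trans (mnormD _ _)); apply: lerD; apply: (le_trans (mnormM _ _)).
      by rewrite -[leRHS]mulr1; apply: ler_pM; rewrite ?mnorm_ge0.
    by rewrite -[leRHS]mul1r; apply: ler_pM; rewrite ?mnorm_ge0.
  have h2 : mnorm (q *m q - q') <= z + 2 * eta.
    by apply: (le_trans (mnorm_trans q _ _)); rewrite lerD // mnormBC.
  apply: (le_trans (lerD h1 h2)); lra.
apply: (@corner_dichotomy_arith (normc l) (normc (1 - l)) _ _ z eta _ _ _ _ eta0 z0 sq).
- exact: normc_ge0.
- exact: normc_ge0.
- by have := le_normcD l (1 - l); rewrite addrCA subrr addr0 normc1.
- rewrite q'E mscale_mull mscale_mulr (proj2 EP) mscaleA -mscaleNl -mscaleDl.
  have -> : l * l - l = -1 * (l * (1 - l)) by ring.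
  by rewrite mnormZ E1 mulr1 !normcM normcN1 mul1r.
- apply: (le_trans (mnorm_shift _ q')); rewrite addrC; apply: lerD.
    by rewrite q'E mnormZ E1 mulr1.
  by rewrite mnormBC.
- apply: (le_trans (mnorm_trans q' _ _)); apply: lerD => //.
  have -> : E - q' = mscale (1 - l) E.
    by rewrite q'E mscaleDl mscale1 mscaleNl.
  by rewrite mnormZ E1 mulr1.
Qed.

Lemma rank_one_corner n :
  let E : 'M[Mat n]_1 := (delta_mx 0 0)%:M in
  [/\ is_projection E, mnorm E = 1 &
    forall q : 'M[Mat n]_1, exists l : R[i], E *m q *m E = mscale l E].
Proof.
move=> E.
have dd : (delta_mx 0 0 : Mat n) * delta_mx 0 0 = delta_mx 0 0.
  exact: mul_delta_mx.
have sd : star (delta_mx 0 0 : Mat n) = delta_mx 0 0.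
  apply/matrixP => a b; rewrite -[star _]/(ctrmx (delta_mx 0 0)) !mxE andbC.
  by case: (_ && _); rewrite ?conjc1 ?conjc0.
have EP : is_projection E.
  split; last by rewrite -scalar_mxM dd.
  by apply/matrixP => i j; rewrite !mxE !ord1 eqxx mulr1n sd.
have E1 : mnorm E = 1.
  case: (projection_norm EP) => // /matrixP/(_ 0 0); rewrite !mxE eqxx mulr1n.
  move=> /matrixP/(_ 0 0); rewrite !mxE /= => /eqP; rewrite oner_eq0 //.
split=> // q.
pose l : R[i] := (q 0 0 : 'M[R[i]]_n.+1) 0 0.
exists l.
apply/matrixP => i j; rewrite !mxE !ord1 big_ord1 !mxE big_ord1 !mxE eqxx !mulr1n.
apply/matrixP => a b.
rewrite -[LHS]/((delta_mx 0 0 *m (q 0 0 : 'M[R[i]]_n.+1) *m delta_mx 0 0) a b).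
rewrite [LHS]mxE (bigD1 0) //= big1 => [|c c0].
  rewrite mxE (bigD1 0) //= big1 => [|c c0].
    rewrite !mxE eqxx !addr0 /l; move: (q 0 0 0 0) => c.
    by case: (a == 0); case: (b == 0); rewrite /= ?(mulr0, mul0r, mulr1, mul1r).
  by rewrite !mxE (negbTE c0) andbF mul0r.
by rewrite [X in _ * X]mxE (negbTE c0) mulr0.
Qed.

(** Minimality survives only up to a fixed small error, but a projection of
    norm less than 1 is zero. *)
Lemma pseudomatricial_minimal_projection (A : cstarAlgType R) : pseudomatricial A ->
  exists e : 'M[A]_1, [/\ is_projection e, e <> 0 &
    forall q : 'M[A]_1, is_projection q -> e *m q = q -> q = 0 \/ q = e].
Proof.
move=> hA.
pose P (B : cstarAlgType R) (X : 'M[B]_1) := mscale (2^-1)%:C (X + adjmx X).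
have Pa (B : cstarAlgType R) (X : 'M[B]_1) : adjmx (P B X) = P B X.
  by rewrite adjmx_scale adjmxD adjmxK addrC.
have P1 (B : cstarAlgType R) (X : 'M[B]_1) : mxball X -> mnorm (P B X) <= 1.
  move=> X1; have Xn : mnorm X <= 1 by rewrite mnorm1x1.
  rewrite mnormZr ?invr_ge0 // ler_pdivrMl // mulr1.
  by apply: (le_trans (mnormD _ _)); rewrite mnorm_adj lerD.
have PE (B : cstarAlgType R) (x : 'M[B]_1) : adjmx x = x -> P B x = x.
  by move=> xa; rewrite /P xa mscaleDr mscale_half2.
have ball (B : cstarAlgType R) (x : 'M[B]_1) : mnorm x <= 1 -> mxball x.
  by rewrite mnorm1x1 => x1 i j; rewrite !ord1.
pose Phi (B : cstarAlgType R) (s : seq 'M[B]_1) :=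
  let q := P B (nth 0 s 0) in let e := P B (nth 0 s 1) in
  Num.min (mnorm q) (mnorm (e - q)) - 14 * (mnorm (q *m q - q) + mnorm (e *m q - q)).
pose Psi (B : cstarAlgType R) (s : seq 'M[B]_1) :=
  let e := P B (nth 0 s 0) in
  Num.max (Num.max (mnorm (e *m e - e)) (1 - mnorm e))
    (sup [set Phi B (Y :: s) | Y in @mxball R 1 B]).
have dP j t : (t < j)%N -> mx_poly j (fun B (s : seq 'M[B]_1) => P B (nth 0 s t)).
  move=> tj; apply/mx_polyZ/mx_polyD; first exact: mx_poly_var.
  by apply/mx_poly_adj/mx_poly_var.
have d0 := dP 2%N 0%N isT; have d1 := dP 2%N 1%N isT; have d10 := dP 1%N 0%N isT.
have dPhi : definable 2 Phi.
  apply: definableB.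
    by apply: definable_min; apply: definable_mnorm => //; exact: mx_polyB.
  by apply/definableZ/definableD; apply/definable_mnorm/mx_polyB => //; exact: mx_polyM.
have dPsi : definable 1 Psi.
  apply: definable_max; last exact: definable_sup.
  apply: definable_max; first by apply/definable_mnorm/mx_polyB => //; exact: mx_polyM.
  by apply/definableB; [exact: definable_cst|exact: definable_mnorm].
have hi (B : cstarAlgType R) : has_inf [set Psi B [:: X] | X in @mxball R 1 B].
  split; first by exists (Psi B [:: 0]); exists 0 => //; exact: mxball0.
  exists 0 => _ [X X1 <-]; rewrite /Psi !le_max mnorm_ge0 //.
have := definable_transfer (c := 0) (definable_inf dPsi) hA.
set S := inf _ => hS.
have {hS} S0 : S <= 0.
  apply: hS => n; have [] := rank_one_corner n.
  move: (_%:M : 'M[Mat n]_1) => E EP E1 corner.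
  apply: (@le_trans _ _ (Psi (Mat n) [:: E])).
    apply: inf_lbound; first by case: (hi (Mat n)).
    by exists E => //; apply: ball; rewrite E1.
  rewrite /Psi /= PE ?(proj1 EP) // (proj2 EP) subrr mnorm0 E1 subrr !ge_max lexx /=.
  apply: sup_le_ub.
    by exists (Phi _ [:: 0; E]); exists 0 => //; exact: mxball0.
  move=> _ [Y Y1 <-]; rewrite /Phi /= (PE _ E) ?(proj1 EP) //.
  have [l lE] := corner (P _ Y).
  by apply: (scalar_corner_dichotomy EP E1 lE); [exact: Pa|exact: P1].
(* The errors below add up to at most 181 c. *)
pose c : R := 200^-1; have c0 : 0 < c by rewrite invr_gt0.
have [_ [X X1 <-]] := inf_adherent c0 (hi A).
move=> /lt_le_trans/(_ (lerD S0 (lexx c))); rewrite add0r /Psi /=.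
set x := P A X; rewrite !gt_max -andbA => /and3P[xx xn hsup].
have c8 : c <= 8^-1 by rewrite lef_pV2 ?posrE // ler_nat.
have [|e eP ex] := near_projection (Pa A X); first by apply: ltW; apply: lt_le_trans xx c8.
have {}ex : mnorm (e - x) <= 12 * c.
  apply: (le_trans ex); apply: ler_pM; rewrite ?mnorm_ge0 //.
  - by rewrite mulr_ge0 // addr_ge0 // mulr_ge0 // mnorm_ge0.
  - have h : mnorm x <= 1 by exact: P1.
    by move: (mnorm x) h; clear => a h; lra.
  - exact: ltW.
have c1 : 200 * c = 1 by rewrite mulfV // pnatr_eq0.
exists e; split=> //.
  move=> e0; move: ex; rewrite e0 sub0r mnormN.
  by move: (mnorm x) xn c1 => a; clear => h1 h2 h3; lra.
move=> q qP eq.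
have q1 := projection_norm_le1 qP.
have hq : Phi A [:: q; X] < c.
  apply: le_lt_trans hsup; apply: sup_upper_bound.
    exact: (definable_has_sup [:: X] dPhi).
  by exists q => //; exact: ball.
move: hq; rewrite /Phi /= (PE _ q) ?(proj1 qP) // (proj2 qP) subrr mnorm0 add0r -/x.
have xq : mnorm (x *m q - q) <= 12 * c.
  rewrite -[X in _ - X]eq -mulmxBl; apply: (le_trans (mnormM _ _)).
  by rewrite -[leRHS]mulr1; apply: ler_pM; rewrite ?mnorm_ge0 // mnormBC.
have eqx : mnorm (e - q) <= mnorm (e - x) + mnorm (x - q) by exact: mnorm_trans.
rewrite ltrBlDr gt_min => /orP[h|h].
  left; apply: projection_norm_lt1 => //; apply: lt_trans h _.
  by move: (mnorm _) xq c1 => a; clear -c; lra.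
right; apply/eqP; rewrite eq_sym -subr_eq0; apply/eqP.
apply: projection_norm_lt1; first exact: is_projectionB.
move: (mnorm (e - q)) (mnorm (e - x)) (mnorm (x - q)) (mnorm _) eqx ex h xq c1.
by clear -c; move=> a b d f; lra.
Qed.

End MinimalProjection.

(** * Countable totally ordered groups are dimension groups *)

Section OrderedGroup.
Variables (G : zmodType) (P : set G).
Hypothesis hP : totally_ordered_group P.

Lemma pos0 : P 0.
Proof. by have := cone_le_refl hP 0; rewrite /cone_le subrr. Qed.

Lemma posD x y : P x -> P y -> P (x + y).
Proof.
move=> Px Py; have := @cone_le_trans _ _ hP 0 x (x + y); rewrite /cone_le !subr0.
by rewrite addrAC subrr add0r; apply.
Qed.

Lemma pos_total x : P x \/ P (- x).
Proof.
by have := cone_le_total hP 0 x; rewrite /cone_le subr0 sub0r.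
Qed.

Lemma pos_anti x : P x -> P (- x) -> x = 0.
Proof.
by move=> Px Nx; apply/esym/(cone_le_anti hP); rewrite /cone_le ?subr0 ?sub0r.
Qed.

Lemma posMn x n : P x -> P (x *+ n).
Proof.
move=> Px; elim: n => [|n ih]; first by rewrite mulr0n; exact: pos0.
by rewrite mulrS; exact: posD.
Qed.

Lemma pos_sum (I : Type) (r : seq I) (F : I -> G) : (forall i, P (F i)) ->
  P (\sum_(i <- r) F i).
Proof.
move=> PF; elim: r => [|i r ih]; first by rewrite big_nil; exact: pos0.
by rewrite big_cons; exact: posD.
Qed.

Lemma pos_sum_eq0 r (F : 'I_r -> G) : (forall i, P (F i)) ->
  \sum_i F i = 0 -> forall i, F i = 0.
Proof.
move=> PF F0 i; apply: pos_anti => //; move: F0; rewrite (bigD1 i) //= addrC.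
move/eqP; rewrite addr_eq0 => /eqP <-.
by rewrite big_mkcond; apply: pos_sum => j; case: ifP => // _; exact: pos0.
Qed.

Lemma pos_Mn_eq0 x n : P x -> x *+ n.+1 = 0 -> x = 0.
Proof.
move=> Px /eqP; rewrite mulrS addr_eq0 => /eqP e; apply: pos_anti => //.
by rewrite e opprK; exact: posMn.
Qed.

Definition in_cone r (b : 'I_r -> G) (g : G) : Prop :=
  exists c : 'I_r -> nat, g = \sum_i b i *+ c i.

Lemma in_coneD r (b : 'I_r -> G) g h : in_cone b g -> in_cone b h -> in_cone b (g + h).
Proof.
move=> [c ->] [d ->]; exists (fun i => (c i + d i)%N); rewrite -big_split.
by apply: eq_bigr => i _; rewrite mulrnDr.
Qed.

Lemma in_cone0 r (b : 'I_r -> G) : in_cone b 0.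
Proof. by exists (fun=> 0%N); rewrite big1. Qed.

Lemma in_cone_gen r (b : 'I_r -> G) i : in_cone b (b i).
Proof.
exists (fun j => (j == i) : nat); rewrite (bigD1 i) //= eqxx big1 ?addr0 //.
by move=> j /negbTE ->.
Qed.

Lemma in_cone_trans r s (a : 'I_r -> G) (b : 'I_s -> G) g :
  (forall i, in_cone b (a i)) -> in_cone a g -> in_cone b g.
Proof.
move=> ab [c ->]; elim/big_ind: _ => [|x y|i _]; [exact: in_cone0|exact: in_coneD|].
by elim: (c i) => [|n ih]; [exact: in_cone0|rewrite mulrS; exact: in_coneD].
Qed.

(** The elementary substitution a_j = a_i + (a_j - a_i). *)
Definition subst_gens r (a : 'I_r -> G) (i j l : 'I_r) : G :=
  if l == j then a j - a i else a l.

Definition subst_coefs r (n : 'I_r -> int) (i j l : 'I_r) : int :=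
  if l == i then n i + n j else n l.

Lemma subst_relation r (a : 'I_r -> G) (n : 'I_r -> int) i j : i != j ->
  \sum_l a l *~ n l = 0 -> \sum_l subst_gens a i j l *~ subst_coefs n i j l = 0.
Proof.
move=> ij rel; apply: etrans rel; rewrite [LHS](bigD1 i) // [RHS](bigD1 i) //=.
rewrite [X in _ + X](bigD1 j) 1?eq_sym // [X in _ = _ + X](bigD1 j) 1?eq_sym //=.
rewrite /subst_gens /subst_coefs !eqxx (negbTE ij) [j == i]eq_sym (negbTE ij) !addrA.
congr (_ + _); last first.
  by apply: eq_bigr => l /andP[/negbTE -> /negbTE ->].
by rewrite mulrzBl mulrzDr addrACA subrr addr0.
Qed.

Lemma subst_gens_cone r s (a : 'I_r -> G) (b : 'I_s -> G) i j : i != j ->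
  (forall l, in_cone b (subst_gens a i j l)) -> forall l, in_cone b (a l).
Proof.
move=> ij h l; have := h l; rewrite /subst_gens; case: eqP => [-> hj|//].
by have := h i; rewrite /subst_gens (negbTE ij) => /(in_coneD hj); rewrite subrK.
Qed.

Lemma subst_gens_pos r (a : 'I_r -> G) i j : (forall l, P (a l)) -> P (a j - a i) ->
  forall l, P (subst_gens a i j l).
Proof. by move=> Pa h l; rewrite /subst_gens; case: eqP. Qed.

(** A relation among positive elements lets one of them be dispensed with,
    after a change of the others. The induction is on the largest absolute
    value N of a coefficient, then on the number of coefficients of absolute
    value N, then on the number of negative coefficients (one coefficient n_i
    being N): for n_j < 0, the substitution replaces n_i by n_i + n_j if
    a_i <= a_j, and n_j by n_i + n_j otherwise. Without negative coefficients
    the relation forces a_i = 0. *)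
Lemma relation_elimination r (a : 'I_r.+1 -> G) (n : 'I_r.+1 -> int) :
  (forall i, P (a i)) -> \sum_i a i *~ n i = 0 -> (exists i, n i != 0) ->
  exists2 b : 'I_r -> G, (forall i, P (b i)) & forall i, in_cone b (a i).
Proof.
pose goal (a : 'I_r.+1 -> G) :=
  exists2 b : 'I_r -> G, (forall i, P (b i)) & forall i, in_cone b (a i).
have bounded (n' : 'I_r.+1 -> int) : exists N : nat, forall i, (absz (n' i) <= N)%N.
  by exists (\max_i absz (n' i))%N => i; exact: leq_bigmax.
have [N] := bounded n; rewrite {bounded}.
elim: N a n => [|N ihN] a n nN Pa rel [i ni].
  by have := nN i; lia.
have [m] : exists m : nat, (#|[set i | absz (n i) == N.+1]%SET| <= m)%N.
  by exists #|[set i | absz (n i) == N.+1]%SET|.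
elim: m a n nN Pa rel i ni => [|m ihm] a n nN Pa rel i ni cnt.
  apply: (ihN a n) => //; last by exists i.
  move=> l; have := nN l; rewrite leq_eqVlt ltnS => /orP[nl|//].
  by move: cnt; rewrite leqn0 cards_eq0 => /eqP/finset.setP/(_ l); rewrite !inE nl.
have [none|/existsP[i0 ni0]] := boolP [forall l, absz (n l) != N.+1].
  apply: (ihN a n) => //; last by exists i.
  by move=> l; have := nN l; rewrite leq_eqVlt (negbTE (forallP none l)).
rewrite negbK in ni0; rewrite -/(goal a).
wlog ni0N : n nN rel i ni cnt ni0 / n i0 = N.+1%:Z.
  move=> H; have [pos|neg] := leP 0 (n i0).
    by apply: (H n nN rel i ni cnt ni0); lia.
  apply: (H (fun l => - n l) _ _ i); last lia.
  - by move=> l; rewrite abszN.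
  - apply/eqP; rewrite -oppr_eq0 -sumrN; apply/eqP; apply: etrans rel.
    by apply: eq_bigr => l _; rewrite mulrNz opprK.
  - by rewrite oppr_eq0.
  - by under eq_finset => l do rewrite abszN.
  - by rewrite abszN.
have nonneg (a' : 'I_r.+1 -> G) (n' : 'I_r.+1 -> int) : (forall l, P (a' l)) ->
    \sum_l a' l *~ n' l = 0 -> n' i0 = N.+1%:Z -> (forall l, 0 <= n' l) -> goal a'.
  move=> Pa' rel' n'N n'0.
  have Pterm l : P (a' l *~ n' l).
    by have := n'0 l; case: (n' l) => // u _; rewrite -pmulrn; exact: posMn.
  have a'0 : a' i0 = 0.
    have := pos_sum_eq0 Pterm rel' i0.
    by rewrite n'N -pmulrn; exact: pos_Mn_eq0.
  exists (fun l => a' (lift i0 l)) => [l|l]; first exact: Pa'.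
  case: (unliftP i0 l) => [l' ->|->]; last by rewrite a'0; exact: in_cone0.
  exact: (in_cone_gen (fun l => a' (lift i0 l))).
have [s] : exists s : nat, (#|[set i | (n i < 0)%R]%SET| <= s)%N.
  by exists #|[set i | (n i < 0)%R]%SET|.
elim: s a n Pa nN rel {i ni} cnt {ni0} ni0N => [|s ihs] a n Pa nN rel cnt ni0N neg.
  apply: (nonneg a n) => // l; rewrite leNgt; apply/negP => nl.
  by move: neg; rewrite leqn0 cards_eq0 => /eqP/finset.setP/(_ l); rewrite !inE nl.
have [/forallP n0|] := boolP [forall l, 0 <= n l]; first exact: (nonneg a n).
rewrite negb_forall => /existsP[j]; rewrite -ltNge => nj.
have i0j : i0 != j by apply: contraTneq nj => <-; rewrite ni0N.
have j0i : j != i0 by rewrite eq_sym.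
have nNj := nN j.
have [le|le] := pos_total (a j - a i0).
  have [|||||b Pb ab] := ihm (subst_gens a i0 j) (subst_coefs n i0 j) _ _ _ j.
  - move=> l; rewrite /subst_coefs; case: eqP => // _; lia.
  - exact: subst_gens_pos.
  - exact: subst_relation.
  - by rewrite /subst_coefs (negbTE j0i); lia.
  - rewrite -ltnS; apply: leq_trans cnt; apply: proper_card; apply/properP; split.
      apply/fintype.subsetP => l; rewrite !inE /subst_coefs; case: (l =P i0) => [->|_ //]; lia.
    exists i0; rewrite !inE ?ni0N // /subst_coefs eqxx; lia.
  by exists b => //; exact: subst_gens_cone ab.
rewrite opprB in le.
have [||||||b Pb ab] := ihs (subst_gens a j i0) (subst_coefs n j i0).
- exact: subst_gens_pos.
- move=> l; rewrite /subst_coefs; case: eqP => // _; lia.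
- exact: subst_relation.
- apply: leq_trans cnt; apply/subset_leq_card/fintype.subsetP => l.
  rewrite !inE /subst_coefs; case: (l =P j) => [->|_ //]; lia.
- by rewrite /subst_coefs (negbTE i0j).
- rewrite -ltnS; apply: leq_trans neg; apply: proper_card; apply/properP; split.
    apply/fintype.subsetP => l; rewrite !inE /subst_coefs; case: (l =P j) => [->|_ //]; lia.
  exists j; rewrite !inE // /subst_coefs eqxx; lia.
by exists b => //; exact: subst_gens_cone ab.
Qed.

Definition indep r (b : 'I_r -> G) : Prop :=
  forall n : 'I_r -> int, \sum_i b i *~ n i = 0 -> forall i, n i = 0.

Lemma independent_positive_basis r (a : 'I_r -> G) : (forall i, P (a i)) ->
  exists (s : nat) (b : 'I_s -> G),
    [/\ forall i, P (b i), indep b & forall i, in_cone b (a i)].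
Proof.
elim: r a => [|r ih] a Pa; first by exists 0%N, a; split=> // [n _|] [].
have [ind|/existsNP[n]] := pselect (indep a).
  by exists r.+1, a; split=> // i; exact: in_cone_gen.
move=> /not_implyP[rel /existsNP[i /eqP ni]].
have [|b Pb ab] := relation_elimination Pa rel; first by exists i.
have [s [c [Pc indc bc]]] := ih b Pb.
by exists s, c; split=> // l; exact: in_cone_trans (ab l).
Qed.

Definition comb r (b : 'I_r -> G) (x : 'rV[int]_r) : G := \sum_i b i *~ x 0 i.

Lemma comb_is_additive r (b : 'I_r -> G) : zmod_morphism (comb b).
Proof.
move=> x y; rewrite /comb -sumrB; apply: eq_bigr => i _.
by rewrite !mxE mulrzBr.
Qed.

HB.instance Definition _ r (b : 'I_r -> G) :=
  GRing.isZmodMorphism.Build 'rV[int]_r G (comb b) (comb_is_additive b).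

Lemma in_coneP r (b : 'I_r -> G) g : in_cone b g ->
  exists2 x : 'rV[int]_r, simplicial_cone x & comb b x = g.
Proof.
move=> [c ->]; exists (\row_i (c i)%:Z) => [i|]; first by rewrite mxE.
by apply: eq_bigr => i _; rewrite mxE -pmulrn.
Qed.

Lemma comb_pos r (b : 'I_r -> G) (x : 'rV[int]_r) : (forall i, P (b i)) ->
  simplicial_cone x -> P (comb b x).
Proof.
move=> Pb x0; apply: pos_sum => i; have := x0 i.
by case: (x 0 i) => // n _; rewrite -pmulrn; exact: posMn.
Qed.

Record stage := Stage {
  stage_rank : nat;
  stage_gens : 'I_stage_rank -> G;
  stage_pos : forall i, P (stage_gens i);
  stage_indep : indep stage_gens }.

Lemma stage_extend (S : stage) (x : G) : P x -> exists T : stage,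
  (forall i, in_cone (@stage_gens T) (@stage_gens S i)) /\ in_cone (@stage_gens T) x.
Proof.
move=> Px; pose a (i : 'I_(stage_rank S).+1) := oapp (@stage_gens S) x (unlift ord0 i).
have [|s [b [Pb indb ab]]] := @independent_positive_basis _ a.
  by move=> i; rewrite /a; case: unlift => [j|] //=; exact: stage_pos.
exists (Stage Pb indb); split=> [i|] /=.
  by have := ab (lift ord0 i); rewrite /a liftK.
by have := ab ord0; rewrite /a unlift_none.
Qed.

(** The independent generators make the maps from the simplicial groups to the
    limit injective. *)
Lemma countable_ordered_dimension_group : countable [set: G] -> dimension_group P.
Proof.
move=> cG.
have [g Pg gP] : exists2 g : nat -> G, (forall n, P (g n)) & forall x, P x -> exists n, g n = x.
  have /countable_injP[f finj] := cG.
  have /choice[g hg] : forall n : nat, exists x : G, P x /\ forall y, P y -> f y = n -> y = x.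
    move=> n; have [[y [Py fy]]|none] := pselect (exists y, P y /\ f y = n).
      by exists y; split=> // z Pz fz; apply: finj; rewrite ?inE // fy.
    exists 0; split; first exact: pos0.
    by move=> y Py fy; case: none; exists y.
  exists g => [n|x Px]; first by case: (hg n).
  by exists (f x); apply/esym; apply: (proj2 (hg (f x))).
have S0 : stage by exists 0%N (fun=> 0) => [[]|n _ []].
have /choice[next nextP] : forall nS : nat * stage, exists T : stage,
    (forall i, in_cone (@stage_gens T) (@stage_gens nS.2 i)) /\
    in_cone (@stage_gens T) (g nS.1).
  by move=> [n S]; exact: stage_extend.
pose S := fix S n := if n is n'.+1 then next (n', S n') else S0.
pose r n := stage_rank (S n); pose b n : 'I_(r n) -> G := @stage_gens (S n).
have bS n i : in_cone (b n.+1) (b n i) by have [h _] := nextP (n, S n); exact: h.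
have bg n : in_cone (b n.+1) (g n) by have [_] := nextP (n, S n).
have rows n : exists M : 'M[int]_(r n, r n.+1),
    (forall i j, 0 <= M i j) /\ forall i, comb (b n.+1) (row i M) = b n i.
  have /choice[x hx] : forall i, exists x : 'rV[int]_(r n.+1),
      simplicial_cone x /\ comb (b n.+1) x = b n i.
    by move=> i; have [x x0 xb] := in_coneP (bS n i); exists x.
  exists (\matrix_i x i); split=> i; first by move=> j; rewrite mxE; case: (hx i).
  by rewrite rowK; case: (hx i).
pose M n := projT1 (cid (rows n)).
have M0 n i j : 0 <= M n i j by case: (projT2 (cid (rows n))) => h _; exact: h.
have Mb n i : comb (b n.+1) (row i (M n)) = b n i.
  by case: (projT2 (cid (rows n))) => _; exact.
have compat n (x : 'rV[int]_(r n)) : comb (b n.+1) (x *m M n) = comb (b n) x.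
  rewrite {2}/comb; under eq_bigr => i _ do rewrite -Mb.
  rewrite /comb; under [RHS]eq_bigr => i _ do rewrite mulrz_suml.
  rewrite [RHS]exchange_big /=; apply: eq_bigr => j _.
  rewrite mxE mulrz_sumr; apply: eq_bigr => i _.
  by rewrite mxE mulrzA_C.
have posP g0 : P g0 <-> exists n (x : 'rV[int]_(r n)), simplicial_cone x /\ comb (b n) x = g0.
  split=> [/gP[n <-]|[n [x [x0 <-]]]]; last by apply: comb_pos x0 => i; exact: stage_pos.
  by have [x x0 xg] := in_coneP (bg n); exists n.+1, x.
exists r, (fun n => mulmxr (M n) : {additive 'rV[int]_(r n) -> 'rV[int]_(r n.+1)}).
exists (fun n => comb (b n) : {additive 'rV[int]_(r n) -> G}); split.
- move=> n x x0 j; rewrite /= mxE; apply: sumr_ge0 => i _.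
  by rewrite mulr_ge0.
- by move=> n x; exact: compat.
- move=> x; have [/posP[n [y [_ <-]]]|/posP[n [y [_ yx]]]] := pos_total x.
    by exists n, y.
  by exists n, (- y); rewrite raddfN /= yx opprK.
- move=> n x x0; exists 0%N => /=; apply/rowP => i.
  by rewrite mxE; exact: (stage_indep x0 i).
- exact: posP.
Qed.

End OrderedGroup.

(** * The ordered K_0-group *)

Section KTheory.
Variables (R : realType) (A : cstarAlgType R).
Implicit Types p q r : projection A.

(* Unqualified, [proj_mx] is the matrix of the projection along a complement. *)
Local Notation pmx := Defs.proj_mx.
Local Notation cls := (@mvn_class R A).

Lemma cls_proj_sum p q : cls (proj_sum p q) = cls p + cls q.
Proof. by rewrite -mvn_classD. Qed.

Lemma groth_diffD (M : nmodType) (x y x' y' : M) :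
  groth_diff x y + groth_diff x' y' = groth_diff (x + x') (y + y').
Proof. exact: groth_addE. Qed.

Lemma groth_diffN (M : nmodType) (x y : M) : - groth_diff x y = groth_diff y x.
Proof. exact: groth_oppE. Qed.

Lemma K0_class_sum p q : K0_class (proj_sum p q) = K0_class p + K0_class q.
Proof. by rewrite /K0_class cls_proj_sum groth_diffD addr0. Qed.

Lemma cls_proj0 p : pmx p = 0 -> cls p = 0.
Proof.
move=> p0; apply/mvn_classP; exists 0.
by rewrite adjmx0 mul0mx mulmx0 p0.
Qed.

Lemma K0_class_proj0 p : pmx p = 0 -> K0_class p = 0.
Proof. by move=> p0; rewrite /K0_class cls_proj0. Qed.

Lemma K0_class_cls p q : cls p = cls q -> K0_class p = K0_class q.
Proof. by rewrite /K0_class => ->. Qed.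

Lemma K0_class_add_cls p q r : cls p + cls r = cls q ->
  K0_class p + K0_class r = K0_class q.
Proof. by rewrite -cls_proj_sum -K0_class_sum; exact: K0_class_cls. Qed.

Lemma groth_diff_cls p q : groth_diff (cls p) (cls q) = K0_class p - K0_class q.
Proof. by rewrite /K0_class groth_diffN groth_diffD addr0 add0r. Qed.

Lemma K0_ind (Q : K0 A -> Prop) :
  (forall p q, Q (K0_class p - K0_class q)) -> forall g, Q g.
Proof.
move=> h; elim/groth_ind; elim/mvn_ind => p; elim/mvn_ind => q.
by rewrite groth_diff_cls.
Qed.

Lemma mvn_zero p q : mvn_equiv (pmx p) (pmx q) -> pmx q = 0 -> pmx p = 0.
Proof.
case: (projP p) => _ pp [v [v1 v2]] q0.
by rewrite -pp -v1 -!mulmxA (mulmxA v) v2 q0 mul0mx mulmx0.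
Qed.

Lemma mvn_orthogonal_sum k (p q : 'M[A]_k) : is_projection p -> is_projection q ->
  p *m q = 0 -> mvn_equiv (dsum p q) (p + q).
Proof.
move=> [pa pp] [qa qq] pq; exists (row_mx p q).
have qp : q *m p = 0 by have := congr1 (@adjmx _ _ _ _) pq; rewrite adjmxM pa qa adjmx0.
have -> : adjmx (row_mx p q) = col_mx p q.
  by rewrite -[in RHS]pa -[in RHS]qa /adjmx tr_row_mx map_col_mx.
by rewrite mul_col_row mul_row_col pp qq pq qp.
Qed.

(** The range projection of [w *m p] splits off from [q]. *)
Lemma subequiv_complement k (k0 : (0 < k)%N) (p q w : 'M[A]_k)
    (pP : is_projection p) (qP : is_projection q) :
  adjmx w *m w = p -> q *m w = w ->
  exists s (sP : is_projection s) (rP : is_projection (q - s)),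
  [/\ q *m s = s, mvn_equiv p s &
    cls (Projection k0 pP) + cls (Projection k0 rP) = cls (Projection k0 qP)].
Proof.
move=> ww qw; pose u := w *m p.
have uu : adjmx u *m u = p.
  by rewrite adjmxM (proj1 pP) -mulmxA (mulmxA _ w) ww !(proj2 pP).
have up : u *m p = u by rewrite -mulmxA (proj2 pP).
have qu : q *m u = u by rewrite mulmxA qw.
have sP : is_projection (u *m adjmx u).
  split; first by rewrite adjmxM adjmxK.
  by rewrite -mulmxA (mulmxA _ u) uu mulmxA up.
have qs : q *m (u *m adjmx u) = u *m adjmx u by rewrite mulmxA qu.
have rP := is_projectionB qP sP qs.
have ps : mvn_equiv p (u *m adjmx u) by exists u.
exists (u *m adjmx u), sP, rP; split=> //.
have -> : cls (Projection k0 pP) = cls (Projection k0 sP) by apply/mvn_classP.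
rewrite -cls_proj_sum; apply/mvn_classP => /=.
have := @mvn_orthogonal_sum _ (u *m adjmx u) (q - u *m adjmx u) sP rP.
rewrite (addrC (u *m adjmx u) (q - _)) subrK; apply.
have sq : u *m adjmx u *m q = u *m adjmx u.
  by have := congr1 (@adjmx _ _ _ _) qs; rewrite adjmxM (proj1 sP) (proj1 qP).
by rewrite mulmxBr sq (proj2 sP) subrr.
Qed.

Lemma dsum_eq0 m n (p : 'M[A]_m) (q : 'M[A]_n) : dsum p q = 0 -> p = 0 /\ q = 0.
Proof.
rewrite /dsum -[0 in RHS]submxK => /eq_block_mx[-> _ _ ->].
by split; apply/matrixP => i j; rewrite !mxE.
Qed.

Definition pad_right p q := proj_sum p (Projection (proj_dim_gt0 q) (@is_projection0 R A _)).
Definition pad_left p q := proj_sum (Projection (proj_dim_gt0 p) (@is_projection0 R A _)) q.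

Lemma cls_pad_right p q : cls (pad_right p q) = cls p.
Proof. by rewrite cls_proj_sum [X in _ + X]cls_proj0 // addr0. Qed.

Lemma cls_pad_left p q : cls (pad_left p q) = cls q.
Proof. by rewrite cls_proj_sum [X in X + _]cls_proj0 // add0r. Qed.

Lemma cls_eta p (k0 : (0 < proj_dim p)%N) : cls (Projection k0 (projP p)) = cls p.
Proof. by apply/mvn_classP/mvn_refl/projP. Qed.

Hypothesis comparable : forall k (p q : 'M[A]_k), is_projection p -> is_projection q ->
  (exists w : 'M[A]_k, adjmx w *m w = p /\ q *m w = w) \/
  (exists w : 'M[A]_k, adjmx w *m w = q /\ p *m w = w).

Lemma cls_comparable p q :
  (exists r, cls p + cls r = cls q) \/ (exists r, cls q + cls r = cls p).
Proof.
have [[w [w1 w2]]|[w [w1 w2]]] := comparable (projP (pad_right p q)) (projP (pad_left p q)).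
  have [s [sP [rP [_ _ e]]]] := subequiv_complement (proj_sum_gt0 p q)
    (projP (pad_right p q)) (projP (pad_left p q)) w1 w2.
  left; exists (Projection (proj_sum_gt0 p q) rP).
  by rewrite -(cls_pad_right p q) -[RHS](cls_pad_left p q);
    rewrite (@cls_eta (pad_left p q)) (@cls_eta (pad_right p q)) in e.
have [s [sP [rP [_ _ e]]]] := subequiv_complement (proj_sum_gt0 p q)
  (projP (pad_left p q)) (projP (pad_right p q)) w1 w2.
right; exists (Projection (proj_sum_gt0 p q) rP).
by rewrite -(cls_pad_left p q) -[RHS](cls_pad_right p q);
  rewrite (@cls_eta (pad_left p q)) (@cls_eta (pad_right p q)) in e.
Qed.

Hypothesis finite : forall k (v : 'M[A]_k), adjmx v *m v = 1%:M -> v *m adjmx v = 1%:M.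

(** An equivalence of [b] with a subprojection [a] extends by 1 - b to an
    isometry. *)
Lemma finite_subprojection k (a b v : 'M[A]_k) : is_projection a -> is_projection b ->
  b *m a = a -> adjmx v *m v = b -> v *m adjmx v = a -> a = b.
Proof.
move=> [aa a2] [ba b2] bA vb va.
have ab : a *m b = a by have := congr1 (@adjmx _ _ _ _) bA; rewrite adjmxM aa ba.
(* Unlike [v], this partial isometry visibly satisfies [u *m b = u]. *)
pose u := a *m v *m b.
have uu : adjmx u *m u = b.
  rewrite /u !adjmxM aa ba -!mulmxA (mulmxA a a) a2 -va !mulmxA -(mulmxA b) vb b2.
  by rewrite -(mulmxA b) vb !b2.
have uu' : u *m adjmx u = a.
  rewrite /u !adjmxM aa ba -!mulmxA (mulmxA b b) b2 -vb !mulmxA -(mulmxA a) va a2.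
  by rewrite -(mulmxA a) va !a2.
have ub : u *m b = u by rewrite -mulmxA b2.
have au : a *m u = u by rewrite !mulmxA a2.
have [c cE] : exists c : 'M[A]_k, c = 1%:M - b by exists (1%:M - b).
have cc : c *m c = c by rewrite cE mulmxBl mul1mx mulmxBr mulmx1 b2 subrr subr0.
have cu : c *m u = 0 by rewrite -au mulmxA cE mulmxBl mul1mx bA subrr mul0mx.
have uc : u *m c = 0 by rewrite cE mulmxBr mulmx1 ub subrr.
have ca : adjmx c = c by rewrite cE adjmxB adjmx1 ba.
have uc' : adjmx u *m c = 0 by rewrite -ca -adjmxM cu adjmx0.
have cu' : c *m adjmx u = 0 by rewrite -ca -adjmxM uc adjmx0.
have := @finite _ (u + c).
rewrite adjmxD ca !(mulmxDl, mulmxDr) uu uu' cc cu uc uc' cu' !addr0 !add0r.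
rewrite cE [b + _]addrC subrK => /(_ erefl) /eqP.
by rewrite addrCA -subr_eq0 addrAC subrr add0r subr_eq0 => /eqP.
Qed.

(** A projection of class 0 is absorbed, up to equivalence, by some other
    projection [r]; by finiteness it vanishes. *)
Lemma K0_class_eq0 p : K0_class p = 0 -> pmx p = 0.
Proof.
rewrite -[RHS]/(groth_diff 0 0) => /groth_diffP[]; elim/mvn_ind => r.
rewrite !addr0 add0r -cls_proj_sum => /mvn_classP/= h.
pose z : 'M[A]_(proj_dim p) := 0.
have zP : is_projection (dsum z (pmx r)).
  by apply: is_projectionD; [exact: is_projection0|exact: projP].
have bP := is_projectionD (projP p) (projP r).
have [v [v1 v2]] : mvn_equiv (dsum (pmx p) (pmx r)) (dsum z (pmx r)).
  by apply: (mvn_trans bP zP h); apply/mvn_sym/mvn0/projP.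
have := finite_subprojection zP bP _ v1 v2.
rewrite /dsum mulmx_block !mul0mx !mulmx0 !addr0 !add0r (proj2 (projP r)) => /(_ erefl).
by move/eq_block_mx => [].
Qed.

Lemma K0_totally_ordered : totally_ordered_group (K0_pos A).
Proof.
have pos0 : K0_pos A 0 by exists (proj_zero A).
have posD x y : K0_pos A x -> K0_pos A y -> K0_pos A (x + y).
  by move=> [p _ <-] [q _ <-]; exists (proj_sum p q) => //; rewrite K0_class_sum.
split=> [g|g h [p _ pE] [q _ qE]|g h k le1 le2|g h|g h k].
- by rewrite /cone_le subrr.
- have e : K0_class (proj_sum p q) = 0 by rewrite K0_class_sum pE qE addrA subrK subrr.
  have /K0_class_eq0/dsum_eq0[p0 _] := e.
  by apply/esym/eqP; rewrite -subr_eq0 -pE K0_class_proj0.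
- by rewrite /cone_le -(subrK h k) -addrA; exact: posD.
- rewrite /cone_le -[g - h]opprB; elim/K0_ind: (h - g) => p q.
  have [[r]|[r]] := cls_comparable p q => /K0_class_add_cls <-.
    by right; rewrite opprB addrAC subrr add0r; exists r.
  by left; rewrite addrAC subrr add0r; exists r.
- by rewrite /cone_le opprD addrACA subrr addr0.
Qed.

Hypothesis minimal : exists e : 'M[A]_1, [/\ is_projection e, e <> 0 &
  forall q : 'M[A]_1, is_projection q -> e *m q = q -> q = 0 \/ q = e].

(** Comparability reduces minimality among all nonzero projections to
    minimality among the subprojections of [e] in [A]. *)
Lemma least_projection : exists e : projection A, pmx e <> 0 /\
  forall q, pmx q <> 0 -> exists r, cls e + cls r = cls q.
Proof.
have [e [eP e0 emin]] := minimal.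
pose e' := Projection (ltn0Sn 0) eP.
exists e'; split=> // q q0.
have [[w [w1 w2]]|[w [w1 w2]]] := comparable (projP (pad_right e' q)) (projP (pad_left e' q)).
  have [s [sP [rP [_ _ h]]]] := subequiv_complement (proj_sum_gt0 e' q)
    (projP (pad_right e' q)) (projP (pad_left e' q)) w1 w2.
  exists (Projection (proj_sum_gt0 e' q) rP).
  by rewrite -(cls_pad_right e' q) -[RHS](cls_pad_left e' q);
    rewrite (@cls_eta (pad_left e' q)) (@cls_eta (pad_right e' q)) in h.
have [s [sP [rP [es qs h]]]] := subequiv_complement (proj_sum_gt0 e' q)
  (projP (pad_left e' q)) (projP (pad_right e' q)) w1 w2.
exists (proj_zero A); rewrite (@cls_proj0 (proj_zero A) erefl) addr0.
rewrite -(cls_pad_right e' q) -[RHS](cls_pad_left e' q); apply/mvn_classP.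
have sq0 : s <> 0.
  move=> s0; apply: q0; rewrite s0 in qs.
  have := @mvn_zero (pad_left e' q) (Projection (proj_sum_gt0 e' q) (@is_projection0 R A _)) qs erefl.
  by case/dsum_eq0.
apply: mvn_sym; suff -> : pmx (pad_right e' q) = s by [].
move: s sP es sq0 {rP h qs w w1 w2}; rewrite /= => s sP es s0.
rewrite -(submxK s) in sP es s0 *.
move: (@ulsubmx _ 1 _ 1 _ s) (@ursubmx _ 1 _ 1 _ s) (@dlsubmx _ 1 _ 1 _ s) (@drsubmx _ 1 _ 1 _ s)
  sP es s0 => a b c d [sa ss] es s0.
move: es; rewrite /dsum mulmx_block !mul0mx !addr0 => /eq_block_mx[ea _ c0 d0].
move: sa ss s0; rewrite -c0 -d0 adjmx_block !adjmx0 => /eq_block_mx[aa ab _ _].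
rewrite -ab mulmx_block !mulmx0 !mul0mx !addr0 => /eq_block_mx[a2 _ _ _] s0.
have [a0|->//] := emin a (conj aa a2) ea.
by case: s0; rewrite a0 block_mx0.
Qed.

Lemma K0_successor (g : K0 A) : exists s, is_successor (K0_pos A) g s.
Proof.
have [e [e0 emin]] := least_projection.
exists (g + K0_class e); split.
  split; first by rewrite /cone_le addrAC subrr add0r; exists e.
  move/eqP; rewrite -subr_eq0 opprD addrA subrr sub0r oppr_eq0 => /eqP.
  by move/K0_class_eq0.
move=> h [[p _ pE] gh].
have p0 : pmx p <> 0.
  by move=> /K0_class_proj0; rewrite pE => /eqP; rewrite subr_eq0 => /eqP hg; case: gh.
have [r /K0_class_add_cls er] := emin p p0.
by exists r => //; rewrite opprD addrA -pE -er addrAC subrr add0r.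
Qed.

Lemma K0_predecessor (g : K0 A) : exists s, is_predecessor (K0_pos A) g s.
Proof.
have [e [e0 emin]] := least_projection.
exists (g - K0_class e); split.
  split; first by rewrite /cone_le opprB addrCA subrr addr0; exists e.
  move/eqP; rewrite -subr_eq0 addrAC subrr add0r oppr_eq0 => /eqP.
  by move/K0_class_eq0.
move=> h [[p _ pE] gh].
have p0 : pmx p <> 0.
  by move=> /K0_class_proj0; rewrite pE => /eqP; rewrite subr_eq0 => /eqP hg; case: gh.
have [r /K0_class_add_cls er] := emin p p0.
by exists r => //; rewrite addrAC -pE -er addrAC subrr add0r.
Qed.

Lemma K0_class_close k (k0 : (0 < k)%N) (p q : 'M[A]_k)
    (pP : is_projection p) (qP : is_projection q) :
  mnorm p * mnorm p * mnorm (p - q) <= 2^-1 ->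
  mnorm q * mnorm q * mnorm (p - q) <= 2^-1 ->
  K0_class (Projection k0 pP) = K0_class (Projection k0 qP).
Proof.
have half (p' q' : 'M[A]_k) (p'P : is_projection p') (q'P : is_projection q') :
    mnorm p' * mnorm p' * mnorm (p' - q') <= 2^-1 ->
    cone_le (K0_pos A) (K0_class (Projection k0 p'P)) (K0_class (Projection k0 q'P)).
  move=> /(close_subprojection p'P q'P)[w [w1 w2]].
  have [s [sP [rP [_ _ /K0_class_add_cls <-]]]] := subequiv_complement k0 p'P q'P w1 w2.
  by rewrite /cone_le addrAC subrr add0r; eexists.
move=> h1; rewrite mnormBC => h2; apply: (cone_le_anti K0_totally_ordered); exact: half.
Qed.

(** The class of a projection is determined by its size, a bound N for its norm
    and an approximation, within a tolerance that depends on N only, by a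
    matrix over a countable dense subset. *)
Lemma separable_K0_countable : separable A -> countable [set: K0 A].
Proof.
move=> [s sdense].
pose tol (N : nat) : R := (4 * N.+1%:R * N.+1%:R)^-1.
have tol0 N : 0 < tol N by rewrite invr_gt0 !mulr_gt0.
pose T := (nat * nat * seq (seq nat))%type.
pose code (t : T) p := [/\ proj_dim p = t.1.1, mnorm (pmx p) <= t.1.2%:R &
  mnorm (pmx p - \matrix_(i, j) s (nth 0%N (nth [::] t.2 i) j)) <= tol t.1.2].
have has_code p : exists t, code t p.
  have [N hN] : exists N : nat, mnorm (pmx p) <= N%:R.
    exists (Num.truncn (mnorm (pmx p))).+1.
    by apply: ltW; exact: truncnS_gt.
  pose k := proj_dim p.
  pose d := tol N / (k * k).+1%:R; have d0 : 0 < d by rewrite divr_gt0.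
  have /choice[f hf] : forall ij : 'I_k * 'I_k, exists n, cnorm (pmx p ij.1 ij.2 - s n) < d.
    by move=> ij; exact: sdense.
  exists (k, N, [seq [seq f (i, j) | j <- enum 'I_k] | i <- enum 'I_k]); split=> //=.
  apply: (@le_trans _ _ ((k * k)%:R * d)).
    apply: mnorm_ball => i j; rewrite !mxE (nth_map i) ?size_enum_ord //.
    by rewrite (nth_map j) ?size_enum_ord // !nth_ord_enum ltW //; exact: (hf (i, j)).
  by rewrite mulrCA ger_pMr // ler_pdivrMr // mul1r ler_nat.
have code_inj t p q : code t p -> code t q -> K0_class p = K0_class q.
  case: t => [[k N] a]; case: p => m p m0 pP; case: q => n q n0 qP.
  move=> [/= mk pN pa] [/= nk qN qa].
  subst m n; rewrite (bool_irrelevance n0 m0).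
  have pq : mnorm (p - q) <= tol N + tol N.
    apply: le_trans (lerD pa qa); rewrite [X in _ <= _ + X]mnormBC.
    exact: mnorm_trans.
  have small (x : 'M[A]_k) : mnorm x <= N%:R -> mnorm x * mnorm x * mnorm (p - q) <= 2^-1.
    move=> xN; apply: (@le_trans _ _ (N.+1%:R * N.+1%:R * (tol N + tol N))).
      have xN1 : mnorm x <= N.+1%:R by apply: (le_trans xN); rewrite ler_nat.
      by apply: ler_pM; rewrite ?mulr_ge0 ?mnorm_ge0 // ler_pM ?mnorm_ge0.
    have N0 : N.+1%:R != 0 :> R by rewrite pnatr_eq0.
    by rewrite le_eqVlt; apply/orP; left; apply/eqP; rewrite /tol; field.
  by apply: K0_class_close; exact: small.
have /choice[f hf] : forall g : K0 A, exists tu : T * T, exists p q,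
    [/\ code tu.1 p, code tu.2 q & g = K0_class p - K0_class q].
  elim/K0_ind => p q; have [t tp] := has_code p; have [u uq] := has_code q.
  by exists (t, u), p, q.
apply/countable_injP; exists (pickle \o f) => g h _ _ /= /(pcan_inj (@pickleK _)) fgh.
have [p [q [tp uq ->]]] := hf g; have [p' [q' [tp' uq' ->]]] := hf h.
rewrite fgh in tp uq.
by rewrite (code_inj _ _ _ tp tp') (code_inj _ _ _ uq uq').
Qed.

End KTheory.

Theorem corollary6p3 (R : realType) (A : cstarAlgType R)
    (hA : pseudomatricial A) :
  [/\ totally_ordered_group (K0_pos A),
      forall g : K0 A, exists s : K0 A, is_successor (K0_pos A) g s,
      forall g : K0 A, exists s : K0 A, is_predecessor (K0_pos A) g s &
      separable A ->
        [/\ countable [set: K0 A],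
            totally_ordered_group (K0_pos A) &
            dimension_group (K0_pos A)]].
Proof.
have comparable k (p q : 'M[A]_k) := @pseudomatricial_comparable R k A p q hA.
have finite k (v : 'M[A]_k) := @pseudomatricial_finite R k A v hA.
have minimal := pseudomatricial_minimal_projection hA.
have ordered := K0_totally_ordered comparable finite.
split=> //.
- exact: K0_successor.
- exact: K0_predecessor.
- move=> /(separable_K0_countable comparable finite) countableK; split=> //.
  exact: countable_ordered_dimension_group.
Qed.
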